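(* Let $(\mathfrak g,A)$ be a $7$-dimensional almost Abelian Lie algebra with Lie bracket $A\in\mathfrak{gl}(\mathbb R^6)$, and let $\varphi$ be a coclosed $\mathrm G_2$-structure on $\mathfrak g$ whose induced metric is not flat. Then the solution $\varphi(t)$ of the (invariant) Laplacian coflow starting at $\varphi(0)=\varphi$ is immortal, i.e. it is defined for all $t\in(\varepsilon_1,\infty)$, for some $\varepsilon_1<0$ (possibly $-\infty$).
   Context: A $7$-dimensional Lie algebra $\mathfrak g$ is almost Abelian if it has an Abelian ideal $\mathfrak h$ of codimension one. A $\mathrm G_2$-structure on $\mathfrak g$ (equivalently a left-invariant one on the simply connected Lie group $G_A$ with Lie algebra $\mathfrak g$) is a $3$-form $\varphi\in\Lambda^3\mathfrak g^*$ linearly equivalent to $e^{123}+e^{145}+e^{167}+e^{246}-e^{257}-e^{347}-e^{356}$; it induces an inner product and an orientation by $6\,g(X,Y)\,\mathrm{vol}=(X\lrcorner\varphi)\wedge(Y\lrcorner\varphi)\wedge\varphi$, a Hodge star $*$ and the dual $4$-form $\psi=*\varphi$. One can choose an orthonormal basis $e_1,\dots,e_7$ with $e_7\perp\mathfrak h\cong\mathbb R^6$ and $\varphi=\omega\wedge e^7+\rho^+$, where $\omega=e^{12}+e^{34}+e^{56}$ and $\rho^+=e^{135}-e^{146}-e^{245}-e^{236}$. The Lie bracket is encoded by $A:=\mathrm{ad}(e_7)|_{\mathfrak h}\in\mathfrak{gl}(\mathbb R^6)$. The structure $\varphi$ is coclosed if $\mathrm d\psi=0$. The invariant Laplacian coflow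 is the ODE $\frac{d}{dt}\psi(t)=\Delta_{t}\psi(t)$ on $\Lambda^4\mathfrak g^*$, where $\psi(t)=*_{t}\varphi(t)$ and $\Delta_t=\mathrm d\mathrm d^{*_t}+\mathrm d^{*_t}\mathrm d$ is the Hodge Laplacian of the metric induced by $\varphi(t)$, with $\mathrm d$ the exterior derivative of left-invariant forms. The solution is taken on its maximal interval of existence containing $0$. *)

(* Defs.v *)
From HB Require Import structures.
From mathcomp Require Import all_boot all_order all_algebra all_fingroup.
From mathcomp Require Import all_classical all_reals all_analysis.

Set Implicit Arguments.
Unset Strict Implicit.
Unset Printing Implicit Defensive.

Import Order.TTheory GRing.Theory Num.Theory.
Import numFieldNormedType.Exports.

Local Open Scope ring_scope.

Section Forms.
Variables (R : realType) (g : vectType R).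
Implicit Types (br nabla : g -> g -> g) (m : g -> g -> R).

(* A k-form is its evaluation map on k-tuples of vectors. Multilinearity and
   alternation are not part of the type: G2-structures are given below by an
   explicit coframe expression, and all the operations preserve alternating
   multilinear maps. *)
Definition form (k : nat) : Type := ('I_k -> g) -> R.

Definition catv (k l : nat) (u : 'I_k -> g) (v : 'I_l -> g) : 'I_(k + l) -> g :=
  fun i => match fintype.split i with inl a => u a | inr b => v b end.

(* Normalised so that (e^1 /\ e^2)(u, v) = e^1(u) e^2(v) - e^2(u) e^1(v). *)
Definition wedge (k l : nat) (a : form k) (b : form l) : form (k + l) := fun v =>
  (k`!%:R * l`!%:R)^-1 *
  \sum_(s : 'S_(k + l)) (-1) ^+ s *
    a (fun i => v (s (lshift l i))) * b (fun j => v (s (rshift k j))).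

Definition contract (k : nat) (x : g) (a : form (1 + k)) : form k :=
  fun v => a (catv (fun=> x) v).

Definition lie_bracket br : Prop :=
  [/\ forall x, linear (br x),
      forall y, linear (br^~ y),
      forall x, br x x = 0
    & forall x y z, br x (br y z) + br y (br z x) + br z (br x y) = 0].

Definition almost_abelian br : Prop :=
  exists h : {vspace g},
    [/\ (\dim h).+1 = \dim {:g},
        forall x y, y \in h -> br x y \in h
      & forall x y, x \in h -> y \in h -> br x y = 0].

(* Chevalley-Eilenberg differential:
     (d a)(v_0, .., v_k) =
       sum_(i < j) (-1)^(i + j) a([v_i, v_j], v_0, .. ^v_i .. ^v_j .., v_k),
   where, for i < j, the vector [v_i, v_j] is moved to the i-th slot, which
   absorbs the sign (-1)^i; on 1-forms, (d a)(x, y) = - a([x, y]). *)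
Definition ext_d br (k : nat) (a : form k) : form k.+1 := fun v =>
  \sum_(j < k.+1) \sum_(i < k | (i < j)%N)
    (-1) ^+ j *
    a (fun l => if l == i then br (v (lift j i)) (v j) else v (lift j l)).

Definition inner_product m : Prop :=
  [/\ forall x, scalar (m x),
      forall x y, m x y = m y x
    & forall x, x != 0 -> 0 < m x x].

Definition orthonormal m (n : nat) (e : 'I_n -> g) : Prop :=
  forall i j, m (e i) (e j) = (i == j)%:R.

Definition gram m : 'M[R]_(\dim {:g}) :=
  \matrix_(i, j) m (vbasis {:g})`_i (vbasis {:g})`_j.

(* In index notation
     ( *a)_(j_1 .. j_l) = 1/k! a^(i_1 .. i_k) vol_(i_1 .. i_k j_1 .. j_l),
   the indices of a being raised with the inverse metric; the result does not
   depend on the basis, and b /\ *a = <b, a> vol for all k-forms b. *)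
Definition hodge m (k l : nat) (vol : form (k + l)) (a : form k) : form l :=
  fun v => k`!%:R^-1 *
  \sum_(I : {ffun 'I_k -> 'I_(\dim {:g})})
  \sum_(J : {ffun 'I_k -> 'I_(\dim {:g})})
    (\prod_(r < k) invmx (gram m) (I r) (J r)) *
    a (fun r => (vbasis {:g})`_(I r)) *
    vol (catv (fun r => (vbasis {:g})`_(J r)) v).

Definition levi_civita br m nabla : Prop :=
  [/\ forall x, linear (nabla x),
      forall y, linear (nabla^~ y),
      forall x y, nabla x y - nabla y x = br x y
    & forall x y z, m (nabla x y) z + m y (nabla x z) = 0].

Definition flat br m : Prop :=
  exists nabla, levi_civita br m nabla /\
    forall x y z,
      nabla x (nabla y z) - nabla y (nabla x z) - nabla (br x y) z = 0.

(* e^i for 1 <= i <= 7, the coframe dual to the basis b. *)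
Definition coframe (b : 7.-tuple g) (i : nat) : form 1 :=
  fun v => coord b (inord i.-1) (v ord0).

Definition coframe3 (b : 7.-tuple g) (i j k : nat) : form 3 :=
  wedge (wedge (coframe b i) (coframe b j)) (coframe b k).

Definition standard_g2 (b : 7.-tuple g) : form 3 := fun v =>
  coframe3 b 1 2 3 v + coframe3 b 1 4 5 v + coframe3 b 1 6 7 v
  + coframe3 b 2 4 6 v - coframe3 b 2 5 7 v - coframe3 b 3 4 7 v
  - coframe3 b 3 5 6 v.

Definition is_g2_form (phi : form 3) : Prop :=
  exists2 b : 7.-tuple g, basis_of {:g} b & phi =1 standard_g2 b.

(* vol is the Riemannian volume form of m for the orientation it defines; it is
   alternating multilinear by the last equation. A form phi satisfying
   is_g2_form induces exactly one such pair (m, vol). *)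
Definition g2_induces (phi : form 3) m (vol : form 7) : Prop :=
  [/\ inner_product m,
      forall e : 'I_7 -> g, orthonormal m e -> `|vol e| = 1
    & forall x y v, 6 * m x y * vol v =
        wedge (wedge (contract (k := 2) x phi) (contract (k := 2) y phi)) phi v].

(* The metric and the volume form are determined by g2_form. *)
Record g2_structure := G2Structure {
  g2_form : form 3;
  g2_metric : g -> g -> R;
  g2_vol : form 7;
  g2_formP : is_g2_form g2_form;
  g2_inducesP : g2_induces g2_form g2_metric g2_vol }.

Implicit Types (p : g2_structure) (P : R -> g2_structure).

Definition psi p : form 4 := hodge (k := 3) (g2_metric p) (g2_vol p) (g2_form p).

Definition coclosed br p : Prop := forall v, ext_d br (psi p) v = 0.

(* On k-forms in dimension 7, d^* = (-1)^k * d *. *)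
Definition codiff4 br p (a : form 4) : form 3 :=
  hodge (k := 4) (g2_metric p) (g2_vol p)
    (ext_d br (hodge (k := 4) (l := 3) (g2_metric p) (g2_vol p) a)).

Definition codiff5 br p (a : form 5) : form 4 := fun v =>
  - hodge (k := 3) (g2_metric p) (g2_vol p)
    (ext_d br (hodge (k := 5) (l := 2) (g2_metric p) (g2_vol p) a)) v.

Definition hodge_laplacian4 br p (a : form 4) : form 4 := fun v =>
  ext_d br (codiff4 br p a) v + codiff5 br p (ext_d br a) v.

(* Solutions on the open interval ]a, b[ containing 0; values of P outside
   ]a, b[ are irrelevant. Derivatives in the finite-dimensional space of 4-forms
   are taken pointwise. The continuity of the 3-forms is needed because psi only
   determines phi up to sign: without it P could jump between phi and - phi. *)
Definition coflow_solution br p (a b : \bar R) P : Prop :=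
  [/\ (a < 0%:E)%E, (0%:E < b)%E,
      g2_form (P 0) =1 g2_form p
    & forall t : R, (a < t%:E)%E -> (t%:E < b)%E ->
        (forall v, {for t, continuous (fun s : R => g2_form (P s) v)}) /\
        (forall v, is_derive t (1 : R) (fun s : R => psi (P s) v)
                     (hodge_laplacian4 br (P t) (psi (P t)) v))].

Definition maximal_coflow_solution br p (a b : \bar R) P : Prop :=
  coflow_solution br p a b P /\
  forall (a' b' : \bar R) P', coflow_solution br p a' b' P' ->
    [/\ (a <= a')%E, (b' <= b)%E
      & forall t : R, (a' < t%:E)%E -> (t%:E < b')%E ->
          g2_form (P' t) =1 g2_form (P t)].

End Forms.

(* Main.v *)
From Pilot Require Import Defs.
From HB Require Import structures.
From mathcomp Require Import all_boot all_order all_algebra all_fingroup.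
From mathcomp Require Import all_classical all_reals all_analysis.
From mathcomp Require Import ring lra zify.
Import Pilot.Defs.

Set Implicit Arguments.
Unset Strict Implicit.
Unset Printing Implicit Defensive.

Import Order.TTheory GRing.Theory Num.Theory.
Import numFieldNormedType.Exports.

Local Open Scope ring_scope.

(** Why the solution is immortal. Let e_0 be the unit normal of the Abelian ideal
and A the action of e_0 on the ideal, identified with C^3 by an adapted frame.

The form psi restricts to omega^2 / 2 on the ideal, so that coclosedness says
that A lies in sp(6, R), that is, A v = U v + S (conj v) with U skew-Hermitian and
S symmetric ([coclosed_symplectic]). A comparison of coefficients then shows
that the Laplacian of psi is the infinitesimal action on psi of an endomorphism
Q = diag (q, - Y), where q = (Im tr U)^2 + |S|^2 and
Y v = (W + 2 T) (conj v) with W = U S + S U^T and T the conjugate of the adjugate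
of S ([laplacian_psi]).

Hence the flow is solved by moving the frame: if Theta' = Q Theta and
A' = - q A - [Y, A], with Theta = 1 initially, then the pullback of phi by Theta
is a solution, and A(t) is its bracket in the transported frame ([Th_conj],
[local_flow]). This is a polynomial differential equation, whose time of
existence depends only on a bound for |A| ([picard], [frame_ode]). The norm does
not increase, since
    (|A|^2)' / 2 = - q |A|^2 - 2 <W, W + 2 T>
                 = - q |A|^2 + 2 |T|^2 - 2 |W + T|^2
and 2 |T|^2 <= |S|^4 <= q |A|^2 ([normT_le], [normA_decreasing]). The local
solution can therefore be continued again and again by the same amount of time
([long_flow]).

Continuation and maximality rest on uniqueness ([flow_unique]). The form psi
determines the metric and the twelfth power of the volume by polynomial formulas
([ref_facts]), and the orientation cannot jump because phi is continuous, so that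
phi and its Laplacian depend on psi in a Lipschitz way along any two
solutions; Gronwall's inequality applies. The maximal solution is then the union of all
solutions, and its interval begins at the infimum of theirs ([maximal_solution]).

The frame in which the argument starts exists because G2 acts transitively
on the unit sphere of R^7; six circle rotations suffice ([frame_kernel]). *)

(** * Multilinear maps in coordinates *)

Section Multilinear.
Variables (R : realType) (g : vectType R).

Definition upd k (v : 'I_k -> g) (i : 'I_k) (x : g) : 'I_k -> g :=
  fun l => if l == i then x else v l.

Definition multilinear k (a : form g k) : Prop :=
  forall v i c x y,
    a (upd v i (c *: x + y)) = c * a (upd v i x) + a (upd v i y).

Definition consv k (x : g) (v : 'I_k -> g) : 'I_k.+1 -> g :=
  fun i => if unlift ord0 i is Some j then v j else x.

Lemma consv0 k x (v : 'I_k -> g) : consv x v ord0 = x.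
Proof. by rewrite /consv unlift_none. Qed.

Lemma consvS k x (v : 'I_k -> g) i : consv x v (lift ord0 i) = v i.
Proof. by rewrite /consv liftK. Qed.

Lemma consvE k (v : 'I_k.+1 -> g) : v = consv (v ord0) (fun i => v (lift ord0 i)).
Proof.
apply/funext => i; case: (unliftP ord0 i) => [j|] ->; first by rewrite consvS.
by rewrite consv0.
Qed.

Lemma upd_consv0 k x (v : 'I_k -> g) y : upd (consv x v) ord0 y = consv y v.
Proof.
apply/funext => i; rewrite /upd; case: (unliftP ord0 i) => [j|] ->.
  by rewrite !consvS eq_sym (negPf (neq_lift _ _)).
by rewrite eqxx consv0.
Qed.

Lemma upd_consvS k x (v : 'I_k -> g) i y :
  upd (consv x v) (lift ord0 i) y = consv x (upd v i y).
Proof.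
apply/funext => l; rewrite /upd; case: (unliftP ord0 l) => [j|] ->.
  by rewrite !consvS (inj_eq lift_inj).
by rewrite (negPf (neq_lift _ _)) !consv0.
Qed.

Lemma upd_id k (v : 'I_k -> g) i : upd v i (v i) = v.
Proof. by apply/funext => l; rewrite /upd; case: eqP => // ->. Qed.

Lemma multilinear_consv k (a : form g k.+1) x :
  multilinear a -> multilinear (fun v => a (consv x v)).
Proof. by move=> la v i c y z; rewrite -!upd_consvS la. Qed.

Lemma multilinear_sum k (a : form g k) v i (I : Type) (r : seq I) (c : I -> R) x :
  multilinear a ->
  a (upd v i (\sum_(j <- r) c j *: x j)) = \sum_(j <- r) c j * a (upd v i (x j)).
Proof.
move=> la; elim: r => [|j r IH].
  by rewrite !big_nil; have := la v i (-1) 0 0; rewrite scaler0 addr0 mulN1r addNr.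
by rewrite !big_cons la IH.
Qed.

Lemma sum_ffun_recl (V : nmodType) k (T : finType) (F : {ffun 'I_k.+1 -> T} -> V) :
  \sum_f F f = \sum_(x : T) \sum_(h : {ffun 'I_k -> T})
     F [ffun i => if unlift ord0 i is Some j then h j else x].
Proof.
rewrite pair_big /=.
rewrite (reindex (fun p : T * {ffun 'I_k -> T} =>
   [ffun i => if unlift ord0 i is Some j then p.2 j else p.1])) //=.
exists (fun f : {ffun 'I_k.+1 -> T} => (f ord0, [ffun i => f (lift ord0 i)])).
  move=> [x h] _ /=; rewrite ffunE unlift_none; congr (_, _).
  by apply/ffunP => i; rewrite !ffunE liftK.
move=> f _; apply/ffunP => i; rewrite ffunE /=.
by case: (unliftP ord0 i) => [j|] -> //=; rewrite ffunE.
Qed.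

(** All choices of frame below are exploited through this expansion: a form is
    handled by its finitely many coefficients. *)
Lemma multilinear_expand k (a : form g k) N (c : 'I_k -> 'I_N -> R) (e : 'I_N -> g) :
  multilinear a ->
  a (fun r => \sum_i c r i *: e i) =
  \sum_(I : {ffun 'I_k -> 'I_N}) (\prod_r c r (I r)) * a (fun r => e (I r)).
Proof.
elim: k a c => [|k IH] a c la.
  have f0 : {ffun 'I_0 -> 'I_N} by apply: finfun => -[].
  rewrite (big_pred1 f0) => [|f]; last by apply/esym/eqP/ffunP => -[].
  by rewrite big_ord0 mul1r; congr a; apply/funext => -[].
rewrite sum_ffun_recl [X in a X]consvE -(upd_consv0 0) multilinear_sum//.
apply: eq_bigr => x _; rewrite upd_consv0.
rewrite (IH (fun v => a (consv (e x) v)) (fun r => c (lift ord0 r))); last first.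
  exact: multilinear_consv.
rewrite mulr_sumr; apply: eq_bigr => h _.
rewrite big_ord_recl ffunE unlift_none mulrA.
under [in RHS]eq_bigr => i _ do rewrite ffunE liftK.
congr (_ * _ * a _); apply/funext => i.
case: (unliftP ord0 i) => [j|] ->; first by rewrite consvS ffunE liftK.
by rewrite consv0 ffunE unlift_none.
Qed.

(** * The Hodge star in an arbitrary frame *)

(** [M] is the inverse metric tensor written in the frame [e]. *)
Definition inv_metric (m : g -> g -> R) N (e : 'I_N -> g) (M : 'M[R]_N) : Prop :=
  forall x, x = \sum_p \sum_q (M p q * m x (e p)) *: e q.

Lemma vbasis_span (x : g) :
  x = \sum_(i < \dim {:g}) coord (vbasis {:g}) i x *: (vbasis {:g})`_i.
Proof. by rewrite -coord_vbasis // memvf. Qed.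

Section Hodge.
Variables (m : g -> g -> R) (N : nat) (e : 'I_N -> g) (M : 'M[R]_N).
Hypotheses (m_ip : inner_product m) (eM : inv_metric m e M).

Lemma ip_sumr x (I : Type) (r : seq I) (c : I -> R) y :
  m x (\sum_(j <- r) c j *: y j) = \sum_(j <- r) c j * m x (y j).
Proof.
case: m_ip => lm _ _; elim: r => [|j r IH].
  rewrite !big_nil; have := lm x (-1) 0 0.
  by rewrite scaler0 addr0 /= mulN1r addNr.
by rewrite !big_cons (lm x) IH.
Qed.

Let D := \matrix_(p < N, i < \dim {:g}) coord (vbasis {:g}) i (e p).

(** The star is defined with the Gram matrix of one fixed basis. The change of basis
    [D] expresses the inverse of that matrix by the inverse metric in an arbitrary
    frame. *)
Lemma invmx_gram : invmx (gram m) = D^T *m M *m D.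
Proof.
have gD : gram m *m (D^T *m M *m D) = 1%:M.
  apply/matrixP => i k; rewrite !mxE.
  transitivity (coord (vbasis {:g}) k (vbasis {:g})`_i); last first.
    by rewrite coord_free ?(basis_free (vbasisP _)).
  rewrite [X in coord _ _ X]eM linear_sum /=.
  under [RHS]eq_bigr => p _ do rewrite linear_sum /=.
  under [RHS]eq_bigr => p _ do under eq_bigr => q _ do rewrite linearZ /=.
  under eq_bigr => j _ do rewrite !mxE mulr_sumr.
  rewrite exchange_big /= exchange_big /=.
  transitivity (\sum_q \sum_(j < \dim {:g}) \sum_p
     m (vbasis {:g})`_i (vbasis {:g})`_j * (D p j * M p q * D q k)).
    rewrite exchange_big /=; apply: eq_bigr => q _; apply: eq_bigr => j _.
    rewrite !mxE mulr_suml mulr_sumr; apply: eq_bigr => p _.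
    by rewrite !mxE.
  rewrite [RHS]exchange_big /=; apply: eq_bigr => q _.
  rewrite exchange_big /=; apply: eq_bigr => p _.
  rewrite [X in m _ X](vbasis_span (e p)) ip_sumr mulr_sumr mulr_suml.
  by apply: eq_bigr => j _; rewrite !mxE; ring.
have [gu _] := mulmx1_unit gD.
by rewrite -[RHS](mulKmx gu) gD mulmx1.
Qed.

Lemma frame_expand p : e p = \sum_(i < \dim {:g}) D p i *: (vbasis {:g})`_i.
Proof. by rewrite {1}[e p]vbasis_span; apply: eq_bigr => i _; rewrite mxE. Qed.

Lemma catv_updl k l (u : 'I_k -> g) (v : 'I_l -> g) i x :
  catv (upd u i x) v = upd (catv u v) (lshift l i) x.
Proof.
apply/funext => j; rewrite /upd /catv.
case: splitP => [a ja|b jb].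
  have -> : j = lshift l a by apply/val_inj.
  by rewrite eq_lshift.
have -> : j = rshift k b by apply/val_inj.
by rewrite eq_rlshift.
Qed.

Lemma catv_updr k l (u : 'I_k -> g) (v : 'I_l -> g) i x :
  catv u (upd v i x) = upd (catv u v) (rshift k i) x.
Proof.
apply/funext => j; rewrite /upd /catv.
case: splitP => [a ja|b jb].
  have -> : j = lshift l a by apply/val_inj.
  by rewrite eq_lrshift.
have -> : j = rshift k b by apply/val_inj.
by rewrite eq_rshift.
Qed.

(** Expanding the frame vectors in the fixed basis, the two matrices [D] that
    accompany each raised index turn [M] back into the inverse Gram matrix. *)
Lemma hodge_frame k l (vol : form g (k + l)) (a : form g k) v :
  multilinear a -> multilinear vol ->
  hodge m vol a v = k`!%:R^-1 *
    \sum_(I : {ffun 'I_k -> 'I_N}) \sum_(J : {ffun 'I_k -> 'I_N})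
      (\prod_r M (I r) (J r)) * a (fun r => e (I r)) *
      vol (catv (fun r => e (J r)) v).
Proof.
move=> la lvol; rewrite /hodge; congr (_ * _).
have lv : multilinear (fun u : 'I_k -> g => vol (catv u v)).
  by move=> u i c x y; rewrite !catv_updl lvol.
pose vb i := (vbasis {:g})`_i.
transitivity (\sum_(I : {ffun 'I_k -> 'I_N}) \sum_(J : {ffun 'I_k -> 'I_N})
  \sum_(i : {ffun 'I_k -> 'I_(\dim {:g})}) \sum_(j : {ffun 'I_k -> 'I_(\dim {:g})})
  ((\prod_r (M (I r) (J r) * D (I r) (i r) * D (J r) (j r))) *
    a (fun r => vb (i r)) * vol (catv (fun r => vb (j r)) v))); last first.
  apply: eq_bigr => I _; apply: eq_bigr => J _.
  have -> : a (fun r => e (I r)) = \sum_(i : {ffun 'I_k -> 'I_(\dim {:g})})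
      (\prod_r D (I r) (i r)) * a (fun r => vb (i r)).
    have /= <- := multilinear_expand (fun r i => D (I r) i) vb la.
    congr a; apply/funext => r.
    exact: frame_expand.
  have -> : vol (catv (fun r => e (J r)) v) =
      \sum_(j : {ffun 'I_k -> 'I_(\dim {:g})})
      (\prod_r D (J r) (j r)) * vol (catv (fun r => vb (j r)) v).
    have /= <- := multilinear_expand (fun r i => D (J r) i) vb lv.
    by congr (vol (catv _ v)); apply/funext => r; exact: frame_expand.
  rewrite -mulrA mulr_suml mulr_sumr; apply: eq_bigr => i _.
  rewrite !mulr_sumr; apply: eq_bigr => j _.
  by rewrite !big_split /=; ring.
rewrite [RHS](eq_bigr (fun I : {ffun 'I_k -> 'I_N} =>
  \sum_(i : {ffun 'I_k -> 'I_(\dim {:g})}) \sum_(j : {ffun 'I_k -> 'I_(\dim {:g})})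
  \sum_(J : {ffun 'I_k -> 'I_N})
  ((\prod_r (M (I r) (J r) * D (I r) (i r) * D (J r) (j r))) *
    a (fun r => vb (i r)) * vol (catv (fun r => vb (j r)) v)))); last first.
  move=> I _; rewrite exchange_big /=; apply: eq_bigr => i _.
  by rewrite exchange_big.
rewrite [RHS]exchange_big /=; apply: eq_bigr => i _.
rewrite [RHS]exchange_big /=; apply: eq_bigr => j _.
under [RHS]eq_bigr => I _ do rewrite -!mulr_suml.
rewrite -!mulr_suml; congr (_ * _ * _).
under [RHS]eq_bigr => I _ do
  rewrite -(bigA_distr_bigA (fun r q => M (I r) q * D (I r) (i r) * D q (j r))).
rewrite -(bigA_distr_bigA (fun r p => \sum_q M p q * D p (i r) * D q (j r))).
apply: eq_bigr => r _; rewrite invmx_gram mxE [RHS]exchange_big /=.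
apply: eq_bigr => q _; rewrite mxE mulr_suml; apply: eq_bigr => p _.
by rewrite !mxE; ring.
Qed.

End Hodge.
End Multilinear.

(** * Alternating forms on index lists *)

(** Insertion that counts transpositions: the sign becomes 0 when the inserted
    entry is already present. It lets the coefficient of an alternating form on any
    list of indices be reduced by computation to an increasing list. *)
Fixpoint ins (x : nat) (l : seq nat) : int * seq nat :=
  if l is y :: l' then
    if (x < y)%N then (1, x :: l)
    else if x == y then (0, x :: l)
    else let r := ins x l' in (- r.1, y :: r.2)
  else (1, [:: x]).

Fixpoint isort (l : seq nat) : int * seq nat :=
  if l is x :: l' then
    let r := isort l' in let r' := ins x r.2 in (r'.1 * r.1, r'.2)
  else (1, [::]).

Definition isgn l := (isort l).1.

Lemma perm_ins x l : perm_eq (ins x l).2 (x :: l).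
Proof.
elim: l => [|y l IH] //=; case: ifP => // _; case: ifP => // _ /=.
rewrite perm_sym (perm_catCA [:: x] [:: y]) /= perm_cons perm_sym.
exact: IH.
Qed.

Lemma perm_isort l : perm_eq (isort l).2 l.
Proof.
elim: l => [|x l IH] //=; apply: (perm_trans (perm_ins _ _)).
by rewrite perm_cons.
Qed.

Lemma ins_sorted x l : sorted ltn l -> (ins x l).1 != 0 -> sorted ltn (ins x l).2.
Proof.
elim: l => [|y l IH] //= sl.
case: ltnP => [xy|yx] /=; first by rewrite xy.
case: (eqVneq x y) => //= nxy H0.
have H : (ins x l).1 != 0 by rewrite -oppr_eq0.
have := IH (path_sorted sl) H.
have : all (ltn y) (ins x l).2.
  rewrite (perm_all _ (perm_ins x l)) /= ltn_neqAle eq_sym nxy yx /=.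
  by rewrite (path_sortedE ltn_trans) in sl; case/andP: sl.
by move=> ha hs; rewrite (path_sortedE ltn_trans) ha.
Qed.

Lemma isort_sorted l : isgn l != 0 -> sorted ltn (isort l).2.
Proof.
rewrite /isgn; elim: l => [|x l IH] //=; rewrite mulf_eq0 negb_or => /andP[h1 h2].
by apply: ins_sorted => //; apply: IH.
Qed.

Lemma ins_sgn x l : x \notin l -> (ins x l).1 ^+ 2 = 1.
Proof.
elim: l => [|y l IH] //=; rewrite inE negb_or => /andP[nxy nxl].
by case: ifP => // _; rewrite (negPf nxy) /= sqrrN IH.
Qed.

Lemma isgn_uniq l : uniq l -> isgn l ^+ 2 = 1.
Proof.
rewrite /isgn; elim: l => [|x l IH] //= /andP[nxl ul].
by rewrite exprMn IH // ins_sgn // (perm_mem (perm_isort l)).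
Qed.

Lemma isgn_nuniq l : ~~ uniq l -> isgn l = 0.
Proof.
move=> nu; apply/eqP; apply: contraNT nu => /isort_sorted.
rewrite -(perm_uniq (perm_isort l)) => s.
by apply: sorted_uniq s; [exact: ltn_trans | exact: ltnn].
Qed.

Lemma isort_perm l l' : perm_eq l l' -> uniq l -> (isort l).2 = (isort l').2.
Proof.
move=> pl ul; have ul' : uniq l' by rewrite -(perm_uniq pl).
have n0 s : uniq s -> isgn s != 0.
  by move=> us; rewrite -sqrf_eq0 isgn_uniq.
apply: (irr_sorted_eq ltn_trans ltnn); rewrite ?isort_sorted ?n0//.
move=> x; rewrite (perm_mem (perm_isort l)) (perm_mem (perm_isort l')).
exact: perm_mem.
Qed.

Lemma isort_id l : sorted ltn l -> isort l = (1, l).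
Proof.
elim: l => [|x l IH] //= sl; rewrite IH ?(path_sorted sl)//=.
by case: l sl {IH} => //= y l /andP[-> _]; rewrite mulr1.
Qed.

Section Alternating.
Variables (R : realType) (g : vectType R).

(** Vanishing on equal neighbours is the form of alternation that is easiest to
    check; it implies the sign rule for all permutations ([comp_perm]). *)
Definition alt_form k (a : form g k) : Prop :=
  multilinear a /\
  forall v (i j : 'I_k), j = i.+1 :> nat -> v i = v j -> a v = 0.

(** Indices are lists of natural numbers rather than finite functions, so that
    tables of coefficients can be computed. *)
Definition fcomp (e : nat -> g) k (a : form g k) (l : seq nat) : R :=
  a (fun i => e (nth 0%N l i)).

Lemma multilinear_add k (a : form g k) v i x y : multilinear a ->
  a (upd v i (x + y)) = a (upd v i x) + a (upd v i y).
Proof. by move=> la; rewrite -{1}[x]scale1r la mul1r. Qed.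

(** Polarisation of the vanishing on the equal arguments [x + y]. *)
Lemma alternating_swap k (a : form g k) v (i j : 'I_k) x y :
  alt_form a -> j = i.+1 :> nat ->
  a (upd (upd v i x) j y) = - a (upd (upd v i y) j x).
Proof.
move=> [la za] ij.
have nij : i != j by apply/eqP => ijE; rewrite ijE in ij; lia.
have updC u w : upd (upd v i u) j w = upd (upd v j w) i u.
  apply/funext => l; rewrite /upd; case: eqP => [->|//].
  by rewrite eq_sym (negPf nij).
have f0 u : a (upd (upd v i u) j u) = 0.
  by apply: (za _ i j ij); rewrite /upd eqxx (negPf nij) eqxx.
have := f0 (x + y); rewrite multilinear_add // updC multilinear_add //.
rewrite (updC (x + y) y) multilinear_add // -!updC !f0 add0r addr0.
by rewrite addrC => /eqP; rewrite addr_eq0 => /eqP.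
Qed.

Variable e : nat -> g.

Lemma comp_swap k (a : form g k) l1 x y l2 : alt_form a ->
  (size l1 + (size l2).+2)%N = k ->
  fcomp e a (l1 ++ x :: y :: l2) = - fcomp e a (l1 ++ y :: x :: l2).
Proof.
move=> aa sk.
have h1 : (size l1 < k)%N by lia.
have h2 : ((size l1).+1 < k)%N by lia.
pose i := Ordinal h1; pose j := Ordinal h2.
pose v := fun i : 'I_k => e (nth 0%N (l1 ++ x :: y :: l2) i).
have E u w : (fun i : 'I_k => e (nth 0%N (l1 ++ u :: w :: l2) i)) =
    upd (upd v i (e u)) j (e w).
  apply/funext => l; rewrite /upd /v -!val_eqE /= !nth_cat.
  case: (ltngtP l (size l1).+1) => [|h|h].
  - rewrite ltnS leq_eqVlt => /predU1P[->|h]; first by rewrite eqxx ltnn subnn.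
    by rewrite h; case: eqP => // E; rewrite E ltnn in h.
  - have -> : (l < size l1)%N = false by lia.
    have -> : (l - size l1 = (l - (size l1).+2).+2)%N by lia.
    by case: eqP => // E; lia.
  - have -> : (l < size l1)%N = false by lia.
    by have -> : (l - size l1 = 1)%N by lia.
by rewrite /fcomp !E (@alternating_swap _ a v i j).
Qed.

Lemma comp_ins k (a : form g k) l1 x l : alt_form a ->
  (size l1 + (size l).+1)%N = k ->
  fcomp e a (l1 ++ x :: l) = (ins x l).1%:~R * fcomp e a (l1 ++ (ins x l).2).
Proof.
move=> aa; elim: l l1 => [|y l IH] l1 sk /=; first by rewrite mul1r.
case: ifP => _ /=; first by rewrite mul1r.
case: eqP => [->|_] /=.
  rewrite mul0r; have := @comp_swap _ a l1 y y l aa sk.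
  by move/eqP; rewrite -addr_eq0 -mulr2n mulrn_eq0 /= => /eqP.
rewrite comp_swap // -cat_rcons IH ?size_rcons; last by move: sk => /=; lia.
by rewrite cat_rcons mulrNz mulNr.
Qed.

Lemma comp_isort_cat k (a : form g k) l1 l : alt_form a ->
  (size l1 + size l)%N = k ->
  fcomp e a (l1 ++ l) = (isgn l)%:~R * fcomp e a (l1 ++ (isort l).2).
Proof.
move=> aa; rewrite /isgn; elim: l l1 => [|x l IH] l1 sk /=; first by rewrite mul1r.
rewrite -cat_rcons IH ?size_rcons; last by move: sk => /=; lia.
rewrite cat_rcons comp_ins //; last first.
  by rewrite (perm_size (perm_isort l)).
by rewrite intrM mulrCA mulrA.
Qed.

Lemma comp_isort k (a : form g k) l : alt_form a -> size l = k ->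
  fcomp e a l = (isgn l)%:~R * fcomp e a (isort l).2.
Proof. by move=> aa sk; apply: (@comp_isort_cat k a [::]). Qed.

Lemma comp_perm k (a : form g k) l l' : alt_form a -> size l = k ->
  uniq l -> perm_eq l l' ->
  fcomp e a l = (isgn l * isgn l')%:~R * fcomp e a l'.
Proof.
move=> aa sk ul pl; rewrite [in LHS]comp_isort // [fcomp e a l']comp_isort //.
  rewrite (isort_perm pl ul) intrM mulrA -[_ * _ * (isgn l')%:~R]mulrA -intrM.
  by rewrite -[isgn l' * _]expr2 isgn_uniq -?(perm_uniq pl)// mulr1.
by rewrite -(perm_size pl).
Qed.

Lemma comp_nuniq k (a : form g k) l : alt_form a -> size l = k ->
  ~~ uniq l -> fcomp e a l = 0.
Proof. by move=> aa sk nu; rewrite comp_isort // isgn_nuniq // mul0r. Qed.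

Definition spanning N := forall x : g, exists c : 'I_N -> R, x = \sum_i c i *: e i.

Lemma multilinear_ext N k (a1 a2 : form g k) : spanning N ->
  multilinear a1 -> multilinear a2 ->
  (forall l, size l = k -> all (ltn^~ N) l -> fcomp e a1 l = fcomp e a2 l) ->
  a1 =1 a2.
Proof.
move=> sp la1 la2 H v.
have [c cE] : exists c : 'I_k -> 'I_N -> R, v = fun r => \sum_i c r i *: e i.
  have : forall r, exists c : 'I_N -> R, v r = \sum_i c i *: e i by move=> r; exact: sp.
  by case/choice => c cE; exists c; apply/funext.
have X a : multilinear a -> a (fun r => \sum_i c r i *: e i) = _ :=
  multilinear_expand c (fun i : 'I_N => e i).
rewrite cE !X //; apply: eq_bigr => I _; congr (_ * _).
have := H [seq val (I r) | r <- enum 'I_k].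
rewrite size_map size_enum_ord => /(_ erefl).
have -> : all (ltn^~ N) [seq val (I r) | r <- enum 'I_k].
  by apply/allP => x /mapP[r _ ->] /=.
move=> /(_ erefl); rewrite /fcomp.
have -> : (fun i : 'I_k => e (nth 0%N [seq val (I r) | r <- enum 'I_k] i)) =
          (fun r => e (I r)).
  apply/funext => i; congr e; rewrite (nth_map i) ?size_enum_ord//.
  by rewrite nth_ord_enum.
by [].
Qed.

Lemma alternating_ext N k (a1 a2 : form g k) : spanning N ->
  alt_form a1 -> alt_form a2 ->
  (forall l, size l = k -> all (ltn^~ N) l -> sorted ltn l ->
     fcomp e a1 l = fcomp e a2 l) ->
  a1 =1 a2.
Proof.
move=> sp aa1 aa2 H; apply: (multilinear_ext sp aa1.1 aa2.1) => l sk al.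
rewrite comp_isort // [RHS]comp_isort //.
have [->|n0] := eqVneq (isgn l) 0; first by rewrite !mul0r.
congr (_ * _); apply: H; last exact: isort_sorted.
- by rewrite (perm_size (perm_isort l)).
- by rewrite (perm_all _ (perm_isort l)).
Qed.

End Alternating.

(** * Sums over index maps and permutations as sums over lists *)

Section ListSums.

Definition flist k n (f : 'I_k -> 'I_n) : seq nat := [seq val (f r) | r <- enum 'I_k].

Lemma size_flist k n (f : 'I_k -> 'I_n) : size (flist f) = k.
Proof. by rewrite size_map size_enum_ord. Qed.

Lemma nth_flist k n (f : 'I_k -> 'I_n) (i : 'I_k) : nth 0%N (flist f) i = f i.
Proof. by rewrite (nth_map i) ?size_enum_ord// nth_ord_enum. Qed.

Lemma flist_inj k n (f h : 'I_k -> 'I_n) : flist f = flist h -> f =1 h.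
Proof.
by move=> fh i; apply/val_inj; rewrite /= -!nth_flist fh.
Qed.

Lemma flist_lt k n (f : 'I_k -> 'I_n) : all (ltn^~ n) (flist f).
Proof. by apply/allP => x /mapP[r _ ->] /=. Qed.

Lemma flist_surj k n l : size l = k -> all (ltn^~ n) l ->
  exists f : {ffun 'I_k -> 'I_n}, flist f = l.
Proof.
move=> sl al.
have h (i : 'I_k) : (nth 0%N l i < n)%N.
  by move/allP: al; apply; rewrite mem_nth ?sl.
exists [ffun i => Ordinal (h i)].
apply: (@eq_from_nth _ 0%N); rewrite size_flist ?sl// => i ik.
by rewrite -[i]/(val (Ordinal ik)) nth_flist ffunE.
Qed.

(** Meant for alternating summands, which vanish unless the indices are a
    rearrangement of the set that makes them non-zero. *)
Lemma sum_flist (V : nmodType) k n (G : seq nat -> V) (I : seq nat) :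
  uniq I -> size I = k -> all (ltn^~ n) I ->
  (forall l, size l = k -> all (ltn^~ n) l -> ~~ perm_eq l I -> G l = 0) ->
  \sum_(f : {ffun 'I_k -> 'I_n}) G (flist f) = \sum_(l <- permutations I) G l.
Proof.
move=> uI sI aI G0.
rewrite (bigID (fun f : {ffun 'I_k -> 'I_n} => perm_eq (flist f) I)) /=.
rewrite [X in _ + X]big1 ?addr0; last first.
  by move=> f; apply: G0; rewrite ?size_flist ?flist_lt.
rewrite -big_filter.
rewrite -(big_map (fun f : {ffun 'I_k -> 'I_n} => flist f) xpredT G).
apply: perm_big; apply: uniq_perm.
- rewrite map_inj_uniq ?filter_uniq ?index_enum_uniq//.
  by move=> f h /flist_inj fh; apply/ffunP.
- exact: permutations_uniq.
move=> l; rewrite mem_permutations; apply/mapP/idP.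
  by move=> [f]; rewrite mem_filter => /andP[H _] ->.
move=> pl; have [f fl] : exists f : {ffun 'I_k -> 'I_n}, flist f = l.
  by apply: flist_surj; rewrite ?(perm_size pl)// (perm_all _ pl).
by exists f => //; rewrite mem_filter fl mem_index_enum pl.
Qed.

Lemma sorted_iota n l : sorted ltn l -> size l = n -> all (ltn^~ n) l -> l = iota 0 n.
Proof.
move=> sl szl al; have ul := sorted_uniq ltn_trans ltnn sl.
apply: (irr_sorted_eq ltn_trans ltnn) => //; first exact: iota_ltn_sorted.
have sub : {subset l <= iota 0 n}.
  by move=> x /(allP al) /=; rewrite mem_iota.
by have [] := uniq_min_size ul sub; rewrite ?size_iota ?szl.
Qed.

End ListSums.

Section TopForm.
Variables (R : realType) (g : vectType R).

Lemma spanning_basis n (b : n.-tuple g) : basis_of {:g} b -> spanning (nth 0 b) n.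
Proof.
move=> bb x; exists (fun i => coord b i x).
by rewrite [LHS](coord_basis bb (memvf x)).
Qed.

Definition det_form n (b : n.-tuple g) : form g n :=
  fun v => \det (\matrix_(i, j) coord b j (v i)).

Lemma det_form_alt n (b : n.-tuple g) : alt_form (det_form b).
Proof.
split=> [v i c x y|v i j ij vij]; rewrite /det_form; last first.
  apply: (determinant_alternate (i1 := i) (i2 := j)).
    by apply/eqP => ijE; rewrite ijE in ij; lia.
  by move=> k; rewrite !mxE vij.
rewrite -[X in _ = _ + X]mul1r.
apply: (determinant_multilinear (i0 := i)).
- by apply/rowP => j; rewrite !mxE /upd eqxx linearP mul1r.
- by apply/matrixP => k j; rewrite !mxE /upd eq_sym (negPf (neq_lift _ _)).
- by apply/matrixP => k j; rewrite !mxE /upd eq_sym (negPf (neq_lift _ _)).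
Qed.

Lemma det_form_perm n (b : n.-tuple g) (s : 'S_n) : basis_of {:g} b ->
  det_form b (fun i => b`_(s i)) = (-1) ^+ s.
Proof.
move=> bb; rewrite -det_perm; congr (\det _); apply/matrixP => i j.
by rewrite !mxE (coord_free _ _ (basis_free bb)) eq_sym.
Qed.

(** Both signs are the determinant of the permuted standard basis. *)
Lemma isgn_perm n (s : 'S_n) : (-1) ^+ s = (isgn (flist s))%:~R :> R.
Proof.
pose b : n.-tuple 'rV[R]_n := [tuple delta_mx ord0 i | i < n].
have mbE (i : 'I_n) : b`_i = delta_mx ord0 i.
  by rewrite (nth_map i) ?size_enum_ord// nth_ord_enum.
pose e i := b`_i.
pose rd : form 'rV[R]_n n := fun v => \det (\matrix_(i, j) v i ord0 j).
have aa : alt_form rd.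
  split=> [v i c x y|v i j ij vij]; last first.
    apply: (determinant_alternate (i1 := i) (i2 := j)).
      by apply/eqP => ijE; rewrite ijE in ij; lia.
    by move=> k; rewrite !mxE vij.
  rewrite -[X in _ = _ + X]mul1r.
  apply: (determinant_multilinear (i0 := i)).
  - by apply/rowP => j; rewrite !mxE /upd eqxx !mxE mul1r.
  - by apply/matrixP => k j; rewrite !mxE /upd eq_sym (negPf (neq_lift _ _)).
  - by apply/matrixP => k j; rewrite !mxE /upd eq_sym (negPf (neq_lift _ _)).
have cE (u : 'S_n) : fcomp e rd (flist u) = (-1) ^+ u.
  rewrite /fcomp -det_perm; congr (\det _); apply/matrixP => i j.
  by rewrite !mxE nth_flist /e mbE mxE eqxx eq_sym.
have c1 := cE 1%g; rewrite odd_perm1 expr0 in c1.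
have f1 : flist (1%g : 'S_n) = iota 0 n.
  apply: (@eq_from_nth _ 0%N); rewrite size_flist ?size_iota// => i ik.
  by rewrite -[i]/(val (Ordinal ik)) nth_flist perm1 nth_iota.
have us : uniq (flist s).
  by rewrite map_inj_uniq ?enum_uniq// => x y /val_inj /perm_inj.
rewrite -cE (@comp_isort _ _ e _ _ _ aa) ?size_flist//.
have -> : (isort (flist s)).2 = flist (1%g : 'S_n).
  rewrite f1; apply: sorted_iota.
  - by apply: isort_sorted; rewrite -sqrf_eq0 isgn_uniq.
  - by rewrite (perm_size (perm_isort _)) size_flist.
  - by rewrite (perm_all _ (perm_isort _)) flist_lt.
by rewrite c1 mulr1.
Qed.

(** The sums over permutations in the wedge product become sums over an explicit
    list, which can be computed. *)
Lemma sum_perm n (F : seq nat -> R) :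
  \sum_(s : 'S_n) (-1) ^+ s * F (flist s) =
  \sum_(l <- permutations (iota 0 n)) (isgn l)%:~R * F l.
Proof.
under eq_bigr => s _ do rewrite isgn_perm.
rewrite -big_enum /= -(big_map (fun s : 'S_n => flist s) xpredT
  (fun l => (isgn l)%:~R * F l)).
apply: perm_big.
have uX : uniq [seq flist s | s : 'S_n].
  by rewrite map_inj_uniq ?enum_uniq// => s u /flist_inj su; apply/permP.
have sub : {subset [seq flist s | s : 'S_n] <= permutations (iota 0 n)}.
  move=> l /mapP[s _ ->]; rewrite mem_permutations.
  apply: uniq_perm; rewrite ?iota_uniq//.
    by rewrite map_inj_uniq ?enum_uniq// => x y /val_inj /perm_inj.
  have us : uniq (flist s).
    by rewrite map_inj_uniq ?enum_uniq// => x y /val_inj /perm_inj.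
  have sub' : {subset flist s <= iota 0 n}.
    by move=> x /(allP (flist_lt s)) /=; rewrite mem_iota.
  by have [] := uniq_min_size us sub'; rewrite ?size_iota ?size_flist.
apply: uniq_perm; rewrite ?permutations_uniq//.
have [] // := uniq_min_size uX sub.
by rewrite size_permutations ?iota_uniq// size_iota size_map -cardE card_Sn.
Qed.

Lemma alternating_scale k (a : form g k) c :
  alt_form a -> alt_form (fun v => c * a v).
Proof.
move=> [la za]; split=> [v i d x y|v i j ij vij]; first by rewrite la; ring.
by rewrite (za v i j) ?mulr0.
Qed.

(** The space of top forms is one-dimensional. *)
Lemma top_form n (b : n.-tuple g) (a : form g n) v :
  basis_of {:g} b -> alt_form a ->
  a v = fcomp (nth 0 b) a (iota 0 n) * det_form b v.
Proof.
move=> bb aa.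
apply: (@alternating_ext _ _ (nth 0 b) n n a
  (fun v => fcomp (nth 0 b) a (iota 0 n) * det_form b v)) => //.
- exact: spanning_basis.
- by apply: alternating_scale; exact: det_form_alt.
move=> l sl al ssl; rewrite (sorted_iota ssl sl al).
suff H : fcomp (nth 0 b) (det_form b) (iota 0 n) = 1.
  by rewrite {2}/fcomp [X in _ * X]H mulr1.
have := det_form_perm 1%g bb; rewrite odd_perm1 expr0 => <-.
by rewrite /fcomp; congr det_form; apply/funext => i; rewrite nth_iota // perm1.
Qed.

End TopForm.

Section HodgeComp.
Variables (R : realType) (g : vectType R) (m : g -> g -> R).

Lemma catv_flist n (e : nat -> g) k l (f : 'I_k -> 'I_n) (J : seq nat) :
  catv (fun r => e (f r)) (fun j : 'I_l => e (nth 0%N J j)) =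
  (fun i : 'I_(k + l) => e (nth 0%N (flist f ++ J) i)).
Proof.
apply/funext => i; rewrite /catv nth_cat size_flist.
case: splitP => [a ia|c ic].
  by rewrite ia nth_flist.
by rewrite ic addKn.
Qed.

Lemma hodge_mlin k l (vol : form g (k + l)) (a : form g k) :
  multilinear vol -> multilinear (hodge m vol a).
Proof.
move=> lv v i c x y; rewrite /hodge mulrCA -mulrDr; congr (_ * _).
rewrite mulr_sumr -big_split /=; apply: eq_bigr => I _.
rewrite mulr_sumr -big_split /=; apply: eq_bigr => J _.
by rewrite !catv_updr lv; ring.
Qed.

Lemma hodge_alt k l (vol : form g (k + l)) (a : form g k) :
  alt_form vol -> alt_form (hodge m vol a).
Proof.
move=> [lv zv]; split; first exact: hodge_mlin.
move=> v i j ij vij; rewrite /hodge big1 ?mulr0 // => I _.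
rewrite big1 // => J _; rewrite (zv _ (rshift k i) (rshift k j)) ?mulr0//=.
  by rewrite ij addnS.
by rewrite /catv !(unsplitK (inr _)).
Qed.

Variables (n : nat) (b : n.-tuple g).
Hypotheses (m_ip : inner_product m) (bb : basis_of {:g} b).
Hypothesis b_on : orthonormal m (fun i : 'I_n => b`_i).

Lemma inv_metric_on : inv_metric m (fun i : 'I_n => b`_i) 1%:M.
Proof.
move=> x; rewrite exchange_big /=.
have xE := coord_basis bb (memvf x).
rewrite {1}xE; apply: eq_bigr => q _.
rewrite -scaler_suml; congr (_ *: _).
rewrite (bigD1 q) //= big1 ?addr0 => [|p pq]; last by rewrite mxE (negPf pq) mul0r.
rewrite mxE eqxx mul1r; case: (m_ip) => _ mC _; rewrite mC {2}xE (ip_sumr m_ip).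
rewrite (bigD1 q) //= big1 ?addr0 => [|p pq].
  by rewrite b_on eqxx mulr1.
by rewrite b_on eq_sym (negPf pq) mulr0.
Qed.

Lemma hodge_on k l (vol : form g (k + l)) (a : form g k) v :
  multilinear a -> multilinear vol ->
  hodge m vol a v = k`!%:R^-1 * \sum_(I : {ffun 'I_k -> 'I_n})
      a (fun r => b`_(I r)) * vol (catv (fun r => b`_(I r)) v).
Proof.
move=> la lvol; rewrite (hodge_frame m_ip inv_metric_on) //; congr (_ * _).
apply: eq_bigr => I _; rewrite (bigD1 I) //= [X in _ + X]big1 ?addr0.
  by rewrite big1 ?mul1r // => r _; rewrite mxE eqxx.
move=> J JI; have [r Jr] : exists r, J r != I r.
  by apply/existsP; apply: contraR JI => /existsPn H; apply/eqP/ffunP => r;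
     apply/eqP; rewrite -[_ == _]negbK.
by rewrite (bigD1 r) //= mxE eq_sym (negPf Jr) !mul0r.
Qed.

(** Only the [k!] rearrangements of the indices complementary to [J] contribute, and
    they contribute equally, which cancels the factor [1/k!]. *)
Lemma hodge_comp k l (vol : form g (k + l)) (a : form g k) I J :
  (k + l)%N = n ->
  alt_form a -> alt_form vol -> size I = k -> size J = l ->
  perm_eq (I ++ J) (iota 0 n) ->
  fcomp (nth 0 b) (hodge m vol a) J =
  (isgn (I ++ J))%:~R * fcomp (nth 0 b) vol (iota 0 n) * fcomp (nth 0 b) a I.
Proof.
move=> kln aa av sI sJ pIJ.
have uIJ : uniq (I ++ J) by rewrite (perm_uniq pIJ) iota_uniq.
have uI : uniq I by move: uIJ; rewrite cat_uniq => /andP[].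
have aI : all (ltn^~ n) I.
  apply/allP => x xI; have : x \in iota 0 n by rewrite -(perm_mem pIJ) mem_cat xI.
  by rewrite mem_iota.
rewrite /fcomp hodge_on //; [|exact: aa.1|exact: av.1].
pose G L := fcomp (nth 0 b) a L * fcomp (nth 0 b) vol (L ++ J).
rewrite (eq_bigr (fun f : {ffun 'I_k -> 'I_n} => G (flist f))); last first.
  move=> f _; rewrite (@catv_flist n (nth 0 b)) /G /fcomp; congr (a _ * _).
  by apply/funext => i; rewrite nth_flist.
have GE L : perm_eq L I -> G L = G I.
  move=> pL; have uL : uniq L by rewrite (perm_uniq pL).
  have sL : size L = k by rewrite (perm_size pL).
  have pLJ : perm_eq (L ++ J) (I ++ J) by rewrite perm_cat2r.
  rewrite /G (comp_perm _ aa sL uL pL).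
  (* vol (. , b_J) is itself an alternating k-form: both factors change by the
     same sign *)
  pose vJ : form g k := fun u => vol (catv u (fun j : 'I_l => b`_(nth 0%N J j))).
  have avJ : alt_form vJ.
    split=> [v i c x y|v i j ij vij]; first by rewrite /vJ !catv_updl av.1.
    apply: (av.2 _ (lshift l i) (lshift l j)) => //.
    by rewrite /catv !(unsplitK (inl _)).
  have cJ A : size A = k -> fcomp (nth 0 b) vol (A ++ J) = fcomp (nth 0 b) vJ A.
    move=> sA; rewrite /fcomp /vJ; congr (vol _); apply/funext => i.
    rewrite /catv nth_cat sA; by case: splitP => [q ->|q ->]; rewrite ?addKn.
  rewrite !cJ // (comp_perm _ avJ sL uL pL) mulrACA -intrM.
  have -> : isgn L * isgn I * (isgn L * isgn I) = isgn L ^+ 2 * isgn I ^+ 2 by ring.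
  by rewrite !isgn_uniq // mulr1 mul1r.
rewrite (sum_flist (I := I)) //; last first.
  move=> L sL aL nL; rewrite /G; case uL : (uniq L); last first.
    by rewrite (comp_nuniq _ aa) ?mul0r ?uL.
  rewrite (comp_nuniq _ av) ?mulr0 ?size_cat ?sL ?sJ//.
  apply: contra nL => uLJ.
  rewrite -(perm_cat2r J) (perm_trans _ (_ : perm_eq (iota 0 n) _))//; last first.
    by rewrite perm_sym.
  have sub : {subset L ++ J <= iota 0 n}.
    move=> x; rewrite mem_cat => /orP[/(allP aL)|xJ]; first by rewrite mem_iota.
    by rewrite -(perm_mem pIJ) mem_cat xJ orbT.
  apply: uniq_perm; rewrite ?iota_uniq//.
  by have [] := uniq_min_size uLJ sub; rewrite ?size_iota ?size_cat ?sL ?sJ ?kln.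
rewrite big_seq (eq_bigr (fun=> G I)) => [|L]; last first.
  by rewrite mem_permutations => pL; apply: GE.
rewrite -big_seq big_const_seq count_predT size_permutations // sI iter_addr_0.
rewrite -[G I *+ _]mulr_natl mulrA mulVf ?mul1r ?pnatr_eq0 ?gtn_eqF ?fact_gt0//.
rewrite /G (comp_perm _ av (l' := iota 0 n)) ?size_cat ?sI ?sJ//.
have -> : isgn (iota 0 n) = 1.
  by rewrite /isgn isort_id ?iota_ltn_sorted.
by rewrite mulr1 mulrC.
Qed.

End HodgeComp.

(** * The differential of an alternating form *)

Section Differential.
Variables (R : realType) (g : vectType R) (br : g -> g -> g).
Hypothesis br_lin : [/\ forall x, linear (br x), forall y, linear (br^~ y)
  & forall x, br x x = 0].

Lemma upd_upd k (v : 'I_k -> g) i x y : upd (upd v i x) i y = upd v i y.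
Proof. by apply/funext => l; rewrite /upd; case: eqP. Qed.

Lemma updC k (v : 'I_k -> g) i j x y : i != j ->
  upd (upd v i x) j y = upd (upd v j y) i x.
Proof.
move=> nij; apply/funext => l; rewrite /upd; case: eqP => [->|//].
by rewrite eq_sym (negPf nij).
Qed.

Lemma upd_lift_same k (v : 'I_k.+1 -> g) j x :
  (fun l => upd v j x (lift j l)) = (fun l => v (lift j l)).
Proof. by apply/funext => l; rewrite /upd eq_sym (negPf (neq_lift _ _)). Qed.

Lemma upd_lift k (v : 'I_k.+1 -> g) j s x :
  (fun l => upd v (lift j s) x (lift j l)) = upd (fun l => v (lift j l)) s x.
Proof. by apply/funext => l; rewrite /upd (inj_eq lift_inj). Qed.

Definition ext_d_term k (a : form g k) v (j : 'I_k.+1) (i : 'I_k) : R :=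
  a (upd (fun l => v (lift j l)) i (br (v (lift j i)) (v j))).

Lemma ext_dE k (a : form g k) v : ext_d br a v =
  \sum_(j < k.+1) \sum_(i < k | (i < j)%N) (-1) ^+ j * ext_d_term a v j i.
Proof. by []. Qed.

Lemma ext_d_mlin k (a : form g k) : multilinear a -> multilinear (ext_d br a).
Proof.
case: br_lin => lr ll _ la v s c x y; rewrite !ext_dE mulr_sumr -big_split /=.
apply: eq_bigr => j _; rewrite mulr_sumr -big_split /=.
apply: eq_bigr => i _; rewrite mulrCA -mulrDr; congr (_ * _).
rewrite /ext_d_term.
case: (unliftP j s) => [l ->|->]; last first.
  have jE z : upd v j z j = z by rewrite /upd eqxx.
  have iE z : upd v j z (lift j i) = v (lift j i).
    by rewrite /upd eq_sym (negPf (neq_lift _ _)).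
  by rewrite !upd_lift_same !jE !iE lr la.
have jE z : upd v (lift j l) z j = v j by rewrite /upd (negPf (neq_lift _ _)).
rewrite !upd_lift !jE; have [<-{i}|nli] := eqVneq l i.
  have lE z : upd v (lift j l) z (lift j l) = z by rewrite /upd eqxx.
  rewrite !lE !upd_upd.
  by have /= -> := ll (v j) c x y; rewrite la.
have iE z : upd v (lift j l) z (lift j i) = v (lift j i).
  by rewrite /upd (inj_eq lift_inj) eq_sym (negPf nli).
by rewrite !iE !(updC _ _ _ nli) la.
Qed.

(** If two neighbouring arguments are equal, the terms whose bracket contains one of
    them cancel against those whose bracket contains the other; in the remaining
    terms the form is evaluated on equal neighbours. *)
Lemma ext_d_alt k (a : form g k) : alt_form a -> alt_form (ext_d br a).
Proof.
move=> aa; have [la za] := aa; case: br_lin => _ _ br0.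
split=> [|v p q pq vpq]; first exact: ext_d_mlin.
rewrite ext_dE.
have npq : q != p by apply/eqP => E; rewrite E in pq; lia.
rewrite (bigD1 p) //= (bigD1 q) //= [X in _ + (_ + X)]big1 => [|j /andP[jp jq]].
  rewrite addr0.
  have qk : (q < k.+1)%N := ltn_ord q.
  have pk : (p < k)%N by lia.
  pose p' := Ordinal pk.
  rewrite [X in _ + X](bigD1 p') /=; last by rewrite pq.
  have -> : ext_d_term a v q p' = 0.
    rewrite /ext_d_term.
    have -> : lift q p' = p by apply/val_inj; rewrite /= /bump /=; lia.
    rewrite vpq br0.
    have := la (fun l => v (lift q l)) p' (-1) 0 0.
    by rewrite scaler0 addr0 mulN1r addNr.
  rewrite mulr0 add0r.
  rewrite [X in _ + X](eq_bigl (fun i : 'I_k => (i < p)%N)); last first.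
    by move=> i; rewrite -val_eqE /= pq; lia.
  rewrite -big_split big1 //= => i ip.
  rewrite pq exprS mulN1r mulNr -mulrBr.
  have -> : ext_d_term a v q i = ext_d_term a v p i; last by rewrite subrr mulr0.
  rewrite /ext_d_term; congr a.
  have -> : lift q i = lift p i by apply/val_inj; rewrite /= /bump /=; lia.
  rewrite vpq; congr upd; apply/funext => l.
  have [lp|lp] := eqVneq (l : nat) p; last first.
    by congr v; apply/val_inj; rewrite /= /bump /=; lia.
  have -> : lift q l = p by apply/val_inj; rewrite /= /bump /=; lia.
  have -> : lift p l = q by apply/val_inj; rewrite /= /bump /=; lia.
  exact: vpq.
have jk : (j < k.+1)%N := ltn_ord j.
have qk : (q < k.+1)%N := ltn_ord q.
have jp' : j != p :> nat by [].
have jq' : j != q :> nat by [].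
case: (ltnP j p) => hjp.
  have k1 : (p.-1 < k)%N by lia.
  have k2 : (q.-1 < k)%N by lia.
  rewrite big1 // => i ij; rewrite /ext_d_term.
  rewrite (za _ (Ordinal k1) (Ordinal k2)) ?mulr0 //=; first by lia.
  rewrite /upd -!val_eqE /=.
  have -> : (p.-1 == i) = false by lia.
  have -> : (q.-1 == i) = false by lia.
  have -> : lift j (Ordinal k1) = p by apply/val_inj; rewrite /= /bump /=; lia.
  by have -> : lift j (Ordinal k2) = q by apply/val_inj; rewrite /= /bump /=; lia.
have k1 : (p < k)%N by lia.
have k2 : (q < k)%N by lia.
pose p' := Ordinal k1; pose q' := Ordinal k2.
have Ep : lift j p' = p by apply/val_inj; rewrite /= /bump /=; lia.
have Eq : lift j q' = q by apply/val_inj; rewrite /= /bump /=; lia.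
have npq' : p' != q' by rewrite -val_eqE /=; lia.
rewrite (bigD1 p') /=; last by lia.
rewrite (bigD1 q') /=; last by rewrite eq_sym npq' andbT; lia.
rewrite [X in _ + (_ + X)]big1 => [|i /andP[/andP[ij ip] iq]].
  rewrite addr0 -mulrDr.
  suff -> : ext_d_term a v j q' = - ext_d_term a v j p' by rewrite subrr mulr0.
  rewrite /ext_d_term Ep Eq -vpq.
  set u := (fun l : 'I_k => v (lift j l)).
  have uq : upd u q' (v p) = u by rewrite vpq -Eq /u upd_id.
  have up : upd u p' (v p) = u by rewrite -Ep /u upd_id.
  rewrite -{1}up -{2}uq (updC _ _ _ npq').
  rewrite [X in _ = - a X](updC _ _ _ (_ : q' != p')) 1?eq_sym//.
  by rewrite [X in a X](updC _ _ _ (_ : q' != p')) 1?eq_sym// (alternating_swap _ _ _ aa).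
rewrite /ext_d_term (za _ p' q') ?mulr0 //.
by rewrite /upd eq_sym (negPf ip) eq_sym (negPf iq) Ep Eq.
Qed.

Lemma ext_d_zero k (a : form g k) v : multilinear a ->
  (forall i j, br (v i) (v j) = 0) -> ext_d br a v = 0.
Proof.
move=> la br0; rewrite ext_dE big1 // => j _; rewrite big1 // => i _.
rewrite /ext_d_term br0; have := la (fun l => v (lift j l)) i (-1) 0 0.
by rewrite scaler0 addr0 mulN1r addNr => ->; rewrite mulr0.
Qed.

(** Among vectors of an Abelian ideal and one further vector, only the brackets with
    the latter survive. *)
Lemma ext_d_transverse k (a : form g k.+1) x (v : 'I_k.+1 -> g) : multilinear a ->
  (forall i j, br (v i) (v j) = 0) ->
  ext_d br a (consv x v) =
  \sum_(j < k.+1) (-1) ^+ j.+1 * a (consv (br x (v j)) (fun l => v (lift j l))).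
Proof.
move=> la br0; rewrite ext_dE big_ord_recl big1 // add0r.
apply: eq_bigr => j _; rewrite (bigD1 ord0) //= big1 ?addr0 => [|i /andP[_ i0]].
  have -> : bump 0 j = j.+1 by [].
  congr (_ * _); rewrite /ext_d_term.
  have -> : lift (lift ord0 j) ord0 = ord0 :> 'I_k.+2 by apply/val_inj.
  rewrite consv0 consvS; congr a; rewrite [RHS]consvE consv0.
  apply/funext => l; rewrite /upd; case: (unliftP ord0 l) => [l' ->|->].
    rewrite eq_sym (negPf (neq_lift _ _)) !consvS.
    have -> : lift (lift ord0 j) (lift ord0 l') = lift ord0 (lift j l').
      by apply/val_inj; rewrite /= /bump /=; lia.
    by rewrite consvS.
  by rewrite eqxx consv0.
rewrite /ext_d_term; case: (unliftP ord0 i) i0 => [i' ->|->] // _.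
have -> : lift (lift ord0 j) (lift ord0 i') = lift ord0 (lift j i').
  by apply/val_inj; rewrite /= /bump /=; lia.
rewrite !consvS br0; have := la (fun l => consv x v (lift (lift ord0 j) l)) (lift ord0 i') (-1) 0 0.
by rewrite scaler0 addr0 mulN1r addNr => ->; rewrite mulr0.
Qed.

Lemma ext_d_fcomp (e : nat -> g) (A : nat -> nat -> R) zs k (a : form g k.+1) x l :
  multilinear a -> size l = k.+1 ->
  (forall i j, i \in l -> j \in l -> br (e i) (e j) = 0) ->
  (forall j, j \in l -> br (e x) (e j) = \sum_(z <- zs) A z j *: e z) ->
  fcomp e (ext_d br a) (x :: l) =
  \sum_(j <- iota 0 k.+1) \sum_(z <- zs)
     (-1) ^+ j.+1 * (A z (nth 0%N l j) * fcomp e a (z :: take j l ++ drop j.+1 l)).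
Proof.
move=> la sl br0 brx.
have mem_l (i : 'I_k.+1) : nth 0%N l i \in l by rewrite mem_nth ?sl.
rewrite [LHS](_ : _ = ext_d br a (consv (e x) (fun i : 'I_k.+1 => e (nth 0%N l i)))).
  rewrite ext_d_transverse //; last by move=> i j; apply: br0.
  have -> : iota 0 k.+1 = index_iota 0 k.+1 by [].
  rewrite big_mkord.
  apply: eq_bigr => j _; rewrite brx // -(upd_consv0 0) multilinear_sum // mulr_sumr.
  apply: eq_bigr => z _; congr (_ * (_ * _)); rewrite upd_consv0 /fcomp; congr a.
  rewrite [RHS]consvE; congr consv; apply/funext => i.
  rewrite /= /bump /= nth_cat size_take sl ltn_ord.
  case: ltnP => ij; first by rewrite nth_take.
  rewrite nth_drop; congr (e (nth _ _ _)); lia.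
rewrite /fcomp; congr (ext_d br a _); rewrite [LHS]consvE.
by congr consv.
Qed.

End Differential.

(** * The standard G2-form *)

Section Tables.

Fixpoint combs (k : nat) (s : seq nat) : seq (seq nat) :=
  match k, s with
  | 0, _ => [:: [::]]
  | k'.+1, [::] => [::]
  | k'.+1, x :: s' => map (cons x) (combs k' s') ++ combs k s'
  end.

Lemma combs_subseq k l s : subseq l s -> size l = k -> l \in combs k s.
Proof.
elim: s k l => [|x s IH] [|k] [|y l] //=.
case: eqP => [->|_] ss [sl]; rewrite mem_cat.
  by rewrite map_f // IH.
by rewrite (IH k.+1) ?orbT //= sl.
Qed.

Lemma sorted_combs n k l : sorted ltn l -> size l = k -> all (ltn^~ n) l ->
  l \in combs k (iota 0 n).
Proof.
move=> sl szl al; apply: combs_subseq => //.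
have -> : l = [seq x <- iota 0 n | x \in l].
  apply: (irr_sorted_eq ltn_trans ltnn) => //.
    by apply: sorted_filter; [exact: ltn_trans|exact: iota_ltn_sorted].
  move=> x; rewrite mem_filter mem_iota /= add0n.
  by case: (boolP (x \in l)) => //= /(allP al).
exact: filter_subseq.
Qed.

(** A property of finitely many index lists is proved by unfolding this conjunction
    into one goal for each list. *)
Fixpoint all_list T (P : T -> Prop) (s : seq T) : Prop :=
  if s is x :: s' then P x /\ all_list P s' else True.

Lemma all_listP (T : eqType) (P : T -> Prop) s : all_list P s ->
  forall x, x \in s -> P x.
Proof.
elim: s => [|y s IH] //= [Py Ps] x; rewrite inE => /predU1P[->//|]; exact: IH.
Qed.

(** The lines of the Fano plane with the signs of the standard form; indices start
    from 0. *)
Definition g2_lines : seq (seq nat * int) :=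
  [:: ([:: 0; 1; 2]%N, 1); ([:: 0; 3; 4]%N, 1); ([:: 0; 5; 6]%N, 1);
      ([:: 1; 3; 5]%N, 1); ([:: 1; 4; 6]%N, -1); ([:: 2; 3; 6]%N, -1);
      ([:: 2; 4; 5]%N, -1)].

Definition g2_tab (l : seq nat) : int :=
  let r := isort l in
  foldr (fun p acc => if p.1 == r.2 then r.1 * p.2 else acc) 0 g2_lines.

(** Unlike the big operators, this sum can be evaluated. *)
Definition isum (T : Type) (s : seq T) (F : T -> int) : int :=
  foldr (fun x acc => F x + acc) 0 s.

Definition nth3 (l : seq nat) i := nth 0%N l i.

(** Most coefficients of the standard form vanish; skipping the second factor in that
    case makes a sum over the permutations of seven indices feasible. *)
Definition lazy_mul (t : int) (x : unit -> int) : int :=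
  if t == 0 then 0 else t * x tt.

Lemma lazy_mulE t x : lazy_mul t x = t * x tt.
Proof. by rewrite /lazy_mul; case: eqP => // ->; rewrite mul0r. Qed.

(** The sum over permutations that the product
    (e_i _| phi) /\ (e_j _| phi) /\ phi hides, before its division by
    (2! 2!) (4! 3!) = 576. *)
Definition g2_metric_count (i j : nat) : int :=
  isum (permutations (iota 0 7)) (fun l =>
    lazy_mul (g2_tab [:: nth3 l 4; nth3 l 5; nth3 l 6]) (fun=> isgn l *
      isum (permutations (iota 0 4)) (fun u =>
        lazy_mul (g2_tab [:: i; nth3 l (nth3 u 0); nth3 l (nth3 u 1)]) (fun=>
          lazy_mul (g2_tab [:: j; nth3 l (nth3 u 2); nth3 l (nth3 u 3)]) (fun=>
            isgn u))))).

Lemma g2_metric_countE i j : (i < 7)%N -> (j < 7)%N ->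
  g2_metric_count i j = if i == j then 3456 else 0.
Proof.
have : all (fun i => all (fun j =>
  g2_metric_count i j == if i == j then 3456 else 0) (iota 0 7)) (iota 0 7).
  by vm_compute.
(* 3456 = 6 * 576 *)
by move=> /allP H i7 j7; apply/eqP; move: (H i); rewrite mem_iota => /(_ i7) /allP; apply;
   rewrite mem_iota.
Qed.

End Tables.

Section StandardForm.
Variables (R : realType) (g : vectType R).

(** The 3 x 3 minor that e^{ijk} takes on vectors with coordinates [x i r]. *)
Definition det3 (x : nat -> 'I_3 -> R) (i j k : nat) : R :=
  let y i r := x i (inord r) in
  y i 0%N * (y j 1%N * y k 2 - y j 2 * y k 1%N)
  - y i 1%N * (y j 0%N * y k 2 - y j 2 * y k 0%N)
  + y i 2 * (y j 0%N * y k 1%N - y j 1%N * y k 0%N).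

Definition g2_poly (x : nat -> 'I_3 -> R) : R :=
  det3 x 0 1 2 + det3 x 0 3 4 + det3 x 0 5 6 + det3 x 1 3 5
  - det3 x 1 4 6 - det3 x 2 3 6 - det3 x 2 4 5.

Lemma permutations2 : permutations (iota 0 2) = [:: [:: 0; 1]; [:: 1; 0]]%N.
Proof. by vm_compute. Qed.

Lemma permutations3 : permutations (iota 0 3) =
  [:: [:: 1; 0; 2]; [:: 0; 1; 2]; [:: 2; 0; 1]; [:: 0; 2; 1]; [:: 1; 2; 0]; [:: 2; 1; 0]]%N.
Proof. by vm_compute. Qed.

Lemma flist_inord k n (s : 'I_k -> 'I_n.+1) i : s i = inord (nth 0%N (flist s) i).
Proof. by rewrite nth_flist inord_val. Qed.

Lemma wedge_coframe2 (b : 7.-tuple g) i j (v : 'I_2 -> g) :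
  wedge (coframe b i) (coframe b j) v =
  coframe b i (fun=> v ord0) * coframe b j (fun=> v ord_max)
  - coframe b i (fun=> v ord_max) * coframe b j (fun=> v ord0).
Proof.
rewrite /wedge (_ : 1`! = 1%N) // mulr1 invr1 mul1r.
pose F (l : seq nat) := coframe b i (fun=> v (inord (nth 0%N l 0))) *
  coframe b j (fun=> v (inord (nth 0%N l 1))).
rewrite (eq_bigr (fun s : 'S_2 => (-1) ^+ s * F (flist s))) => [|s _].
  rewrite (@sum_perm R 2 F) permutations2 !big_cons big_nil /F /=.
  have -> : inord 0 = ord0 :> 'I_2 by apply/val_inj; rewrite /= inordK.
  have -> : inord 1 = ord_max :> 'I_2 by apply/val_inj; rewrite /= inordK.
  by rewrite /isgn /=; ring.
rewrite -mulrA /F; congr (_ * (_ * _)); congr coframe; apply/funext => r;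
  by rewrite [in LHS]flist_inord /= ?[r]ord1.
Qed.

Lemma coframe3E (b : 7.-tuple g) i j k (v : 'I_3 -> g) :
  coframe3 b i.+1 j.+1 k.+1 v = det3 (fun i r => coord b (inord i) (v r)) i j k.
Proof.
rewrite /coframe3; set w2 := wedge _ (coframe b j.+1); rewrite /wedge.
pose F (l : seq nat) :=
  (coframe b i.+1 (fun=> v (inord (nth 0%N l 0))) *
  coframe b j.+1 (fun=> v (inord (nth 0%N l 1)))
  - coframe b i.+1 (fun=> v (inord (nth 0%N l 1))) *
  coframe b j.+1 (fun=> v (inord (nth 0%N l 0)))) *
  coframe b k.+1 (fun=> v (inord (nth 0%N l 2))).
rewrite (eq_bigr (fun s : 'S_3 => (-1) ^+ s * F (flist s))) => [|s _].
  rewrite (@sum_perm R 3 F) permutations3 !big_cons big_nil /F /isgn /= /coframe /det3 /=.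
  rewrite (_ : (1 + 1)`! = 2%N) // (_ : 1`! = 1%N) //.
  by field.
rewrite -mulrA /w2 wedge_coframe2 /F; congr (_ * (_ * _)).
  by rewrite ![in LHS](flist_inord s).
by congr coframe; apply/funext => r; rewrite [in LHS]flist_inord /= ?[r]ord1.
Qed.

Lemma standard_g2E (b : 7.-tuple g) v :
  standard_g2 b v = g2_poly (fun i r => coord b (inord i) (v r)).
Proof. by rewrite /standard_g2 !coframe3E. Qed.

Lemma g2_poly_lin (x : nat -> 'I_3 -> R) (y z : nat -> R) c s :
  g2_poly (fun i r => if r == s then c * y i + z i else x i r) =
  c * g2_poly (fun i r => if r == s then y i else x i r) +
  g2_poly (fun i r => if r == s then z i else x i r).
Proof.
rewrite /g2_poly /det3; case: s => -[|[|[|//]]] i3;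
  by rewrite -!val_eqE /= !inordK //=; ring.
Qed.

Lemma standard_g2_alt (b : 7.-tuple g) : alt_form (standard_g2 b).
Proof.
split=> [v s c x y|v i j ij vij].
  have E (w : g) : (fun i r => coord b (inord i) (upd v s w r)) =
      (fun i r => if r == s then coord b (inord i) w else coord b (inord i) (v r)).
    by apply/funext => i; apply/funext => r; rewrite /upd; case: eqP.
  rewrite !standard_g2E !E -g2_poly_lin; congr g2_poly.
  by apply/funext => i; apply/funext => r; case: eqP => // _; rewrite linearP.
have [E|E] : v (inord 0) = v (inord 1) \/ v (inord 1) = v (inord 2).
  move: vij; rewrite -(inord_val i) -(inord_val j) ij.
  by case: i ij => -[|[|[|//]]] i3 /= ij vij; [left|right|case: j ij => /= j3 ? ?; lia].
- by rewrite standard_g2E /g2_poly /det3 E; ring.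
- by rewrite standard_g2E /g2_poly /det3 E; ring.
Qed.

Section Basis.
Variable b : 7.-tuple g.
Hypothesis bb : basis_of {:g} b.
Let e := nth 0 b.

Lemma coord_e i j : (i < 7)%N -> (j < 7)%N ->
  coord b (inord i) (e j) = (i == j)%:R.
Proof.
move=> i7 j7; have -> : e j = b`_(Ordinal j7) by [].
by rewrite coord_free ?(basis_free bb)// -val_eqE /= inordK // eq_sym.
Qed.

Lemma standard_g2_sorted l : l \in combs 3 (iota 0 7) ->
  fcomp e (standard_g2 b) l = (g2_tab l)%:~R.
Proof.
move=> lc; have al : all (ltn^~ 7) l.
  by move: l lc; apply/allP; vm_compute.
have l7 i : (nth 0%N l i < 7)%N.
  have [il|il] := ltnP i (size l); last by rewrite nth_default.
  by move/(all_nthP 0%N): al; apply.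
transitivity (g2_poly (fun i r => (i == nth 0%N l r)%:R)).
  rewrite /fcomp standard_g2E /g2_poly /det3.
  by rewrite !coord_e.
move: l lc {al l7}; apply: all_listP.
have i0 : inord 0 = ord0 :> 'I_3 by apply/val_inj; rewrite /= inordK.
have i1 : inord 1 = Ordinal (isT : (1 < 3)%N) by apply/val_inj; rewrite /= inordK.
have i2 : inord 2 = Ordinal (isT : (2 < 3)%N) by apply/val_inj; rewrite /= inordK.
rewrite /g2_poly /det3 i0 i1 i2 /=.
do !split; rewrite /g2_tab /=; ring.
Qed.

Lemma standard_g2_comp l : size l = 3 -> all (ltn^~ 7) l ->
  fcomp e (standard_g2 b) l = (g2_tab l)%:~R.
Proof.
move=> sl al; have aa := standard_g2_alt b.
rewrite (comp_isort e aa sl).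
have tabE : g2_tab l = isgn l * g2_tab (isort l).2 \/ isgn l = 0.
  have [|n0] := eqVneq (isgn l) 0; [by right|left].
  rewrite /g2_tab (isort_id (isort_sorted n0)) /isgn.
  elim: g2_lines => [|[x c] s IH] /=; first by rewrite mulr0.
  by case: eqP => _; rewrite ?mul1r.
case: tabE => [->|s0]; last first.
  rewrite s0 mul0r /g2_tab -/(isgn l) s0.
  by elim: g2_lines => [|[x c] s IH] //=; case: eqP => // _; rewrite mul0r.
rewrite intrM; have [->|n0] := eqVneq (isgn l) 0; first by rewrite !mul0r.
congr (_ * _); apply: standard_g2_sorted; apply: sorted_combs.
- exact: isort_sorted.
- by rewrite (perm_size (perm_isort _)).
- by rewrite (perm_all _ (perm_isort _)).
Qed.

End Basis.
End StandardForm.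

(** * Metric and volume of a G2-structure *)

Section Wedge.
Variables (R : realType) (g : vectType R).

Lemma upd_comp k l (v : 'I_l -> g) (f : 'I_k -> 'I_l) i x : injective f ->
  (fun r => upd v (f i) x (f r)) = upd (fun r => v (f r)) i x.
Proof. by move=> fi; apply/funext => r; rewrite /upd (inj_eq fi). Qed.

Lemma upd_comp_out k l (v : 'I_l -> g) (f : 'I_k -> 'I_l) i x :
  (forall r, f r != i) -> (fun r => upd v i x (f r)) = (fun r => v (f r)).
Proof. by move=> fi; apply/funext => r; rewrite /upd (negPf (fi r)). Qed.

Lemma wedge_alt k l (a : form g k) (c : form g l) :
  multilinear a -> multilinear c -> alt_form (wedge a c).
Proof.
move=> la lc; split=> [v i t x y|v i j ij vij].
  rewrite /wedge mulrCA -mulrDr; congr (_ * _).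
  rewrite mulr_sumr -big_split /=; apply: eq_bigr => s _.
  have fl : injective (fun r : 'I_k => s (lshift l r)).
    by move=> r q /perm_inj /lshift_inj.
  have fr : injective (fun r : 'I_l => s (rshift k r)).
    by move=> r q /perm_inj /rshift_inj.
  rewrite -(permKV s i); case: (splitP ((s^-1)%g i)) => q iq.
    have -> : (s^-1)%g i = lshift l q by apply/val_inj.
    have E z : c (fun r => upd v (s (lshift l q)) z (s (rshift k r))) =
               c (fun r => v (s (rshift k r))).
      by congr c; apply: upd_comp_out => r; rewrite (inj_eq perm_inj) eq_rlshift.
    have E' z : a (fun r => upd v (s (lshift l q)) z (s (lshift l r))) =
                a (upd (fun r => v (s (lshift l r))) q z) := congr1 a (upd_comp _ _ _ fl).
    by rewrite !E !E' la mulrDr mulrDl mulrCA !mulrA.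
  have -> : (s^-1)%g i = rshift k q by apply/val_inj.
  have E z : a (fun r => upd v (s (rshift k q)) z (s (lshift l r))) =
             a (fun r => v (s (lshift l r))).
    by congr a; apply: upd_comp_out => r; rewrite (inj_eq perm_inj) eq_lrshift.
  have E' z : c (fun r => upd v (s (rshift k q)) z (s (rshift k r))) =
              c (upd (fun r => v (s (rshift k r))) q z) := congr1 c (upd_comp _ _ _ fr).
  by rewrite !E !E' lc mulrDr mulrCA.
have nij : i != j by apply/eqP => E; rewrite E in ij; lia.
rewrite /wedge; set S := \sum_(s : _) _.
suff : S = - S by move/eqP; rewrite -addr_eq0 -mulr2n mulrn_eq0 /= => /eqP ->; rewrite mulr0.
rewrite {1}/S (reindex_inj (mulIg (tperm i j))) /= -sumrN; apply: eq_bigr => s _.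
rewrite odd_permM odd_tperm nij addbT.
have vt r : v ((s * tperm i j)%g r) = v (s r).
  by rewrite permM; case: tpermP => // ->.
have -> : (fun r => v ((s * tperm i j)%g (lshift l r))) = (fun r => v (s (lshift l r))).
  by apply/funext => r.
have -> : (fun r => v ((s * tperm i j)%g (rshift k r))) = (fun r => v (s (rshift k r))).
  by apply/funext => r.
by case: (odd_perm s) => /=; rewrite ?expr0 ?expr1 ?mulN1r ?mul1r ?mulNr ?opprK.
Qed.

Lemma contract_mlin k x (a : form g (1 + k)) : multilinear a -> multilinear (contract x a).
Proof. by move=> la v i c y z; rewrite /contract !catv_updr la. Qed.

Lemma multilinear_wedge k l (a : form g k) (c : form g l) :
  multilinear a -> multilinear c -> multilinear (wedge a c).
Proof. by move=> la lc; have [] := wedge_alt la lc. Qed.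

Lemma catv_cons (e : nat -> g) k i J :
  catv (fun _ : 'I_1 => e i) (fun q : 'I_k => e (nth 0%N J q)) =
  (fun q : 'I_(1 + k) => e (nth 0%N (i :: J) q)).
Proof.
apply/funext => q; rewrite /catv; case: splitP => r ->; rewrite ?ord1 //.
Qed.

Lemma isumE (T : Type) (s : seq T) (F : T -> int) :
  (isum s F)%:~R = \sum_(x <- s) (F x)%:~R :> R.
Proof. by elim: s => [|x s IH]; rewrite ?big_nil ?big_cons //= intrD IH. Qed.

Lemma nth_lt n l i : all (ltn^~ n.+1) l -> (nth 0%N l i < n.+1)%N.
Proof.
move=> al; have [il|il] := ltnP i (size l); last by rewrite nth_default.
by move/(all_nthP 0%N): al; apply.
Qed.

Variable b : 7.-tuple g.
Hypothesis bb : basis_of {:g} b.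
Let e := nth 0 b.
Variable phi : form g 3.
Hypothesis phiE : phi =1 standard_g2 b.

Lemma phi_standard : phi = standard_g2 b. Proof. exact/funext. Qed.

Lemma phi_alt : alt_form phi.
Proof. by rewrite phi_standard; exact: standard_g2_alt. Qed.

Lemma phi_comp l : size l = 3 -> all (ltn^~ 7) l -> fcomp e phi l = (g2_tab l)%:~R.
Proof. by rewrite phi_standard; exact: standard_g2_comp. Qed.

Lemma phi_comp3 x y z : (x < 7)%N -> (y < 7)%N -> (z < 7)%N ->
  fcomp e phi [:: x; y; z] = (g2_tab [:: x; y; z])%:~R.
Proof. by move=> *; apply: phi_comp => //=; apply/and4P. Qed.

(** The Gram matrix of a standard frame, times the volume of the frame, is therefore
    the identity; [vol_basis] separates the two factors. *)
Lemma g2_metric_wedge i j : (i < 7)%N -> (j < 7)%N ->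
  wedge (wedge (contract (k := 2) (e i) phi) (contract (k := 2) (e j) phi)) phi
    (fun r : 'I_7 => e r) = 6 * (i == j)%:R.
Proof.
move=> i7 j7.
have inner l : all (ltn^~ 7) l ->
    wedge (contract (k := 2) (e i) phi) (contract (k := 2) (e j) phi)
      (fun q : 'I_4 => e (nth 0%N l q)) =
    4^-1 * (isum (permutations (iota 0 4)) (fun u =>
        lazy_mul (g2_tab [:: i; nth3 l (nth3 u 0); nth3 l (nth3 u 1)]) (fun=>
          lazy_mul (g2_tab [:: j; nth3 l (nth3 u 2); nth3 l (nth3 u 3)]) (fun=>
            isgn u))))%:~R.
  move=> al; rewrite /wedge (_ : 2`! = 2%N) // -natrM (_ : (2 * 2)%N = 4%N) //.
  congr (_ * _); pose F u :=
     (g2_tab [:: i; nth3 l (nth3 u 0); nth3 l (nth3 u 1)] *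
      g2_tab [:: j; nth3 l (nth3 u 2); nth3 l (nth3 u 3)])%:~R : R.
  rewrite (eq_bigr (fun s : 'S_4 => (-1) ^+ s * F (flist s))) => [|s _].
    rewrite (@sum_perm R 4 F) isumE; apply: eq_bigr => u _.
    by rewrite /F !lazy_mulE -intrM; congr (_%:~R); ring.
  rewrite -mulrA; congr (_ * _); rewrite /F intrM; congr (_ * _).
    rewrite -phi_comp3 ?nth_lt // /contract.
    have -> : (fun q : 'I_2 => e (nth 0%N l (s (lshift 2 q)))) =
      (fun q : 'I_2 => e (nth 0%N [:: nth3 l (nth3 (flist s) 0); nth3 l (nth3 (flist s) 1)] q)).
      apply/funext => q; rewrite -nth_flist /nth3.
      by case: q => -[|[|//]].
    by rewrite catv_cons.
  rewrite -phi_comp3 ?nth_lt // /contract.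
  have -> : (fun q : 'I_2 => e (nth 0%N l (s (rshift 2 q)))) =
    (fun q : 'I_2 => e (nth 0%N [:: nth3 l (nth3 (flist s) 2); nth3 l (nth3 (flist s) 3)] q)).
    apply/funext => q; rewrite -nth_flist /nth3.
    by case: q => -[|[|//]].
  by rewrite catv_cons.
set w := wedge _ (contract _ _); rewrite /wedge.
pose X l := isum (permutations (iota 0 4)) (fun u =>
        lazy_mul (g2_tab [:: i; nth3 l (nth3 u 0); nth3 l (nth3 u 1)]) (fun=>
          lazy_mul (g2_tab [:: j; nth3 l (nth3 u 2); nth3 l (nth3 u 3)]) (fun=>
            isgn u))).
pose F l := 4^-1 * (X l * g2_tab [:: nth3 l 4; nth3 l 5; nth3 l 6])%:~R : R.
rewrite (eq_bigr (fun s : 'S_7 => (-1) ^+ s * F (flist s))) => [|s _].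
  rewrite (@sum_perm R 7 F).
  have -> : \sum_(l <- permutations (iota 0 7)) (isgn l)%:~R * F l =
    4^-1 * (g2_metric_count i j)%:~R.
    rewrite isumE mulr_sumr; apply: eq_bigr => l _.
    by rewrite lazy_mulE -/(X l) /F !intrM; ring.
  rewrite g2_metric_countE //.
  have -> : (2 + 2)`! = 24%N by []. have -> : 3`! = 6%N by [].
  by case: eqP => _ /=; field.
rewrite -mulrA; congr (_ * _); rewrite /F intrM mulrA; congr (_ * _).
  rewrite -inner ?flist_lt // -/w; congr w; apply/funext => q.
  by rewrite -[X in e X]nth_flist.
rewrite -phi_comp3 ?nth_lt ?flist_lt // /fcomp; congr phi; apply/funext => q.
rewrite -nth_flist /nth3; by case: q => -[|[|[|//]]].
Qed.

Variables (m : g -> g -> R) (vol : form g 7).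
Hypothesis ind : g2_induces phi m vol.

Lemma e_neq0 i : (i < 7)%N -> e i != 0.
Proof.
move=> i7; apply/eqP => e0; have := coord_e bb i7 i7.
by rewrite -/e e0 linear0 eqxx => /eqP; rewrite eq_sym oner_eq0.
Qed.

Lemma vol_alt : alt_form vol.
Proof.
case: ind => -[_ _ mp] _ volE.
have m0 := mp _ (e_neq0 (isT : (0 < 7)%N)).
have -> : vol = fun v => (6 * m (e 0%N) (e 0%N))^-1 *
  wedge (wedge (contract (k := 2) (e 0%N) phi) (contract (k := 2) (e 0%N) phi)) phi v.
  apply/funext => v; rewrite -volE mulKf // mulf_neq0 ?pnatr_eq0 //.
  by rewrite gt_eqF.
have lc : multilinear (contract (k := 2) (e 0%N) phi).
  by apply: contract_mlin; exact: phi_alt.1.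
exact: (alternating_scale _ (wedge_alt (multilinear_wedge lc lc) phi_alt.1)).
Qed.

Lemma metric_vol i j : (i < 7)%N -> (j < 7)%N ->
  m (e i) (e j) * fcomp e vol (iota 0 7) = (i == j)%:R.
Proof.
case: ind => _ _ volE i7 j7.
have := volE (e i) (e j) (fun r : 'I_7 => e r); rewrite g2_metric_wedge // -mulrA.
move/(mulfI (_ : 6 != 0)); rewrite pnatr_eq0 => /(_ isT) <-; congr (_ * vol _).
by apply/funext => r; rewrite nth_iota.
Qed.

Lemma fcomp_scale (a : form g 7) c : alt_form a ->
  a (fun r : 'I_7 => c *: e r) = c ^+ 7 * fcomp e a (iota 0 7).
Proof.
move=> aa; rewrite (top_form _ bb aa) mulrC; congr (_ * _).
rewrite /det_form -[RHS]det_scalar; congr (\det _); apply/matrixP => i j.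
by rewrite !mxE linearZ /= (coord_free _ _ (basis_free bb)) eq_sym mulr_natr.
Qed.

(** Let [c] be the volume of the frame. The defining identity gives
    m (e_i, e_j) = delta_ij / c, so that the frame scaled by sqrt c is orthonormal; its
    volume, (sqrt c)^9, is then 1. *)
Lemma vol_basis : fcomp e vol (iota 0 7) = 1.
Proof.
have [[lm mC mp] volN _] := ind.
set c := fcomp e vol (iota 0 7).
have m0 := mp _ (e_neq0 (isT : (0 < 7)%N)).
have cm := metric_vol (isT : (0 < 7)%N) (isT : (0 < 7)%N).
have c0 : 0 < c by rewrite -(pmulr_rgt0 _ m0) cm eqxx ltr01.
pose r := Num.sqrt c.
have r0 : 0 < r by rewrite sqrtr_gt0.
have rr : r ^+ 2 = c by rewrite sqr_sqrtr // ltW.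
have mZ x y : m x (r *: y) = r * m x y.
  have -> : r *: y = r *: y + 0 by rewrite addr0.
  by have /= -> := lm x r y 0; have /= := lm x (-1) 0 0; rewrite scaler0 addr0 mulN1r addNr => ->; rewrite addr0.
have on : orthonormal m (fun i : 'I_7 => r *: e i).
  move=> i j; rewrite mZ mC mZ mC mulrA -expr2 rr mulrC metric_vol //.
have := volN _ on; rewrite fcomp_scale; last exact: vol_alt.
rewrite -/c -[X in _ * X]rr -exprD ger0_norm ?exprn_ge0 ?ltW // => r9.
have r1 : r = 1 by apply/eqP; have /eqP := r9; rewrite pexprn_eq1 ?ltW.
by rewrite -rr r1 expr1n.
Qed.

Lemma metric_basis : orthonormal m (fun i : 'I_7 => e i).
Proof.
by move=> i j; have := metric_vol (ltn_ord i) (ltn_ord j); rewrite vol_basis mulr1.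
Qed.

End Wedge.

(** * The dual 4-form and the Hodge star in an adapted frame *)

Definition compl (n : nat) (J : seq nat) : seq nat := [seq i <- iota 0 n | i \notin J].

Lemma perm_compl n J : uniq J -> all (ltn^~ n) J -> perm_eq (compl n J ++ J) (iota 0 n).
Proof.
move=> uJ aJ; rewrite perm_catC; apply: uniq_perm; rewrite ?iota_uniq//.
  rewrite cat_uniq uJ filter_uniq ?iota_uniq// andbT.
  by apply/hasPn => x; rewrite mem_filter => /andP[].
move=> x; rewrite mem_cat mem_filter mem_iota /= add0n.
by case: (boolP (x \in J)) => //= /(allP aJ) /= ->.
Qed.

Lemma compl_lt n J : all (ltn^~ n) (compl n J).
Proof. by apply/allP => x; rewrite mem_filter mem_iota => /andP[_ /andP[]]. Qed.

Lemma size_compl n J : uniq J -> all (ltn^~ n) J -> size (compl n J) = (n - size J)%N.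
Proof.
move=> uJ aJ; have /perm_size := perm_compl uJ aJ.
by rewrite size_cat size_iota => H; have := addnK (size J) (size (compl n J)); rewrite H.
Qed.

Definition star_sgn J : int := if uniq J then isgn (compl 7 J ++ J) else 0.

Section Frames.
Variables (R : realType) (g : vectType R).
Implicit Types (p : g2_structure g) (b : 7.-tuple g).

Definition frame p b := basis_of {:g} b /\ g2_form p =1 standard_g2 b.

Lemma frame_exists p : exists b, frame p b.
Proof. by case: (g2_formP p) => b bb pE; exists b. Qed.

Lemma g2_form_alt p : alt_form (g2_form p).
Proof. by have [b [bb pE]] := frame_exists p; exact: phi_alt pE. Qed.

Lemma g2_vol_alt p : alt_form (g2_vol p).
Proof.
by have [b [bb pE]] := frame_exists p; exact: (vol_alt bb pE (g2_inducesP p)).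
Qed.

Lemma psi_alt p : alt_form (psi p).
Proof. by rewrite /psi; apply: hodge_alt; exact: g2_vol_alt. Qed.

Lemma g2_ip p : inner_product (g2_metric p).
Proof. by case: (g2_inducesP p). Qed.

Section Frame.
Variables (p : g2_structure g) (b : 7.-tuple g).
Hypothesis fr : frame p b.
Let e := nth 0 b.

Lemma frame_on : orthonormal (g2_metric p) (fun i : 'I_7 => b`_i).
Proof. by case: fr => bb pE; exact: (metric_basis bb pE (g2_inducesP p)). Qed.

Lemma frame_vol : fcomp e (g2_vol p) (iota 0 7) = 1.
Proof. by case: fr => bb pE; exact: (vol_basis bb pE (g2_inducesP p)). Qed.

Lemma frame_form l : size l = 3 -> all (ltn^~ 7) l ->
  fcomp e (g2_form p) l = (g2_tab l)%:~R.
Proof. by case: fr => bb pE; exact: phi_comp. Qed.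

Lemma star_comp k l (kl : (k + l)%N = 7) (vol : form g (k + l)) (a : form g k) J :
  alt_form a -> alt_form vol -> fcomp e vol (iota 0 7) = 1 ->
  size J = l -> all (ltn^~ 7) J ->
  fcomp e (hodge (g2_metric p) vol a) J = (star_sgn J)%:~R * fcomp e a (compl 7 J).
Proof.
move=> aa av v1 sJ aJ; rewrite /star_sgn; case: ifPn => uJ; last first.
  by rewrite mul0r (comp_nuniq _ (hodge_alt _ _ av)).
rewrite (hodge_comp (g2_ip p) fr.1 frame_on (I := compl 7 J)) //.
- by rewrite v1 mulr1.
- by rewrite size_compl // sJ; lia.
- exact: perm_compl.
Qed.

Lemma psi_comp J : size J = 4 -> all (ltn^~ 7) J ->
  fcomp e (psi p) J = (star_sgn J * g2_tab (compl 7 J))%:~R.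
Proof.
move=> sJ aJ; rewrite /psi star_comp //; last exact: frame_vol.
- rewrite /star_sgn intrM; case: ifPn => uJ; last by rewrite !mul0r.
  by rewrite frame_form ?compl_lt // size_compl // sJ.
- exact: g2_form_alt.
- exact: g2_vol_alt.
Qed.

Lemma psi_star : hodge (k := 4) (l := 3) (g2_metric p) (g2_vol p) (psi p) =
  g2_form p.
Proof.
apply/funext; apply: (alternating_ext (e := e) (N := 7)).
- exact: spanning_basis fr.1.
- by apply: hodge_alt; exact: g2_vol_alt.
- exact: g2_form_alt.
move=> l sl al ssl; rewrite star_comp //; last exact: frame_vol.
- have ul := sorted_uniq ltn_trans ltnn ssl.
  rewrite psi_comp ?compl_lt ?size_compl ?sl // frame_form // -intrM; congr (_%:~R).
  have : l \in combs 3 (iota 0 7) by exact: sorted_combs.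
  move: l {sl al ssl ul}; apply: all_listP.
  by vm_compute.
- exact: psi_alt.
- exact: g2_vol_alt.
Qed.

End Frame.

Lemma bilinear_ext p p' b : basis_of {:g} b ->
  (forall i j : 'I_7, g2_metric p b`_i b`_j = g2_metric p' b`_i b`_j) ->
  g2_metric p = g2_metric p'.
Proof.
move=> bb H; apply/funext => x; apply/funext => y.
have ip := g2_ip p; have ip' := g2_ip p'.
rewrite (coord_basis bb (memvf x)) (coord_basis bb (memvf y)).
rewrite (ip_sumr ip) (ip_sumr ip'); apply: eq_bigr => j _; congr (_ * _).
case: (ip) => _ mC _; case: (ip') => _ mC' _; rewrite mC mC'.
rewrite (ip_sumr ip) (ip_sumr ip'); apply: eq_bigr => i _; congr (_ * _).
by rewrite mC mC'.
Qed.

(** The form determines the whole structure. *)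
Lemma g2_form_inj p p' : g2_form p =1 g2_form p' ->
  g2_metric p = g2_metric p' /\ g2_vol p = g2_vol p'.
Proof.
move=> pp'; have [b [bb pE]] := frame_exists p.
have fr : frame p b by [].
have fr' : frame p' b by split=> // v; rewrite -pp'.
split; first by apply: (bilinear_ext bb) => i j; rewrite (frame_on fr) (frame_on fr').
apply/funext => v; rewrite (top_form _ bb (g2_vol_alt p)) (top_form _ bb (g2_vol_alt p')).
by rewrite (frame_vol fr) (frame_vol fr').
Qed.

Lemma psi_inj p p' : g2_form p =1 g2_form p' -> psi p = psi p'.
Proof.
by move=> pp'; have [mE vE] := g2_form_inj pp'; rewrite /psi mE vE (funext pp').
Qed.

End Frames.

(** * The Hodge Laplacian of an almost abelian bracket *)

Section Derivation.
Variables (R : realType) (g : vectType R).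

(** The action of an endomorphism on a form, as a derivation. *)
Definition form_der (Q : g -> g) k (a : form g k) : form g k :=
  fun v => \sum_(s < k) a (upd v s (Q (v s))).

Lemma form_der_alt (Q : g -> g) k (a : form g k) : linear Q -> alt_form a ->
  alt_form (form_der Q a).
Proof.
move=> lQ aa; have [la za] := aa; split=> [v i c x y|v i j ij vij]; rewrite /form_der.
  rewrite mulr_sumr -big_split /=; apply: eq_bigr => s _.
  have [<-{i}|si] := eqVneq s i.
    have E z : upd v s z s = z by rewrite /upd eqxx.
    by rewrite !upd_upd !E lQ la.
  have E z : upd v i z s = v s by rewrite /upd (negPf si).
  by rewrite !E !(updC _ _ _ (_ : i != s)) 1?eq_sym // la.
have nij : i != j by apply/eqP => E; rewrite E in ij; lia.
rewrite (bigD1 i) //= (bigD1 j) 1?eq_sym //= big1 ?addr0 => [|s /andP[si sj]].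
  rewrite -vij; set X := Q (v i).
  have E : upd v i X = upd (upd v i X) j (v i).
    by rewrite updC // vij upd_id.
  by rewrite E (alternating_swap _ _ _ aa ij) upd_id addNr.
apply: (za _ i j ij).
by rewrite /upd eq_sym (negPf si) eq_sym (negPf sj).
Qed.

End Derivation.

(** A linear combination of monomials in matrix entries: coefficient and list
    of entries. *)
Definition lterm : Type := int * seq (nat * nat).

(** The formula of [ext_d_fcomp] on symbolic coefficients: if [arr] lists the
    coefficients of a form, this is the coefficient of its differential on
    [0 :: l]. *)
Definition d_terms (arr : seq nat -> seq lterm) (l : seq nat) : seq lterm :=
  flatten [seq flatten [seq [seq ((-1) ^+ j.+1 * t.1, (z, nth 0%N l j) :: t.2)
                            | t <- arr (z :: take j l ++ drop j.+1 l)]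
                       | z <- iota 1 6]
          | j <- iota 0 (size l)].

Definition const_terms (c : int) : seq lterm :=
  if c == 0 then [::] else [:: (c, [::])].

Definition psi_tab (l : seq nat) : int := star_sgn l * g2_tab (compl 7 l).

(** Since d^* psi = * d phi, a coefficient on [K] is one of [d phi] on the complement of
    [K], whose first index is 0. *)
Definition codiff_terms (K : seq nat) : seq lterm :=
  if uniq K then
    [seq (star_sgn K * t.1, t.2)
    | t <- d_terms (fun l => const_terms (g2_tab l)) (behead (compl 7 K))]
  else [::].

(** Components of [d d^* psi], as quadratic forms in the matrix of the
    bracket. *)
Definition laplacian_terms (l : seq nat) : seq lterm :=
  if l is 0%N :: L then d_terms codiff_terms L else [::].

Definition der_terms (l : seq nat) : seq lterm :=
  flatten [seq flatten [seq
     (let c := psi_tab (set_nth 0%N l s z) in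
      if c == 0 then [::] else [:: (c, [:: (z, nth 0%N l s)])]) | z <- iota 0 7]
  | s <- iota 0 4].

Section Core.
Variables (R : realType) (g : vectType R) (br : g -> g -> g).
Hypothesis br_lin : [/\ forall x, linear (br x), forall y, linear (br^~ y)
  & forall x, br x x = 0].

Definition eval_terms (A : nat -> nat -> R) (s : seq lterm) : R :=
  foldr (fun (t : lterm) acc =>
    t.1%:~R * foldr (fun q acc => A q.1 q.2 * acc) 1 t.2 + acc) 0 s.

Lemma eval_cat A s1 s2 : eval_terms A (s1 ++ s2) = eval_terms A s1 + eval_terms A s2.
Proof. by elim: s1 => [|t s IH] /=; rewrite ?add0r // IH addrA. Qed.

Lemma eval_flatten A (T : Type) (s : seq T) (F : T -> seq lterm) :
  eval_terms A (flatten [seq F x | x <- s]) = \sum_(x <- s) eval_terms A (F x).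
Proof. by elim: s => [|x s IH] /=; rewrite ?big_nil ?big_cons // eval_cat IH. Qed.

Lemma eval_scale A c s :
  eval_terms A [seq (c * t.1, t.2) | t <- s] = c%:~R * eval_terms A s.
Proof. by elim: s => [|t s IH] /=; rewrite ?mulr0 // IH intrM; ring. Qed.

Lemma eval_const A c : eval_terms A (const_terms c) = c%:~R.
Proof. by rewrite /const_terms; case: eqP => [->|_] //=; rewrite mulr1 addr0. Qed.

Lemma eval_d_terms A arr l : eval_terms A (d_terms arr l) =
  \sum_(j <- iota 0 (size l)) \sum_(z <- iota 1 6)
    (-1) ^+ j.+1 * (A z (nth 0%N l j) *
                    eval_terms A (arr (z :: take j l ++ drop j.+1 l))).
Proof.
rewrite eval_flatten; apply: eq_bigr => j _.
rewrite eval_flatten; apply: eq_bigr => z _.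
elim: (arr _) => [|t s IH] /=; first by rewrite !mulr0.
by rewrite IH intrM rmorphXn /= rmorphN1; ring.
Qed.

Variables (p : g2_structure g) (b : 7.-tuple g).
Hypothesis fr : frame p b.
Let e := nth 0 b.

(** [b_1, .., b_6] span an abelian ideal on which [b_0] acts by [A]. *)
Definition abelian_frame (A : nat -> nat -> R) : Prop :=
  (forall i j, i \in iota 1 6 -> j \in iota 1 6 -> br (e i) (e j) = 0) /\
  (forall j, j \in iota 1 6 -> br (e 0%N) (e j) = \sum_(z <- iota 1 6) A z j *: e z).

Variable A : nat -> nat -> R.
Hypothesis frA : abelian_frame A.

Lemma sub_lt7 l : {subset l <= iota 1 6} -> all (ltn^~ 7) l.
Proof. by move=> sl; apply/allP => x /sl; rewrite mem_iota => /andP[]. Qed.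

Lemma ext_d_comp_h k (a : form g k) l : multilinear a -> size l = k.+1 ->
  {subset l <= iota 1 6} -> fcomp e (ext_d br a) l = 0.
Proof.
move=> la sl sub; apply: ext_d_zero => // i j.
by apply: frA.1; apply: sub; rewrite mem_nth ?sl.
Qed.

Lemma ext_d_comp k (a : form g k.+1) l arr : multilinear a -> size l = k.+1 ->
  {subset l <= iota 1 6} ->
  (forall l', size l' = k.+1 -> {subset l' <= iota 1 6} ->
     fcomp e a l' = eval_terms A (arr l')) ->
  fcomp e (ext_d br a) (0%N :: l) = eval_terms A (d_terms arr l).
Proof.
move=> la sl sub H.
rewrite (@ext_d_fcomp _ _ br e A (iota 1 6)) //; last 2 first.
- by move=> i j il jl; apply: frA.1; apply: sub.
- by move=> j jl; apply: frA.2; apply: sub.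
rewrite eval_d_terms sl big_seq [RHS]big_seq; apply: eq_bigr => j.
rewrite mem_iota => /andP[_ jk]; rewrite big_seq [RHS]big_seq.
apply: eq_bigr => z z6; rewrite H //.
  by rewrite /= size_cat size_take size_drop sl; case: ltnP; lia.
move=> x; rewrite inE => /predU1P[->//|]; rewrite mem_cat => /orP[/mem_take|/mem_drop];
exact: sub.
Qed.

Lemma d_form_comp l : size l = 3 -> {subset l <= iota 1 6} ->
  fcomp e (ext_d br (g2_form p)) (0%N :: l) =
  eval_terms A (d_terms (fun l => const_terms (g2_tab l)) l).
Proof.
move=> sl sub; apply: ext_d_comp => //; first exact: (g2_form_alt p).1.
by move=> l' sl' sub'; rewrite eval_const (frame_form fr) // sub_lt7.
Qed.

Lemma d_psi_comp l : size l = 4 -> {subset l <= iota 1 6} ->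
  fcomp e (ext_d br (psi p)) (0%N :: l) =
  eval_terms A (d_terms (fun l => const_terms (psi_tab l)) l).
Proof.
move=> sl sub; apply: ext_d_comp => //; first exact: (psi_alt p).1.
by move=> l' sl' sub'; rewrite eval_const (psi_comp fr) // sub_lt7.
Qed.

Lemma codiff4_psi : codiff4 br p (psi p) =
  hodge (k := 4) (l := 3) (g2_metric p) (g2_vol p) (ext_d br (g2_form p)).
Proof. by rewrite /codiff4 (psi_star fr). Qed.

Lemma codiff4_alt : alt_form (codiff4 br p (psi p)).
Proof. by rewrite codiff4_psi; apply: hodge_alt; exact: g2_vol_alt. Qed.

Lemma codiff_comp K : size K = 3 -> {subset K <= iota 1 6} ->
  fcomp e (codiff4 br p (psi p)) K = eval_terms A (codiff_terms K).
Proof.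
move=> sK sub; have aK := sub_lt7 sub; rewrite codiff4_psi (star_comp fr) //; last first.
- exact: frame_vol.
- exact: g2_vol_alt.
- by apply: (ext_d_alt br_lin); exact: g2_form_alt.
rewrite /codiff_terms; case: ifPn => uK; last first.
  by rewrite /star_sgn (negPf uK) mul0r.
rewrite eval_scale; congr (_ * _).
have n0 : 0%N \notin K by apply/negP => /sub; rewrite mem_iota.
have cE : compl 7 K = 0%N :: [seq i <- iota 1 6 | i \notin K].
  by rewrite /compl -[iota 0 7]/(0%N :: iota 1 6) /= n0.
have sc := size_compl uK aK; rewrite sK cE in sc.
rewrite cE d_form_comp //; first by case: sc.
by move=> x; rewrite mem_filter => /andP[].
Qed.

Lemma laplacian_comp l : l \in combs 4 (iota 0 7) ->
  fcomp e (ext_d br (codiff4 br p (psi p))) l = eval_terms A (laplacian_terms l).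
Proof.
move=> lc; have [L [sL subL lE]] : exists L, [/\ size L = if head 1 l is 0%N then 3 else 4,
    {subset L <= iota 1 6} & l = if head 1 l is 0%N then 0%N :: L else L].
  have : all (fun l => (size (if head 1 l is 0%N then behead l else l) ==
     if head 1 l is 0%N then 3 else 4) &&
    all (mem (iota 1 6)) (if head 1 l is 0%N then behead l else l) &&
     (l != [::])) (combs 4 (iota 0 7)).
    by vm_compute.
  move=> /allP /(_ _ lc) /andP[/andP[/eqP h1 /allP h2] h3].
  exists (if head 1 l is 0%N then behead l else l); split => //.
  by case: l h3 {lc h1 h2} => //= -[].
rewrite lE; case hl : (head 1 l) sL lE => [|n] sL lE /=.
  apply: ext_d_comp => //; first exact: codiff4_alt.1.
  by move=> l' sl' sub'; exact: codiff_comp.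
rewrite ext_d_comp_h //; last exact: codiff4_alt.1.
by rewrite -lE; case: (l) hl => [|[]].
Qed.

Definition mat_end (Q : nat -> nat -> R) : g -> g :=
  fun x => \sum_(j < 7) coord b j x *: \sum_(z <- iota 0 7) Q z j *: e z.

Lemma mat_end_linear Q : linear (mat_end Q).
Proof.
move=> c x y; rewrite /mat_end scaler_sumr -big_split /=; apply: eq_bigr => j _.
by rewrite linearP scalerDl scalerA.
Qed.

Lemma mat_end_basis Q j : (j < 7)%N -> mat_end Q (e j) = \sum_(z <- iota 0 7) Q z j *: e z.
Proof.
move=> j7; rewrite /mat_end (bigD1 (Ordinal j7)) //= [X in _ + X]big1 ?addr0 => [|i ij].
  have := coord_e fr.1 j7 j7; rewrite (_ : inord j = Ordinal j7).
    by move=> ->; rewrite eqxx scale1r.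
  by apply/val_inj; rewrite /= inordK.
rewrite -[X in coord _ X]inord_val (coord_e fr.1) //.
by rewrite -val_eqE /= in ij; rewrite (negPf ij) scale0r.
Qed.

Lemma der_comp Q l : size l = 4 -> all (ltn^~ 7) l ->
  fcomp e (form_der (mat_end Q) (psi p)) l = eval_terms Q (der_terms l).
Proof.
move=> sl al; rewrite /fcomp /form_der /der_terms eval_flatten.
have -> : iota 0 4 = index_iota 0 4 by [].
rewrite big_mkord; apply: eq_bigr => s _; rewrite eval_flatten.
have sl7 : (nth 0%N l s < 7)%N by move/(all_nthP 0%N): al; apply; rewrite sl.
rewrite mat_end_basis // multilinear_sum; last exact: (psi_alt p).1.
rewrite big_seq [RHS]big_seq; apply: eq_bigr => z; rewrite mem_iota => z7.
have -> : psi p (upd (fun i : 'I_4 => e (nth 0%N l i)) s (e z)) =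
    (psi_tab (set_nth 0%N l s z))%:~R.
  rewrite -(psi_comp fr); last 2 first.
  - by rewrite size_set_nth sl; apply/maxn_idPr; exact: ltn_ord.
  - apply/(all_nthP 0%N) => i _; rewrite nth_set_nth /=; case: eqP => // _.
    by apply: nth_lt.
  rewrite /fcomp; congr psi; apply/funext => i; rewrite /upd nth_set_nth /=.
  by rewrite -val_eqE /=; case: eqP.
by case: eqP => [->|_] /=; ring.
Qed.

End Core.

(** * The flow on sp(6, R) *)

Section Symplectic.
Variable R : realType.
Implicit Types (x : nat -> R) (P : nat -> nat -> R).

Definition sum3 (f : nat -> R) : R := f 0%N + f 1%N + f 2.

Definition sym_entry (o : nat) x (j k : nat) : R :=
  match j, k with
  | 0, 0 => x o | 0, 1 | 1, 0 => x o.+1 | 0, _ | _, 0 => x o.+2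
  | 1, 1 => x (o + 3)%N | 1, _ | _, 1 => x (o + 4)%N
  | _, _ => x (o + 5)%N
  end.

Definition skew_entry x (j k : nat) : R :=
  match j, k with
  | 0, 1 => x 0%N | 1, 0 => - x 0%N | 0, 2 => x 1%N | 2, 0 => - x 1%N
  | 1, 2 => x 2 | 2, 1 => - x 2 | _, _ => 0
  end.

(** Real and imaginary parts of the skew-Hermitian part [U] and of the symmetric
    part [S] of an element of sp(6, R), acting on C^3 by
    [v |-> U v + S (conj v)]. *)
Definition U1 x := skew_entry x.
Definition U2 x := sym_entry 3 x.
Definition S1 x := sym_entry 9 x.
Definition S2 x := sym_entry 15 x.

(** Entry [(a, c)] of the real 6 x 6 matrix of [v |-> P v + Q (conj v)]. *)
Definition real_mat (P1 P2 Q1 Q2 : nat -> nat -> R) (a c : nat) : R :=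
  let j := a./2 in let k := c./2 in
  match odd a, odd c with
  | false, false => P1 j k + Q1 j k
  | false, true => Q2 j k - P2 j k
  | true, false => P2 j k + Q2 j k
  | true, true => P1 j k - Q1 j k
  end.

Definition sp_mat x := real_mat (U1 x) (U2 x) (S1 x) (S2 x).

(** [W = U S + S U^T]. *)
Definition W1 x j k : R := sum3 (fun i =>
  U1 x j i * S1 x i k - U2 x j i * S2 x i k + S1 x j i * U1 x k i - S2 x j i * U2 x k i).
Definition W2 x j k : R := sum3 (fun i =>
  U1 x j i * S2 x i k + U2 x j i * S1 x i k + S1 x j i * U2 x k i + S2 x j i * U1 x k i).

Definition cofactor1 x (a c a' c' : nat) : R :=
  (* real part of S_ac S_a'c' - S_ac' S_a'c *)
  S1 x a c * S1 x a' c' - S2 x a c * S2 x a' c'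
  - (S1 x a c' * S1 x a' c - S2 x a c' * S2 x a' c).
Definition cofactor2 x (a c a' c' : nat) : R :=
  S1 x a c * S2 x a' c' + S2 x a c * S1 x a' c'
  - (S1 x a c' * S2 x a' c + S2 x a c' * S1 x a' c).

Definition next3 (i : nat) : nat := match i with 0 => 1 | 1 => 2 | _ => 0 end.
(** [T] is the conjugate of the adjugate of [S]. *)
Definition T1 x j k : R :=
  cofactor1 x (next3 j) (next3 k) (next3 (next3 j)) (next3 (next3 k)).
Definition T2 x j k : R :=
  - cofactor2 x (next3 j) (next3 k) (next3 (next3 j)) (next3 (next3 k)).

Definition Y1 x j k : R := W1 x j k + 2 * T1 x j k.
Definition Y2 x j k : R := W2 x j k + 2 * T2 x j k.
Definition Y_mat x := real_mat (fun _ _ => 0) (fun _ _ => 0) (Y1 x) (Y2 x).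

Definition tau x : R := sum3 (fun j => U2 x j j).
Definition normS x : R :=
  sum3 (fun j => sum3 (fun k => S1 x j k ^+ 2 + S2 x j k ^+ 2)).
Definition qq x : R := tau x ^+ 2 + normS x.

(** The endomorphism through which the Laplacian acts on psi. *)
Definition Q_mat x (a c : nat) : R :=
  match a, c with
  | 0, 0 => qq x | a'.+1, c'.+1 => - Y_mat x a' c' | _, _ => 0
  end.

Definition A_mat x (a c : nat) : R :=
  match a, c with a'.+1, c'.+1 => sp_mat x a' c' | _, _ => 0 end.

Definition dU1 x j k : R := - (qq x * U1 x j k) - sum3 (fun i =>
  Y1 x j i * S1 x i k + Y2 x j i * S2 x i k - S1 x j i * Y1 x i k - S2 x j i * Y2 x i k).
Definition dU2 x j k : R := - (qq x * U2 x j k) - sum3 (fun i =>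
  Y2 x j i * S1 x i k - Y1 x j i * S2 x i k - S2 x j i * Y1 x i k + S1 x j i * Y2 x i k).
Definition dS1 x j k : R := - (qq x * S1 x j k) + sum3 (fun i =>
  U1 x j i * Y1 x i k - U2 x j i * Y2 x i k + Y1 x j i * U1 x k i - Y2 x j i * U2 x k i).
Definition dS2 x j k : R := - (qq x * S2 x j k) + sum3 (fun i =>
  U1 x j i * Y2 x i k + U2 x j i * Y1 x i k + Y1 x j i * U2 x k i + Y2 x j i * U1 x k i).

(** The bracket flow [A' = - q A - [Y, A]] in the coordinates of [sp_mat]. *)
Definition sp_field x : seq R :=
  let sym (f : nat -> nat -> R) :=
    [:: f 0 0; f 0 1; f 0 2; f 1 1; f 1 2; f 2 2]%N in
  [:: dU1 x 0 1; dU1 x 0 2; dU1 x 1 2]%N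
  ++ sym (dU2 x) ++ sym (dS1 x) ++ sym (dS2 x).

Definition normA x : R := sum3 (fun j => sum3 (fun k =>
  U1 x j k ^+ 2 + U2 x j k ^+ 2 + S1 x j k ^+ 2 + S2 x j k ^+ 2)).

Lemma Y1C x j k : (j < 3)%N -> (k < 3)%N -> Y1 x j k = Y1 x k j.
Proof.
rewrite /Y1 /W1 /T1 /cofactor1 /sum3 /S1 /S2.
by case: j => [|[|[|//]]]; case: k => [|[|[|//]]] //= _ _; ring.
Qed.

Lemma Y2C x j k : (j < 3)%N -> (k < 3)%N -> Y2 x j k = Y2 x k j.
Proof.
rewrite /Y2 /W2 /T2 /cofactor2 /sum3 /S1 /S2.
by case: j => [|[|[|//]]]; case: k => [|[|[|//]]] //= _ _; ring.
Qed.

(** [Y] lies in sp(6, R) as well, so that the bracket flow is an equation for the 21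
    coordinates. *)
Lemma sp_field_bracket x a c : (a < 6)%N -> (c < 6)%N ->
  sp_mat (nth 0 (sp_field x)) a c = - (qq x * sp_mat x a c) -
  \sum_(k <- iota 0 6) (Y_mat x a k * sp_mat x k c - sp_mat x a k * Y_mat x k c).
Proof.
have [y1 [y2 y3]] : Y1 x 1 0 = Y1 x 0 1 /\ Y1 x 2 0 = Y1 x 0 2 /\ Y1 x 2 1 = Y1 x 1 2.
  by split; [|split]; apply: Y1C.
have [z1 [z2 z3]] : Y2 x 1 0 = Y2 x 0 1 /\ Y2 x 2 0 = Y2 x 0 2 /\ Y2 x 2 1 = Y2 x 1 2.
  by split; [|split]; apply: Y2C.
rewrite unlock /= /sp_mat /Y_mat /real_mat.
case: a => [|[|[|[|[|[|//]]]]]] _; case: c => [|[|[|[|[|[|//]]]]]] _ /=;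
rewrite /U1 /U2 /S1 /S2 /= /dU1 /dU2 /dS1 /dS2 /sum3 ?(y1, y2, y3, z1, z2, z3)
  /U1 /U2 /S1 /S2 /=; ring.
Qed.

(** <[Y, A], A> = <Y, [A, A^T]>, and [W] represents half of [A, A^T]. *)
Lemma normA_derivative x :
  sum3 (fun j => sum3 (fun k => U1 x j k * dU1 x j k + U2 x j k * dU2 x j k
    + S1 x j k * dS1 x j k + S2 x j k * dS2 x j k)) =
  - (qq x * normA x) - 2 * sum3 (fun j => sum3 (fun k =>
      Y1 x j k * W1 x j k + Y2 x j k * W2 x j k)).
Proof.
have [y1 [y2 y3]] : Y1 x 1 0 = Y1 x 0 1 /\ Y1 x 2 0 = Y1 x 0 2 /\ Y1 x 2 1 = Y1 x 1 2.
  by split; [|split]; apply: Y1C.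
have [z1 [z2 z3]] : Y2 x 1 0 = Y2 x 0 1 /\ Y2 x 2 0 = Y2 x 0 2 /\ Y2 x 2 1 = Y2 x 1 2.
  by split; [|split]; apply: Y2C.
rewrite /normA /W1 /W2 /dU1 /dU2 /dS1 /dS2 /sum3 ?(y1, y2, y3, z1, z2, z3).
rewrite /U1 /U2 /S1 /S2 /=.
ring.
Qed.

Definition normT x : R := sum3 (fun j => sum3 (fun k => T1 x j k ^+ 2 + T2 x j k ^+ 2)).

Lemma normS_ge0 x : 0 <= normS x.
Proof. by rewrite /normS /sum3 !addr_ge0 ?sqr_ge0. Qed.

(** The entries of [T] are the 2 x 2 minors of [S]. By Lagrange's identity the minors in
    two rows have square sum at most the product of the square norms of these rows. *)
Lemma normT_le x : 2 * normT x <= normS x ^+ 2.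
Proof.
pose n a := sum3 (fun k => S1 x a k ^+ 2 + S2 x a k ^+ 2).
have n0 a : 0 <= n a by rewrite /n /sum3 !addr_ge0 ?sqr_ge0.
(* Lagrange's identity for two rows of S in C^3 *)
have lagrange a c : sum3 (fun k =>
    cofactor1 x a (next3 k) c (next3 (next3 k)) ^+ 2 +
    cofactor2 x a (next3 k) c (next3 (next3 k)) ^+ 2) <= n a * n c.
  rewrite -subr_ge0.
  have -> : n a * n c - sum3 (fun k =>
    cofactor1 x a (next3 k) c (next3 (next3 k)) ^+ 2 +
    cofactor2 x a (next3 k) c (next3 (next3 k)) ^+ 2) =
    sum3 (fun k => S1 x a k * S1 x c k + S2 x a k * S2 x c k) ^+ 2 +
    sum3 (fun k => S2 x a k * S1 x c k - S1 x a k * S2 x c k) ^+ 2.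
    by rewrite /n /cofactor1 /cofactor2 /sum3 /=; ring.
  by rewrite addr_ge0 ?sqr_ge0.
have h0 := lagrange 1%N 2; have h1 := lagrange 2 0%N; have h2 := lagrange 0%N 1%N.
have -> : normT x = sum3 (fun j => sum3 (fun k =>
    cofactor1 x (next3 j) (next3 k) (next3 (next3 j)) (next3 (next3 k)) ^+ 2 +
    cofactor2 x (next3 j) (next3 k) (next3 (next3 j)) (next3 (next3 k)) ^+ 2)).
  by rewrite /normT /T1 /T2 /sum3 !sqrrN.
have -> : normS x = n 0%N + n 1%N + n 2 by [].
rewrite {1}/sum3; have s0 := sqr_ge0 (n 0%N); have s1 := sqr_ge0 (n 1%N).
have s2 := sqr_ge0 (n 2).
move: h0 h1 h2; rewrite /=; nra.
Qed.

(** Completing the square,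
    - 2 <W, W + 2 T> = 2 |T|^2 - 2 |W + T|^2, and the remaining positive term is absorbed:
    2 |T|^2 <= |S|^4 <= q |A|^2. *)
Lemma normA_decreasing x :
  sum3 (fun j => sum3 (fun k => U1 x j k * dU1 x j k + U2 x j k * dU2 x j k
    + S1 x j k * dS1 x j k + S2 x j k * dS2 x j k)) <= 0.
Proof.
rewrite normA_derivative.
have WT : 0 <= sum3 (fun j => sum3 (fun k =>
    (W1 x j k + T1 x j k) ^+ 2 + (W2 x j k + T2 x j k) ^+ 2)).
  by rewrite /sum3 !addr_ge0 ?sqr_ge0.
have -> : - (qq x * normA x) - 2 * sum3 (fun j => sum3 (fun k =>
      Y1 x j k * W1 x j k + Y2 x j k * W2 x j k)) =
  - (qq x * normA x) + 2 * normT x - 2 * sum3 (fun j => sum3 (fun k =>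
    (W1 x j k + T1 x j k) ^+ 2 + (W2 x j k + T2 x j k) ^+ 2)).
  by rewrite /normT /Y1 /Y2 /sum3; ring.
have := normT_le x.
have NS : normS x <= normA x.
  have -> : normA x = normS x + sum3 (fun j => sum3 (fun k => U1 x j k ^+ 2 + U2 x j k ^+ 2)).
    by rewrite /normA /normS /sum3; ring.
  by rewrite lerDl /sum3 !addr_ge0 ?sqr_ge0.
have qS : normS x <= qq x by rewrite /qq lerDr sqr_ge0.
have : normS x ^+ 2 <= qq x * normA x.
  by rewrite expr2 ler_pM ?normS_ge0.
lra.
Qed.

End Symplectic.

(** Computes the tables of coefficients before algebraic identities are checked. *)
Ltac eval_lists f :=
  repeat match goal with
  | |- context [f ?l] => let t := eval vm_compute in (f l) in change (f l) with t
  end.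

Section CoreIdentity.
Variable R : realType.

(** The 35 coefficients of d d^* psi = Q psi, each a quadratic identity in the
    coordinates of sp(6, R). *)
Lemma laplacian_identity (x : nat -> R) l : l \in combs 4 (iota 0 7) ->
  eval_terms (A_mat x) (laplacian_terms l) = eval_terms (Q_mat x) (der_terms l).
Proof.
move: l; apply: all_listP.
let t := eval vm_compute in (combs 4 (iota 0 7)) in change (combs 4 (iota 0 7)) with t.
rewrite /all_list.
do !split; try exact: I.
all: eval_lists laplacian_terms; eval_lists der_terms.
all: rewrite /eval_terms /= /qq /tau /normS /sp_mat /Y_mat /real_mat /Y1 /Y2 /W1 /W2 /T1 /T2
  /cofactor1 /cofactor2 /sum3 /U1 /U2 /S1 /S2 /sym_entry /skew_entry /=.
all: ring.
Qed.
End CoreIdentity.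

(** * Coclosed structures in an adapted frame *)

Section CoclosedFrames.
Variables (R : realType) (g : vectType R) (br : g -> g -> g).
Hypothesis br_lin : [/\ forall x, linear (br x), forall y, linear (br^~ y)
  & forall x, br x x = 0].
Variables (p : g2_structure g) (b : 7.-tuple g).
Hypothesis fr : frame p b.

Lemma alt_form0 k : alt_form ((fun=> 0%R) : form g k).
Proof. by split=> // v i c x y; rewrite mulr0 addr0. Qed.

(** On the ideal psi is omega^2 / 2, which sp(6, R) preserves. *)
Lemma psi_closed_identity (x : nat -> R) L : L \in combs 4 (iota 1 6) ->
  eval_terms (A_mat x) (d_terms (fun l => const_terms (psi_tab l)) L) = 0.
Proof.
move: L; apply: all_listP.
let t := eval vm_compute in (combs 4 (iota 1 6)) in change (combs 4 (iota 1 6)) with t.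
rewrite /all_list; do !split; try exact: I.
all: eval_lists (d_terms (fun l => const_terms (psi_tab l))).
all: rewrite /eval_terms /= /sp_mat /real_mat /U1 /U2 /S1 /S2 /=; ring.
Qed.

Lemma combs_tail k : {subset combs k.+1 (iota 0 7) <=
  map (cons 0%N) (combs k (iota 1 6)) ++ combs k.+1 (iota 1 6)}.
Proof. by []. Qed.

Lemma combs_sub k s l : l \in combs k s -> {subset l <= s} /\ size l = k.
Proof.
elim: s k l => [|x s IH] [|k] l //=; try by rewrite inE => /eqP->.
rewrite mem_cat => /orP[/mapP[l' /IH[sub sl] ->]|/IH[sub sl]].
  split=> /=; last by rewrite sl.
  by move=> y; rewrite !inE => /predU1P[->|/sub ->]; rewrite ?eqxx ?orbT.
by split=> // y /sub; rewrite inE => ->; rewrite orbT.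
Qed.

Lemma psi_closed x : abelian_frame br b (A_mat x) -> ext_d br (psi p) = fun=> 0.
Proof.
move=> frA; apply/funext; apply: (alternating_ext (e := nth 0 b) (N := 7)).
- exact: spanning_basis fr.1.
- by apply: (ext_d_alt br_lin); exact: psi_alt.
- exact: alt_form0.
move=> l sl al ssl; rewrite [RHS]/fcomp.
have /combs_tail := sorted_combs ssl sl al.
rewrite mem_cat => /orP[/mapP[L LL ->]|ll].
  have [sub sL] := combs_sub LL.
  by rewrite (d_psi_comp fr frA) // psi_closed_identity.
have [sub _] := combs_sub ll.
by apply: (ext_d_comp_h frA) => //; exact: (psi_alt p).1.
Qed.

Lemma hodge0 k l (m : g -> g -> R) (vol : form g (k + l)) :
  hodge m vol (fun=> 0) = fun=> 0.
Proof.
apply/funext => v; rewrite /hodge big1 ?mulr0 // => I _.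
by rewrite big1 // => J _; rewrite mulr0 mul0r.
Qed.

Lemma ext_d0 k : ext_d br ((fun=> 0%R) : form g k) = fun=> 0.
Proof.
apply/funext => v; rewrite /ext_d big1 // => j _; rewrite big1 // => i _.
by rewrite mulr0.
Qed.

(** In an adapted frame the Laplacian moves psi along its GL(7)-orbit. *)
Lemma laplacian_psi x : abelian_frame br b (A_mat x) ->
  hodge_laplacian4 br p (psi p) =1 form_der (mat_end b (Q_mat x)) (psi p).
Proof.
move=> frA v; rewrite /hodge_laplacian4 /codiff5 (psi_closed frA).
rewrite (hodge0 (k := 5) (l := 2)) ext_d0 (hodge0 (k := 3) (l := 4)) oppr0 addr0.
move: v; apply: (alternating_ext (e := nth 0 b) (N := 7)).
- exact: spanning_basis fr.1.
- by apply: (ext_d_alt br_lin); exact: (codiff4_alt br fr).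
- by apply: form_der_alt; [exact: mat_end_linear|exact: psi_alt].
move=> l sl al ssl; have lc := sorted_combs ssl sl al.
by rewrite (laplacian_comp br_lin fr frA) // laplacian_identity // (der_comp fr).
Qed.

(** The differential of psi is, up to sign, e^0 wedged with the action of [A] on
    omega^2 / 2. The 15 linear equations that make it vanish say that [A] preserves
    omega. *)
Lemma coclosed_symplectic A : abelian_frame br b A -> coclosed br p ->
  exists x, abelian_frame br b (A_mat x).
Proof.
move=> frA cc.
have E L : L \in combs 4 (iota 1 6) ->
    eval_terms A (d_terms (fun l => const_terms (psi_tab l)) L) = 0.
  move=> LL; have [sub sL] := combs_sub LL.
  by rewrite -(d_psi_comp fr frA) //; exact: cc.
have {}E : all_list (fun L => eval_terms A
    (d_terms (fun l => const_terms (psi_tab l)) L) = 0) (combs 4 (iota 1 6)).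
  elim: (combs _ _) E => //= L s IH E; split; first by apply: E; rewrite inE eqxx.
  by apply: IH => L' L's; apply: E; rewrite inE L's orbT.
(* Half sums and half differences of the four real blocks recover [U] and [S]. *)
pose hs (u v : R) := (u + v) / 2; pose hd (u v : R) := (u - v) / 2.
pose a j k := A (2 * j + 1)%N (2 * k + 1)%N.
pose d j k := A (2 * j + 2)%N (2 * k + 2)%N.
pose s j k := A (2 * j + 1)%N (2 * k + 2)%N.
pose c j k := A (2 * j + 2)%N (2 * k + 1)%N.
pose sym (f h : nat -> nat -> R) (o : R -> R -> R) :=
  [seq o (f q.1 q.2) (h q.1 q.2) | q <- [:: (0, 0); (0, 1); (0, 2); (1, 1); (1, 2); (2, 2)]%N].
pose x := nth 0 ([:: hs (a 0 1) (d 0 1); hs (a 0 2) (d 0 2); hs (a 1 2) (d 1 2)]%N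
  ++ sym c s hd ++ sym a d hd ++ sym c s hs).
exists x; split; first exact: frA.1.
move=> j j6; rewrite frA.2 // big_seq [RHS]big_seq; apply: eq_bigr => z z6.
congr (_ *: _); move: z z6 j j6.
suff H : all_list (fun z => all_list (fun j => A z j = A_mat x z j) (iota 1 6)) (iota 1 6).
  by move=> z z6 j j6; move: (all_listP H z6) => {}H; exact: (all_listP H j6).
move: E; let t := eval vm_compute in (combs 4 (iota 1 6)) in change (combs 4 (iota 1 6)) with t.
rewrite [iota 1 6]/= /all_list.
eval_lists (d_terms (fun l => const_terms (psi_tab l))).
rewrite /eval_terms /= /sp_mat /real_mat /U1 /U2 /S1 /S2 /= /x /hs /hd /a /d /s /c /=.
rewrite /muln_rec /= => E.
do 15! (case: E => ? E).
do !split; try exact: I; lra.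
Qed.

End CoclosedFrames.

(** * Ordinary differential equations *)

Section Calculus.
Variable R : realType.
Implicit Types (f df : R -> R) (t : R).

Lemma is_derive_continuous f t d : is_derive t 1 f d -> {for t, continuous f}.
Proof. by move=> fd; apply/differentiable_continuous/derivable1_diffP. Qed.

Lemma is_derive_mul f (h : R -> R) t (d d' : R) :
  is_derive t 1 f d -> is_derive t 1 h d' ->
  is_derive t 1 (fun s => f s * h s) (d * h t + f t * d').
Proof.
move=> fd hd; have H := @is_deriveM R _ f h t 1 _ _ fd hd.
have -> : d * h t + f t * d' = f t *: d' + h t *: d.
  by rewrite /GRing.scale /= addrC [d * _]mulrC.
exact: H.
Qed.

Lemma is_derive_sum_seq (I : Type) (r : seq I) (F : I -> R -> R) t (d : I -> R) :
  (forall i, is_derive t 1 (F i) (d i)) ->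
  is_derive t 1 (fun s => \sum_(i <- r) F i s) (\sum_(i <- r) d i).
Proof.
move=> H; elim: r => [|i r IH].
  have -> : (fun s => \sum_(i <- [::]) F i s) = cst 0.
    by apply/funext => s; rewrite big_nil.
  by rewrite big_nil; exact: is_derive_cst.
have -> : (fun s => \sum_(j <- i :: r) F j s) = F i + (fun s => \sum_(j <- r) F j s).
  by apply/funext => s; rewrite big_cons.
by rewrite big_cons; exact: is_deriveD.
Qed.

Lemma mean_value f df s t : s <= t ->
  (forall u, s <= u <= t -> is_derive u 1 f (df u)) ->
  exists2 c, s <= c <= t & f t - f s = df c * (t - s).
Proof.
move=> st H; have [||c cst E] := @MVT_segment R f df s t st.
- by move=> x xst; apply: H; rewrite !(itvP xst).
- apply: derivable_within_continuous => x xst.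
  by have [] // : is_derive x 1 f (df x) by apply: H; rewrite !(itvP xst).
by exists c => //; rewrite !(itvP cst).
Qed.

Lemma derive_le0 f df s t : s <= t ->
  (forall u, s <= u <= t -> is_derive u 1 f (df u)) ->
  (forall u, s <= u <= t -> df u <= 0) -> f t <= f s.
Proof.
move=> st H H0; have [c cst E] := mean_value st H.
by rewrite -subr_le0 E mulr_le0_ge0 ?H0 // subr_ge0.
Qed.

Lemma derive_bound f df (K T : R) : (forall u : R, `|u| < T -> is_derive u 1 f (df u)) ->
  (forall u : R, `|u| < T -> `|df u| <= K) -> f 0 = 0 ->
  forall t, `|t| < T -> `|f t| <= K * `|t|.
Proof.
move=> H HK f0 t tT; have [t0|t0] := leP 0 t.
  have ut u : 0 <= u <= t -> `|u| < T.
    case/andP=> u0 ut; rewrite ger0_norm //; apply: le_lt_trans ut _.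
    by rewrite -(ger0_norm t0).
  have [c ct E] := mean_value t0 (fun u h => H u (ut u h)).
  by move: E; rewrite f0 !subr0 => ->; rewrite normrM ler_wpM2r // HK // ut.
have ut u : t <= u <= 0 -> `|u| < T.
  case/andP=> tu u0; rewrite ler0_norm //; apply: le_lt_trans tT.
  by rewrite ltr0_norm // lerN2.
have [c ct E] := mean_value (ltW t0) (fun u h => H u (ut u h)).
have -> : f t = df c * t by move: E; rewrite f0 !sub0r mulrN => /oppr_inj.
by rewrite normrM ler_wpM2r // HK // ut.
Qed.

(** [f] times exp (- K u) decreases and [f] times exp (K u) increases, so that the
    conclusion holds on both sides of the initial time. *)
Lemma gronwall f df (K s e : R) :
  (forall u, Num.min s e <= u <= Num.max s e -> is_derive u 1 f (df u)) ->
  (forall u, Num.min s e <= u <= Num.max s e -> `|df u| <= K * f u) ->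
  f s = 0 -> 0 <= f e -> f e = 0.
Proof.
have expD (c u : R) : is_derive u 1 (fun v => expR (c * v)) (expR (c * u) * c).
  have -> : (fun v => expR (c * v)) = expR \o ( *%R c) by [].
  apply: is_derive1_comp.
  have := @is_deriveZ R _ _ id c u 1 1 (is_derive_id _ _).
  by rewrite /GRing.scale /= mulr1.
have hD (c u : R) : is_derive u 1 f (df u) ->
    is_derive u 1 (fun v => f v * expR (c * v)) ((df u + c * f u) * expR (c * u)).
  move=> fu; have -> : (df u + c * f u) * expR (c * u) =
    df u * expR (c * u) + f u * (expR (c * u) * c) by ring.
  exact: is_derive_mul.
move=> H HK fs fe; have e0 u := expR_gt0 (u : R).
have [se|es] := leP s e.
  have ms u : s <= u <= e -> Num.min s e <= u <= Num.max s e by rewrite min_l // max_r.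
  have : f e * expR (- K * e) <= f s * expR (- K * s).
    apply: (@derive_le0 (fun v => f v * expR (- K * v)) _ s e se).
      by move=> u ue; apply: hD; apply: H; apply: ms.
    move=> u ue; apply: mulr_le0_ge0; last exact: ltW.
    rewrite mulNr subr_le0.
    by apply: le_trans (HK _ (ms _ ue)); exact: ler_norm.
  rewrite fs mul0r pmulr_lle0 // => h; by apply/le_anti; rewrite h.
have ms u : e <= u <= s -> Num.min s e <= u <= Num.max s e.
  by rewrite (min_r (ltW es)) (max_l (ltW es)).
have : - (f s * expR (K * s)) <= - (f e * expR (K * e)).
  apply: (@derive_le0 (fun v => - (f v * expR (K * v)))
    (fun u => - ((df u + K * f u) * expR (K * u))) e s (ltW es)).
    by move=> u ue; apply: is_deriveN; apply: hD; apply: H; apply: ms.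
  move=> u ue; rewrite oppr_le0; apply: mulr_ge0; last exact: ltW.
  have := HK _ (ms _ ue); rewrite ler_norml => /andP[h _].
  by rewrite -lerBlDr sub0r.
rewrite fs mul0r lerN2 pmulr_lle0 // => h; by apply/le_anti; rewrite h.
Qed.

Lemma antiderivative f (T : R) : 0 < T -> continuous f ->
  exists G : R -> R, G 0 = 0 /\ forall t, `|t| < T -> is_derive t 1 G (f t).
Proof.
move=> T0 cf; pose F (x : R) := (\int[lebesgue_measure]_(t in `[(- T), x]) f t)%R.
exists (fun x => F x - F 0); split; first by rewrite subrr.
move=> t; rewrite ltr_norml => /andP[Tt tT].
have [] := @continuous_FTC1_closed R f (- T) t T tT _ Tt (cf t).
  apply: continuous_compact_integrable; first exact: segment_compact.
  by apply: continuous_subspaceT.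
rewrite -/F => dF F't.
have dFt : is_derive t 1 F (f t) by apply: DeriveDef; [exact: dF|rewrite -derive1E; exact: F't].
have := @is_deriveB R _ _ F (cst (F 0)) t 1 (f t) 0 dFt _.
by rewrite subr0; apply; exact: is_derive_cst.
Qed.

(** The lower bounds u_k - 2 c / 2^k increase and the upper bounds u_k + 2 c / 2^k
    decrease. *)
Lemma geometric_limit (u : nat -> R) c :
  (forall k, `|u k.+1 - u k| <= c / 2 ^+ k) ->
  exists l, forall k, `|u k - l| <= 2 * c / 2 ^+ k.
Proof.
move=> H; have c0 : 0 <= c.
  by have := le_trans (normr_ge0 _) (H 0%N); rewrite expr0 divr1.
pose v k := u k - 2 * c / 2 ^+ k; pose w k := u k + 2 * c / 2 ^+ k.
have p2 k : 0 < 2 ^+ k :> R by rewrite exprn_gt0.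
have half k : 2 * c / 2 ^+ k.+1 = c / 2 ^+ k.
  by rewrite exprS invfM mulrACA divff ?mul1r // pnatr_eq0.
have dbl k : 2 * c / 2 ^+ k = c / 2 ^+ k + c / 2 ^+ k by rewrite -mulrA mulr_natl mulr2n.
have vS k : v k <= v k.+1.
  rewrite /v half dbl; have := H k; rewrite ler_norml => /andP[h _]; lra.
have wS k : w k.+1 <= w k.
  rewrite /w half dbl; have := H k; rewrite ler_norml => /andP[_ h]; lra.
have vm : {homo v : i j / (i <= j)%N >-> i <= j} by apply: homo_leq => //; exact: le_trans.
have wm i j : (i <= j)%N -> w j <= w i.
  move=> ij; rewrite -(subnK ij); elim: (j - i)%N => [|n IH]; first by rewrite add0n.
  by rewrite addSn; apply: le_trans (wS _) IH.
have vw i j : v i <= w j.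
  have d0 k : 0 <= 2 * c / 2 ^+ k by rewrite divr_ge0 ?mulr_ge0 // ltW.
  apply: (le_trans (vm _ _ (leq_maxl i j))).
  apply: le_trans (wm _ _ (leq_maxr i j)).
  by rewrite /v /w; have := d0 (maxn i j); lra.
have hs : has_sup (range v).
  by split; [exists (v 0%N); exists 0%N|exists (w 0%N) => _ [k _ <-]].
exists (sup (range v)) => k; rewrite ler_norml; apply/andP; split.
  have : sup (range v) <= w k by apply: sup_le_ub hs.1 _ => _ [i _ <-].
  rewrite /w; lra.
have : v k <= sup (range v) by apply: (sup_upper_bound hs); exists k.
rewrite /v; lra.
Qed.

End Calculus.

Section Picard.
Variable R : realType.

Lemma le_geometric (a b c : R) : (forall k, a <= b + c / 2 ^+ k) -> a <= b.
Proof.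
move=> H; rewrite leNgt; apply/negP => ba.
have d0 : 0 < a - b by rewrite subr_gt0.
have c0 : 0 <= c by have := H 0%N; rewrite expr0 divr1; lra.
have := archi_boundP (divr_ge0 c0 (ltW d0)).
set k := Num.bound _ => ck.
have k2 : k%:R <= 2 ^+ k :> R by rewrite -natrX ler_nat ltnW // ltn_expl.
have p2 : 0 < 2 ^+ k :> R by rewrite exprn_gt0.
have := H k; rewrite -lerBlDl ler_pdivlMr //.
have : c < k%:R * (a - b) by rewrite -ltr_pdivrMr.
have : k%:R * (a - b) <= 2 ^+ k * (a - b) by rewrite ler_wpM2r // ltW.
rewrite mulrC; lra.
Qed.

(** Integrating up to [clamp T t] instead of [t] keeps the Picard iterates defined and
    inside the box at all times. *)
Definition clamp (T t : R) : R := Num.max (- T) (Num.min t T).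

Lemma clamp_norm (T t : R) : 0 <= T -> `|clamp T t| <= T.
Proof.
move=> T0; rewrite ler_norml /clamp le_max lexx /= ge_max.
by rewrite ge_min lexx orbT andbT; lra.
Qed.

Lemma clamp_id (T t : R) : `|t| < T -> clamp T t = t.
Proof.
by rewrite ltr_norml => /andP[h1 h2]; rewrite /clamp min_l ?ltW // max_r // ltW.
Qed.

Lemma clamp_lip (T s t : R) : `|clamp T s - clamp T t| <= `|s - t|.
Proof.
wlog st : s t / s <= t => [H|].
  by have [/H//|/ltW/H] := leP s t; rewrite distrC [X in _ <= X]distrC.
have c1 : clamp T s <= clamp T t.
  rewrite /clamp ge_max le_max lexx /= le_max; apply/orP; right.
  by rewrite le_min !ge_min st lexx orbT.
rewrite distrC [X in _ <= X]distrC !ger0_norm ?subr_ge0 //.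
rewrite /clamp /Num.max /Num.min; repeat case: ifP => //; lra.
Qed.

Lemma lipschitz_continuous (f : R -> R) K :
  (forall s t, `|f s - f t| <= K * `|s - t|) -> continuous f.
Proof.
move=> H t; apply/cvgrPdist_lt => e e0.
have K0 : 0 < `|K| + 1 by rewrite ltr_pwDr.
near=> s; apply: le_lt_trans (H _ _) _.
apply: (@le_lt_trans _ _ ((`|K| + 1) * `|t - s|)).
  by rewrite ler_wpM2r // (le_trans (ler_norm _)) // lerDl.
rewrite mulrC -ltr_pdivlMr //; near: s.
by apply: (@cvgr_dist_lt _ _ _ _ _ id t) => //; rewrite divr_gt0.
Unshelve. all: by end_near.
Qed.

Variables (I : Type) (F : (I -> R) -> I -> R) (x0 : I -> R) (r M L T : R).
Hypotheses (r0 : 0 < r) (T0 : 0 < T) (L0 : 0 <= L).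
Hypotheses (MT : M * T <= r) (LT : L * T <= 2^-1).

Definition in_box (x : I -> R) := forall i, `|x i - x0 i| <= r.

Hypothesis F_bound : forall x, in_box x -> forall i, `|F x i| <= M.
Hypothesis F_lip : forall x y D, in_box x -> in_box y ->
  (forall j, `|x j - y j| <= D) -> forall i, `|F x i - F y i| <= L * D.

(* Curves with values in the box, with speed at most M. *)
Let good (X : R -> I -> R) :=
  (forall t, in_box (X t)) /\ (forall s t i, `|X s i - X t i| <= M * `|s - t|).

Let step (X Y : R -> I -> R) := forall i, exists G : R -> R,
  [/\ G 0 = 0, forall t : R, `|t| < 2 * T -> is_derive t 1 G (F (X t) i)
    & forall t, Y t i = x0 i + G (clamp T t)].

Lemma picard_step X : good X -> exists Y, good Y /\ step X Y.
Proof.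
move=> [bX lX].
have cF i : continuous (fun t => F (X t) i).
  apply: (@lipschitz_continuous _ (L * M)) => s t; rewrite -mulrA.
  by apply: F_lip => // j; exact: lX.
have T20 : 0 < 2 * T by rewrite mulr_gt0.
have : forall i, exists G : R -> R, G 0 = 0 /\
    forall t : R, `|t| < 2 * T -> is_derive t 1 G (F (X t) i).
  by move=> i; exact: antiderivative.
case/choice => G HG; exists (fun t i => x0 i + G i (clamp T t)).
have clT t : `|clamp T t| < 2 * T.
  by apply: le_lt_trans (clamp_norm _ (ltW T0)) _; rewrite ltr_pMl ?ltr1n.
have GM i s t : `|s| < 2 * T -> `|t| < 2 * T -> `|G i s - G i t| <= M * `|s - t|.
  wlog st : s t / s <= t => [H|] sT tT.
    have [/H|/ltW/H] := leP s t; first exact.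
    by rewrite distrC [X in M * X]distrC; apply.
  have uT u : s <= u <= t -> `|u| < 2 * T.
    case/andP=> su ut; move: sT tT; rewrite !ltr_norml => /andP[? ?] /andP[? ?].
    by apply/andP; split; lra.
  have [c ct] := mean_value st (fun u hu => (HG i).2 u (uT u hu)).
  rewrite distrC [X in M * X]distrC => ->; rewrite normrM ler_wpM2r //.
  exact: F_bound.
split; [split=> [t i|s t i]|move=> i; exists (G i)].
- rewrite addrC addKr -[G i _]subr0 -(HG i).1.
  apply: le_trans (GM i _ 0 (clT t) _) _; first by rewrite normr0.
  rewrite subr0; apply: le_trans MT; have := clamp_norm t (ltW T0).
  have M0 : 0 <= M by apply: le_trans (F_bound (bX 0) i).
  by move=> h; rewrite ler_wpM2l.
- rewrite opprD addrACA subrr add0r; apply: le_trans (GM i _ _ (clT s) (clT t)) _.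
  have M0 : 0 <= M by apply: le_trans (F_bound (bX 0) i).
  by rewrite ler_wpM2l // clamp_lip.
- by split=> //; [exact: (HG i).1|exact: (HG i).2].
Qed.

Lemma picard_contract X X' Y Y' D : good X -> good X' -> step X Y -> step X' Y' ->
  (forall t i, `|X t i - X' t i| <= D) ->
  forall t i, `|Y t i - Y' t i| <= D / 2.
Proof.
move=> gX gX' sX sX' H t i.
have [G [G0 dG ->]] := sX i; have [G' [G'0 dG' ->]] := sX' i.
rewrite opprD addrACA subrr add0r.
have D0 : 0 <= D by apply: le_trans (H 0 i).
have clT : `|clamp T t| < 2 * T.
  by apply: le_lt_trans (clamp_norm _ (ltW T0)) _; rewrite ltr_pMl ?ltr1n.
have := @derive_bound R (fun u => G u - G' u) (fun u => F (X u) i - F (X' u) i)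
   (L * D) (2 * T) _ _ _ _ clT.
rewrite /= => h; apply: (le_trans (h _ _ _)).
- by move=> u uT; apply: is_deriveB; [exact: dG|exact: dG'].
- by move=> u uT; apply: F_lip; [exact: gX.1|exact: gX'.1|exact: H].
- by rewrite G0 G'0 subrr.
have := clamp_norm t (ltW T0) => c1.
apply: (@le_trans _ _ (L * D * T)); first by rewrite ler_wpM2l // mulr_ge0.
by rewrite mulrAC mulrC ler_wpM2l.
Qed.

(** The Picard iterates converge geometrically; the limit is again a fixed point
    of the Picard operator because the step is Lipschitz. *)
Theorem picard : exists X : R -> I -> R, X 0 = x0 /\
  forall t : R, `|t| < T -> in_box (X t) /\
    forall i, is_derive t 1 (fun s => X s i) (F (X t) i).
Proof.
have [I0|/existsNP[i0 _]] := pselect (forall i : I, False).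
  exists (fun _ => x0); split=> // t _; split=> i; case: (I0 i).
have M0 : 0 <= M.
  have b0 : in_box x0 by move=> i; rewrite subrr normr0 ltW.
  exact: le_trans (F_bound b0 i0).
have g0 : good (fun _ => x0).
  by split=> [t i|s t i]; rewrite subrr normr0 ?mulr_ge0 // ltW.
pose S := {X | good X}.
have /choice [nx Hnx] : forall X : S, exists Y : S, step (sval X) (sval Y).
  move=> [X gX]; have [Y [gY sY]] := picard_step gX.
  by exists (exist _ Y gY).
pose X k := sval (iter k nx (exist _ _ g0)).
have gX k : good (X k) := svalP _.
have sX k : step (X k) (X k.+1) by exact: Hnx.
have dX k t i : `|X k.+1 t i - X k t i| <= r / 2 ^+ k.
  elim: k t i => [|k IH] t i; first by rewrite expr0 divr1; exact: (gX 1%N).1.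
  have -> : r / 2 ^+ k.+1 = r / 2 ^+ k / 2 by rewrite exprSr invfM mulrA.
  exact: (picard_contract (gX _) (gX _) (sX _) (sX _) IH).
have [Z HZ] : exists Z : R -> I -> R, forall t i k, `|X k t i - Z t i| <= 2 * r / 2 ^+ k.
  have /choice [Z HZ] : forall q : R * I, exists z, forall k,
      `|X k q.1 q.2 - z| <= 2 * r / 2 ^+ k.
    by move=> [t i]; apply: geometric_limit => k; exact: dX.
  by exists (fun t i => Z (t, i)) => t i k; exact: HZ (t, i) k.
have gZ : good Z.
  split=> [t i|s t i].
    apply: (@le_geometric _ _ (2 * r)) => k; have := (gX k).1 t i; have := HZ t i k.
    have -> : Z t i - x0 i = (X k t i - x0 i) - (X k t i - Z t i) by ring.
    by move=> h1 h2; apply: le_trans (ler_normB _ _) _; exact: lerD.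
  apply: (@le_geometric _ _ (4 * r)) => k; have := (gX k).2 s t i.
  have := HZ s i k; have := HZ t i k.
  have -> : Z s i - Z t i = (X k s i - X k t i) + (X k t i - Z t i) - (X k s i - Z s i) by ring.
  move=> h1 h2 h3; apply: le_trans (ler_normB _ _) _.
  apply: le_trans (lerD (ler_normD _ _) (lexx _)) _.
  have -> : 4 * r / 2 ^+ k = 2 * r / 2 ^+ k + 2 * r / 2 ^+ k by rewrite -!mulrA -mulrDl; ring.
  by rewrite addrA; do 2?apply: lerD.
have [Y [gY sY]] := picard_step gZ.
have YZ t i : Y t i = Z t i.
  apply/eqP; rewrite -subr_eq0 -normr_le0; apply: (@le_geometric _ _ (4 * r)) => k.
  have e0 : 0 <= 2 * r / 2 ^+ k.
    by apply: divr_ge0; [rewrite mulr_ge0 // ltW|exact: exprn_ge0].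
  have c := picard_contract gZ (gX k) sY (sX k) (D := 2 * r / 2 ^+ k).
  have h1 : `|Y t i - X k.+1 t i| <= 2 * r / 2 ^+ k.
    apply: (le_trans (c _ t i)) => [t' i'|]; first by rewrite distrC.
    by rewrite ler_pdivrMr // ler_peMr // ler1n.
  have h2 : `|X k.+1 t i - Z t i| <= 2 * r / 2 ^+ k.
    apply: (le_trans (HZ t i k.+1)).
    have -> : 2 * r / 2 ^+ k.+1 = 2 * r / 2 ^+ k / 2 by rewrite exprSr invfM mulrA.
    by rewrite ler_pdivrMr // ler_peMr // ler1n.
  have -> : Y t i - Z t i = (Y t i - X k.+1 t i) + (X k.+1 t i - Z t i) by ring.
  rewrite add0r; apply: le_trans (ler_normD _ _) _.
  have -> : 4 * r / 2 ^+ k = 2 * r / 2 ^+ k + 2 * r / 2 ^+ k by rewrite -!mulrA -mulrDl; ring.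
  exact: lerD.
exists Z; split.
  apply/funext => i; rewrite -YZ; have [G [G0 _ ->]] := sY i.
  by rewrite clamp_id ?normr0 // G0 addr0.
move=> t tT; split; first exact: gZ.1.
move=> i; have [G [G0 dG YE]] := sY i.
have tT2 : `|t| < 2 * T by apply: lt_trans tT _; rewrite ltr_pMl ?ltr1n.
have D := @is_deriveD R _ _ (cst (x0 i)) G t 1 0 _ (is_derive_cst _ _ _) (dG t tT2).
rewrite add0r in D; apply: near_eq_is_derive D.
have tI : t \in `](- T), T[ by rewrite in_itv /= -ltr_norml.
near=> s; rewrite -YZ YE clamp_id //.
have : s \in `](- T), T[ by near: s; exact: near_in_itvoo.
by rewrite in_itv /= -ltr_norml.
Unshelve. all: by end_near.
Qed.

End Picard.

(** * The frame flow *)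

Section LocallyLipschitz.
Variable R : realType.
Implicit Types (f h : (nat -> R) -> R) (x y : nat -> R).

(** Bounded and Lipschitz on every ball for the sup norm. *)
Definition loc_lip f := forall K : R, exists2 M : R, 0 <= M &
  (forall x, (forall i, `|x i| <= K) -> `|f x| <= M) /\
  (forall x y D, (forall i, `|x i| <= K) -> (forall i, `|y i| <= K) ->
     (forall j, `|x j - y j| <= D) -> `|f x - f y| <= M * D).

Lemma loc_lip_cst (c : R) : loc_lip (fun=> c).
Proof.
move=> K; exists `|c| => //; split=> // x y D _ _ xy.
by rewrite subrr normr0 mulr_ge0 // (le_trans _ (xy 0%N)).
Qed.

Lemma loc_lip_var i : loc_lip (fun x => x i).
Proof.
move=> K; exists (`|K| + 1); first by rewrite addr_ge0.
split=> [x xK|x y D _ _ xy].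
  by apply: le_trans (xK i) _; rewrite (le_trans (ler_norm K)) // lerDl.
apply: le_trans (xy i) _; have D0 : 0 <= D by rewrite (le_trans _ (xy 0%N)).
by rewrite ler_peMl // lerDr.
Qed.

Lemma loc_lip_add f h : loc_lip f -> loc_lip h -> loc_lip (fun x => f x + h x).
Proof.
move=> lf lh K; have [M M0 [fM fL]] := lf K; have [N N0 [hN hL]] := lh K.
exists (M + N); first exact: addr_ge0.
split=> [x xK|x y D xK yK xy].
  by apply: le_trans (ler_normD _ _) _; rewrite lerD ?fM ?hN.
by rewrite opprD addrACA mulrDl (le_trans (ler_normD _ _)) // lerD ?fL ?hL.
Qed.

Lemma loc_lip_mul f h : loc_lip f -> loc_lip h -> loc_lip (fun x => f x * h x).
Proof.
move=> lf lh K; have [M M0 [fM fL]] := lf K; have [N N0 [hN hL]] := lh K.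
exists (M * N + M * N + M * N); first by rewrite !addr_ge0 ?mulr_ge0.
split=> [x xK|x y D xK yK xy].
  rewrite normrM; apply: (@le_trans _ _ (M * N)); first by rewrite ler_pM ?fM ?hN.
  by rewrite -addrA lerDl addr_ge0 ?mulr_ge0.
have -> : f x * h x - f y * h y = f x * (h x - h y) + (f x - f y) * h y by ring.
have D0 : 0 <= D by rewrite (le_trans _ (xy 0%N)).
apply: le_trans (ler_normD _ _) _; rewrite !normrM !mulrDl.
have h1 : `|f x| * `|h x - h y| <= M * N * D.
  by rewrite -mulrA ler_pM ?fM ?hL.
have h2 : `|f x - f y| * `|h y| <= M * N * D.
  by rewrite mulrAC ler_pM ?fL ?hN.
by rewrite -addrA lerD // (le_trans h2) // lerDl !mulr_ge0.
Qed.

Lemma loc_lip_opp f : loc_lip f -> loc_lip (fun x => - f x).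
Proof.
move=> lf K; have [M M0 [fM fL]] := lf K; exists M => //.
split=> [x xK|x y D xK yK xy]; first by rewrite normrN fM.
by rewrite -opprD normrN fL.
Qed.

Lemma loc_lip_sub f h : loc_lip f -> loc_lip h -> loc_lip (fun x => f x - h x).
Proof. by move=> lf lh; apply: loc_lip_add => //; exact: loc_lip_opp. Qed.

Lemma loc_lip_exp f n : loc_lip f -> loc_lip (fun x => f x ^+ n).
Proof.
move=> lf; elim: n => [|n IH]; first exact: loc_lip_cst.
have -> : (fun x => f x ^+ n.+1) = (fun x => f x * f x ^+ n).
  by apply/funext => x; rewrite exprS.
exact: loc_lip_mul.
Qed.

Lemma loc_lip_sum3 (F : (nat -> R) -> nat -> R) :
  (forall j, loc_lip (fun x => F x j)) -> loc_lip (fun x => sum3 (F x)).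
Proof. by move=> lF; do 2!apply: loc_lip_add => //. Qed.

Lemma loc_lip_sum (I : Type) (s : seq I) (F : I -> (nat -> R) -> R) :
  (forall j, loc_lip (F j)) -> loc_lip (fun x => \sum_(j <- s) F j x).
Proof.
move=> lF; elim: s => [|i s IH].
  have -> : (fun x => \sum_(j <- [::]) F j x) = fun=> 0.
    by apply/funext => x; rewrite big_nil.
  exact: loc_lip_cst.
have -> : (fun x => \sum_(j <- i :: s) F j x) = (fun x => F i x + \sum_(j <- s) F j x).
  by apply/funext => x; rewrite big_cons.
exact: loc_lip_add.
Qed.

Lemma loc_lip_sym o j k : loc_lip (fun x => sym_entry o x j k).
Proof.
by case: j => [|[|j]]; case: k => [|[|k]]; exact: loc_lip_var.
Qed.

Lemma loc_lip_skew j k : loc_lip (fun x => skew_entry x j k).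
Proof.
by case: j => [|[|[|j]]]; case: k => [|[|[|k]]] /=;
  first [exact: loc_lip_cst|exact: loc_lip_var|apply: loc_lip_opp; exact: loc_lip_var].
Qed.

End LocallyLipschitz.

Ltac loc_lip_tac := repeat
  match goal with
  | |- loc_lip (fun x => sym_entry _ x _ _) => apply: loc_lip_sym
  | |- loc_lip (fun x => skew_entry x _ _) => apply: loc_lip_skew
  | |- loc_lip (fun x => sum3 _) => apply: loc_lip_sum3 => ?
  | |- loc_lip (fun x => _ + _) => apply: loc_lip_add
  | |- loc_lip (fun x => _ * _) => apply: loc_lip_mul
  | |- loc_lip (fun x => - _) => apply: loc_lip_opp
  | |- loc_lip (fun x => _ ^+ _) => apply: loc_lip_exp
  | |- loc_lip (fun x => x _) => apply: loc_lip_var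
  | |- loc_lip (fun x => _%:R) => apply: loc_lip_cst
  | |- loc_lip (fun x => 0) => apply: loc_lip_cst
  end.

Section FrameField.
Variable R : realType.
Implicit Types x : nat -> R.

Lemma loc_lip_Y1 j k : loc_lip (fun x => Y1 x j k).
Proof. rewrite /Y1 /W1 /T1 /cofactor1 /U1 /U2 /S1 /S2; loc_lip_tac. Qed.

Lemma loc_lip_Y2 j k : loc_lip (fun x => Y2 x j k).
Proof. rewrite /Y2 /W2 /T2 /cofactor2 /U1 /U2 /S1 /S2; loc_lip_tac. Qed.

Lemma loc_lip_qq : loc_lip (fun x => qq x).
Proof.
rewrite /qq /tau /normS /U2 /S1 /S2; loc_lip_tac.
Qed.

Ltac loc_lip_field := repeat
  match goal with
  | |- loc_lip (fun x => Y1 x _ _) => apply: loc_lip_Y1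
  | |- loc_lip (fun x => Y2 x _ _) => apply: loc_lip_Y2
  | |- loc_lip (@qq _) => exact: loc_lip_qq
  | |- _ => progress loc_lip_tac
  end.

Lemma loc_lip_dU1 j k : loc_lip (fun x => dU1 x j k).
Proof.
rewrite /dU1 /U1 /S1 /S2; loc_lip_field.
Qed.

Lemma loc_lip_dU2 j k : loc_lip (fun x => dU2 x j k).
Proof.
rewrite /dU2 /U2 /S1 /S2; loc_lip_field.
Qed.

Lemma loc_lip_dS1 j k : loc_lip (fun x => dS1 x j k).
Proof.
rewrite /dS1 /U1 /U2 /S1; loc_lip_field.
Qed.

Lemma loc_lip_dS2 j k : loc_lip (fun x => dS2 x j k).
Proof.
rewrite /dS2 /U1 /U2 /S2; loc_lip_field.
Qed.

Lemma loc_lip_Y_mat a c : loc_lip (fun x => Y_mat x a c).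
Proof.
rewrite /Y_mat /real_mat; case: (odd a); case: (odd c).
- by apply: loc_lip_sub; [exact: loc_lip_cst|exact: loc_lip_Y1].
- by apply: loc_lip_add; [exact: loc_lip_cst|exact: loc_lip_Y2].
- by apply: loc_lip_sub; [exact: loc_lip_Y2|exact: loc_lip_cst].
- by apply: loc_lip_add; [exact: loc_lip_cst|exact: loc_lip_Y1].
Qed.

(** The state of the flow: the 21 coordinates of the bracket [A], followed by
    the coframe transformation, block diagonal with blocks of size 1 and 6. *)
Definition frame_mat x (a c : nat) : R :=
  match a, c with
  | 0, 0 => x 21%N | a'.+1, c'.+1 => x (22 + (6 * a' + c'))%N | _, _ => 0
  end.

Definition frame_field x : seq R :=
  sp_field x ++ (qq x * x 21%N) ::
  [seq - \sum_(k <- iota 0 6) Y_mat x (i %/ 6) k * x (22 + (6 * k + i %% 6))%N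
  | i <- iota 0 36].

Lemma size_frame_field x : size (frame_field x) = 58.
Proof. by []. Qed.

Lemma frame_field_sp x i : (i < 21)%N ->
  nth 0 (frame_field x) i = nth 0 (sp_field x) i.
Proof. by move=> i21; rewrite nth_cat /= i21. Qed.

Lemma frame_field_mat x a c : (a < 7)%N -> (c < 7)%N ->
  frame_mat (nth 0 (frame_field x)) a c =
  \sum_(k <- iota 0 7) Q_mat x a k * frame_mat x k c.
Proof.
have sm a' c' : (a' < 6)%N -> (c' < 6)%N -> nth 0 (frame_field x) (22 + (6 * a' + c')) =
  - \sum_(k <- iota 0 6) Y_mat x a' k * x (22 + (6 * k + c'))%N.
  move=> a6 c6; rewrite nth_cat; have -> : size (sp_field x) = 21%N by [].
  have -> : (22 + (6 * a' + c') < 21)%N = false by lia.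
  have -> : (22 + (6 * a' + c') - 21 = (6 * a' + c').+1)%N by lia.
  rewrite -[nth 0 (_ :: _) _.+1]/(nth 0 [seq _ | i <- iota 0 36] (6 * a' + c')).
  rewrite (nth_map 0%N) ?size_iota; last by lia.
  rewrite nth_iota; last by lia.
  rewrite add0n mulnC divnMDl // divn_small // addn0 modnMDl modn_small //.
case: a => [|a]; case: c => [|c] a7 c7.
- by rewrite unlock /= !mul0r !addr0.
- by rewrite unlock /= mulr0 !mul0r !addr0.
- by rewrite unlock /= mul0r !mulr0 !addr0.
rewrite -[frame_mat _ _ _]/(nth 0 (frame_field x) (22 + (6 * a + c))) sm //.
by rewrite unlock /=; ring.
Qed.

Lemma loc_lip_frame_field i : loc_lip (fun x => nth 0 (frame_field x) i).
Proof.
have [i21|i21] := ltnP i 21.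
  have -> : (fun x => nth 0 (frame_field x) i) = fun x => nth 0 (sp_field x) i.
    by apply/funext => x; rewrite frame_field_sp.
  do 21!(case: i i21 => [_|i i21];
    [by first [exact: loc_lip_dU1|exact: loc_lip_dU2|exact: loc_lip_dS1|exact: loc_lip_dS2]|]).
  by [].
have [j ->] : exists j, i = (21 + j)%N by exists (i - 21)%N; lia.
have -> : (fun x => nth 0 (frame_field x) (21 + j)) = fun x => nth 0 ((qq x * x 21%N) ::
  [seq - \sum_(k <- iota 0 6) Y_mat x (i %/ 6) k * x (22 + (6 * k + i %% 6))%N
  | i <- iota 0 36]) j.
  apply/funext => x; rewrite nth_cat (_ : size (sp_field x) = 21%N) //.
  by rewrite ltnNge leq_addr /= addKn.
case: j => [|j] /=; first by apply: loc_lip_mul; [exact: loc_lip_qq|exact: loc_lip_var].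
have [j36|j36] := ltnP j 36; last first.
  have -> : (fun x => nth 0 [seq - \sum_(k <- iota 0 6) Y_mat x (i %/ 6) k *
    x (22 + (6 * k + i %% 6))%N | i <- iota 0 36] j) = fun=> 0.
    by apply/funext => x; rewrite nth_default // size_map size_iota.
  exact: loc_lip_cst.
have -> : (fun x => nth 0 [seq - \sum_(k <- iota 0 6) Y_mat x (i %/ 6) k *
    x (22 + (6 * k + i %% 6))%N | i <- iota 0 36] j) =
  fun x => - \sum_(k <- iota 0 6) Y_mat x (j %/ 6) k * x (22 + (6 * k + j %% 6))%N.
  by apply/funext => x; rewrite (nth_map 0%N) ?size_iota // nth_iota.
apply: loc_lip_opp.
apply: (loc_lip_sum _ (F := fun k x => Y_mat x (j %/ 6) k * x (22 + (6 * k + j %% 6))%N)) => k.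
by apply: loc_lip_mul; [exact: loc_lip_Y_mat|exact: loc_lip_var].
Qed.

Lemma frame_field_uniform (K : R) : exists2 M : R, 0 <= M & forall i,
  (forall x, (forall i, `|x i| <= K) -> `|nth 0 (frame_field x) i| <= M) /\
  (forall x y D, (forall i, `|x i| <= K) -> (forall i, `|y i| <= K) ->
     (forall j, `|x j - y j| <= D) ->
     `|nth 0 (frame_field x) i - nth 0 (frame_field y) i| <= M * D).
Proof.
suff [M M0 HM] : exists2 M : R, 0 <= M & forall i, (i < 58)%N ->
  (forall x, (forall i, `|x i| <= K) -> `|nth 0 (frame_field x) i| <= M) /\
  (forall x y D, (forall i, `|x i| <= K) -> (forall i, `|y i| <= K) ->
     (forall j, `|x j - y j| <= D) ->
     `|nth 0 (frame_field x) i - nth 0 (frame_field y) i| <= M * D).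
  exists M => // i; have [/HM//|i58] := ltnP i 58.
  have nz x : nth 0 (frame_field x) i = 0 by rewrite nth_default // size_frame_field.
  split=> [x _|x y D _ _ xy]; rewrite !nz ?subrr normr0 // mulr_ge0 //.
  exact: le_trans (xy 0%N).
elim: 58%N => [|n [M M0 IH]]; first by exists 0.
have [N N0 [NM NL]] := loc_lip_frame_field n K.
exists (M + N) => [|i]; first exact: addr_ge0.
rewrite ltnS leq_eqVlt => /predU1P[->|/IH[h1 h2]]; split=> [x xK|x y D xK yK xy].
- by apply: le_trans (NM _ xK) _; rewrite lerDr.
- apply: le_trans (NL _ _ _ xK yK xy) _; rewrite ler_wpM2r ?lerDr //.
  exact: le_trans (xy 0%N).
- by apply: le_trans (h1 _ xK) _; rewrite lerDl.
- apply: le_trans (h2 _ _ _ xK yK xy) _; rewrite ler_wpM2r ?lerDl //.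
  exact: le_trans (xy 0%N).
Qed.

(** The time of existence depends only on the bound [K] for the initial values; this
    uniformity is what allows the continuation of solutions. *)
Lemma frame_ode (K : R) : 0 <= K -> exists2 T : R, 0 < T &
  forall x0 : nat -> R, (forall i, `|x0 i| <= K) ->
  exists X : R -> nat -> R, X 0 = x0 /\ forall t : R, `|t| < T ->
    (forall i, `|X t i| <= K + 1) /\
    forall i, is_derive t 1 (fun s => X s i) (nth 0 (frame_field (X t)) i).
Proof.
move=> K0; have [M M0 HM] := frame_field_uniform (K + 1).
have M1 : 0 < 2 * (M + 1) by rewrite mulr_gt0 // ltr_wpDl.
exists (2 * (M + 1))^-1; first by rewrite invr_gt0.
move=> x0 x0K.
have box x : in_box x0 1 x -> forall i, `|x i| <= K + 1.
  move=> bx i; have -> : x i = x0 i + (x i - x0 i) by ring.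
  by apply: le_trans (ler_normD _ _) _; rewrite lerD.
have MT : M * (2 * (M + 1))^-1 <= 2^-1.
  by rewrite ler_pdivrMr // mulrA mulVf ?pnatr_eq0 // mul1r lerDl.
have [X [X0 HX]] : exists X : R -> nat -> R, X 0 = x0 /\ forall t : R,
    `|t| < (2 * (M + 1))^-1 -> in_box x0 1 (X t) /\
    forall i, is_derive t 1 (fun s => X s i) (nth 0 (frame_field (X t)) i).
  apply: (@picard R nat (fun x i => nth 0 (frame_field x) i) x0 1 M M
    (2 * (M + 1))^-1) => //.
  - by rewrite invr_gt0.
  - by apply: le_trans MT _; rewrite invf_le1 // ler1n.
  - by move=> x bx i; apply: (HM i).1; exact: box.
  - by move=> x y D bx b'y xy i; apply: (HM i).2 => //; exact: box.
exists X; split=> // t tT; split=> [|i]; last exact: (HX t tT).2.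
by apply: box; exact: (HX t tT).1.
Qed.

Lemma Q_mat_bound (K : R) : exists2 M : R, 0 <= M &
  forall x, (forall i, `|x i| <= K) -> forall i j : 'I_7, `|Q_mat x i j| <= M.
Proof.
have lQ a c : loc_lip (fun x => Q_mat x a c).
  case: a => [|a]; case: c => [|c] /=; first exact: loc_lip_qq.
  - exact: loc_lip_cst.
  - exact: loc_lip_cst.
  - by apply: loc_lip_opp; exact: loc_lip_Y_mat.
have /choice [M HM] : forall q : 'I_7 * 'I_7, exists M : R, 0 <= M /\
    forall x, (forall i, `|x i| <= K) -> `|Q_mat x q.1 q.2| <= M.
  by move=> [i j]; have [M M0 [HM _]] := lQ i j K; exists M.
exists (\sum_q M q); first by apply: sumr_ge0 => q _; exact: (HM q).1.
move=> x xK i j; apply: le_trans ((HM (i, j)).2 x xK) _.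
by rewrite (bigD1 (i, j)) //= lerDl sumr_ge0 // => q _; exact: (HM q).1.
Qed.

End FrameField.

(** * Linear equations and the Leibniz rule *)

Section LinearODE.
Variable R : realType.

(** Gronwall's inequality for the sum of the squares of the components. *)
Lemma linear_ode_zero n (w : R -> 'I_n -> R) (Q : R -> 'I_n -> 'I_n -> R) (M T : R) :
  (forall t : R, `|t| < T -> forall i,
     is_derive t 1 (fun s => w s i) (\sum_k Q t i k * w t k)) ->
  (forall t : R, `|t| < T -> forall i k, `|Q t i k| <= M) ->
  forall s t : R, `|s| < T -> `|t| < T -> (forall i, w s i = 0) -> forall i, w t i = 0.
Proof.
move=> dw QM s t sT tT ws0.
pose f u := \sum_i w u i * w u i.
pose df u := \sum_i ((\sum_k Q u i k * w u k) * w u i + w u i * (\sum_k Q u i k * w u k)).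
have inT u : Num.min s t <= u <= Num.max s t -> `|u| < T.
  rewrite ge_min le_max => /andP[/orP h1 /orP h2].
  by move: sT tT; rewrite !ltr_norml => /andP[? ?] /andP[? ?];
    apply/andP; split; case: h1; case: h2; lra.
have f0 : f t = 0.
  apply: (@gronwall R f df (2 * n%:R * M) s t).
  - move=> u /inT uT; apply: is_derive_sum_seq => i.
    by apply: is_derive_mul; exact: dw.
  - move=> u /inT uT.
    apply: (@le_trans _ _ (\sum_(i < n) \sum_(k < n) M * (w u i * w u i + w u k * w u k))).
      apply: le_trans (ler_norm_sum _ _ _) _; apply: ler_sum => i _.
      have -> : (\sum_k Q u i k * w u k) * w u i + w u i * (\sum_k Q u i k * w u k) =
        \sum_k 2 * (w u i * w u k) * Q u i k.
        have -> : \sum_k 2 * (w u i * w u k) * Q u i k = 2 * w u i * \sum_k Q u i k * w u k.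
          by rewrite mulr_sumr; apply: eq_bigr => k _; ring.
        by ring.
      apply: le_trans (ler_norm_sum _ _ _) _; apply: ler_sum => k _.
      rewrite normrM [M * _]mulrC; apply: ler_pM => //; last exact: QM.
      rewrite ler_norml; have h1 := sqr_ge0 (w u i + w u k).
      have h2 := sqr_ge0 (w u i - w u k).
      by apply/andP; split; nra.
    under eq_bigr => i _ do rewrite -mulr_sumr big_split /= sumr_const card_ord.
    rewrite -mulr_sumr big_split /= sumr_const card_ord sumrMnl -/(f u).
    by rewrite -[f u *+ n]mulr_natl le_eqVlt; apply/orP; left; apply/eqP; ring.
  - by rewrite /f big1 // => i _; rewrite ws0 mul0r.
  - by apply: sumr_ge0 => i _; rewrite -expr2 sqr_ge0.
move=> i; apply/eqP; rewrite -sqrf_eq0; apply/eqP/le_anti.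
rewrite sqr_ge0 andbT -f0 /f (bigD1 i) //= expr2 lerDl.
by apply: sumr_ge0 => j _; rewrite -expr2 sqr_ge0.
Qed.

Lemma is_derive_prod n (u : 'I_n -> R -> R) (t : R) (d : 'I_n -> R) :
  (forall r, is_derive t 1 (u r) (d r)) ->
  is_derive t 1 (fun s => \prod_r u r s)
    (\sum_r \prod_q (if q == r then d q else u q t)).
Proof.
elim: n u d => [|n IH] u d H.
  have -> : (fun s => \prod_(r < 0) u r s) = cst 1.
    by apply/funext => s; rewrite big_ord0.
  by rewrite big_ord0; exact: is_derive_cst.
have -> : (fun s => \prod_r u r s) =
   (fun s => u ord0 s * \prod_(r < n) u (lift ord0 r) s).
  by apply/funext => s; rewrite big_ord_recl.
rewrite big_ord_recl big_ord_recl eqxx.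
have -> : \prod_(i < n) (if lift ord0 i == ord0 then d (lift ord0 i) else u (lift ord0 i) t) =
   \prod_(i < n) u (lift ord0 i) t.
  by apply: eq_bigr => i _.
have -> : \sum_(i < n) \prod_q (if q == lift ord0 i then d q else u q t) =
  u ord0 t * \sum_(i < n) \prod_(q < n) (if q == i then d (lift ord0 q) else u (lift ord0 q) t).
  rewrite mulr_sumr; apply: eq_bigr => i _.
  rewrite big_ord_recl (negPf (neq_lift _ _)); congr (_ * _).
by apply: is_derive_mul => //; exact: IH.
Qed.

Variable g : vectType R.

(** Leibniz rule for a multilinear map along differentiable curves. *)
Lemma is_derive_multilinear k (a : form g k) N (e : 'I_N -> g)
    (c : R -> 'I_k -> 'I_N -> R) (d : 'I_k -> 'I_N -> R) (t : R) :
  multilinear a ->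
  (forall r i, is_derive t 1 (fun s => c s r i) (d r i)) ->
  is_derive t 1 (fun s => a (fun r => \sum_i c s r i *: e i))
    (\sum_r a (upd (fun r => \sum_i c t r i *: e i) r (\sum_i d r i *: e i))).
Proof.
move=> la H.
have -> : (fun s => a (fun r => \sum_i c s r i *: e i)) = (fun s =>
    \sum_(I : {ffun 'I_k -> 'I_N}) (\prod_r c s r (I r)) * a (fun r => e (I r))).
  by apply/funext => s; rewrite (multilinear_expand (c s) e la).
have -> : \sum_r a (upd (fun r => \sum_i c t r i *: e i) r (\sum_i d r i *: e i)) =
  \sum_(I : {ffun 'I_k -> 'I_N})
   ((\sum_r \prod_q (if q == r then d q (I q) else c t q (I q))) * a (fun r => e (I r)) +
    (\prod_r c t r (I r)) * 0).
  transitivity (\sum_r \sum_(I : {ffun 'I_k -> 'I_N})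
     (\prod_q (if q == r then d q (I q) else c t q (I q))) * a (fun r => e (I r))).
    apply: eq_bigr => r _.
    rewrite -(multilinear_expand (fun q i => if q == r then d q i else c t q i) e la).
    congr a; apply/funext => q; rewrite /upd; case: (eqVneq q r) => [->|] //.
  rewrite exchange_big /=; apply: eq_bigr => I _.
  by rewrite mulr0 addr0 mulr_suml.
apply: is_derive_sum_seq => I.
have h := is_derive_cst (a (fun r => e (I r))) t (1 : R).
apply: (is_derive_mul _ h).
exact: (@is_derive_prod _ (fun r s => c s r (I r)) t (fun r => d r (I r))).
Qed.

End LinearODE.

(** * Pulling back a G2-structure *)

Section Pullback.
Variables (R : realType) (g : vectType R).

Lemma linear_zero (f : g -> g) : linear f -> f 0 = 0.
Proof.
by move=> lf; have := lf (-1) 0 0; rewrite scaler0 addr0 scaleN1r addNr.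
Qed.

Lemma linear_comb (f : g -> g) (I : Type) (r : seq I) (c : I -> R) (y : I -> g) :
  linear f -> f (\sum_(i <- r) c i *: y i) = \sum_(i <- r) c i *: f (y i).
Proof.
move=> lf; elim: r => [|i r IH]; last by rewrite !big_cons lf IH.
by rewrite !big_nil linear_zero.
Qed.

Variable b : 7.-tuple g.
Hypothesis bb : basis_of {:g} b.

(** The endomorphism with matrix [M] in the basis [b]. *)
Definition emx (M : 'M[R]_7) : g -> g :=
  fun x => \sum_(i < 7) (\sum_(j < 7) M i j * coord b j x) *: b`_i.

Lemma emx_linear M : linear (emx M).
Proof.
move=> c x y; rewrite /emx scaler_sumr -big_split /=; apply: eq_bigr => i _.
rewrite scalerA -scalerDl mulr_sumr -big_split /=; congr (_ *: _).
by apply: eq_bigr => j _; rewrite linearP /=; ring.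
Qed.

Lemma coord_emx M i x : coord b i (emx M x) = \sum_j M i j * coord b j x.
Proof. by rewrite /emx coord_sum_free ?(basis_free bb). Qed.

Lemma coord_ext x y : (forall i : 'I_7, coord b i x = coord b i y) -> x = y.
Proof.
move=> H; rewrite (coord_basis bb (memvf x)) (coord_basis bb (memvf y)).
by apply: eq_bigr => i _; rewrite H.
Qed.

Lemma emxM M N x : emx M (emx N x) = emx (M *m N) x.
Proof.
apply: coord_ext => i; rewrite !coord_emx.
under eq_bigr => j _ do rewrite coord_emx mulr_sumr.
rewrite exchange_big /=; apply: eq_bigr => k _.
by rewrite mxE mulr_suml; apply: eq_bigr => j _; rewrite mulrA.
Qed.

Lemma emx1 x : emx 1%:M x = x.
Proof.
apply: coord_ext => i; rewrite coord_emx (bigD1 i) //= big1 ?addr0 => [|j ji].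
  by rewrite mxE eqxx mul1r.
by rewrite mxE eq_sym (negPf ji) mul0r.
Qed.

Lemma emx_basis M (j : 'I_7) : emx M b`_j = \sum_(i < 7) M i j *: b`_i.
Proof.
rewrite /emx; apply: eq_bigr => i _; congr (_ *: _).
rewrite (bigD1 j) //= big1 ?addr0 => [|k kj].
  by rewrite coord_free ?(basis_free bb) // eqxx mulr1.
by rewrite coord_free ?(basis_free bb) // ?(eq_sym j) (negPf kj) mulr0.
Qed.

Definition mx_of (Q : nat -> nat -> R) : 'M[R]_7 := \matrix_(i, j) Q i j.

Lemma mat_endE Q x : mat_end b Q x = emx (mx_of Q) x.
Proof.
have E (i : 'I_7) : \sum_(z <- iota 0 7) Q z i *: b`_z = emx (mx_of Q) b`_i.
  have -> : iota 0 7 = index_iota 0 7 by [].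
  by rewrite emx_basis big_mkord; apply: eq_bigr => j _; rewrite mxE.
rewrite [in RHS](coord_basis bb (memvf x)) (linear_comb _ _ _ (emx_linear _)).
by apply: eq_bigr => i _; rewrite -E.
Qed.

Variables (p : g2_structure g) (M N : 'M[R]_7).
Hypotheses (fr : frame p b) (MN : M *m N = 1%:M) (NM : N *m M = 1%:M).

Definition pull_basis : 7.-tuple g := [tuple of map (emx N) b].

Lemma pull_basisE i : (i < 7)%N -> pull_basis`_i = emx N b`_i.
Proof. by move=> i7; rewrite (nth_map 0) // size_tuple. Qed.

Lemma emxK x : emx N (emx M x) = x. Proof. by rewrite emxM NM emx1. Qed.
Lemma emxVK x : emx M (emx N x) = x. Proof. by rewrite emxM MN emx1. Qed.

Lemma pull_expand x : x = \sum_(i < 7) coord b i (emx M x) *: pull_basis`_i.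
Proof.
rewrite -[LHS]emxK {1}[emx M x](coord_basis bb (memvf _)).
rewrite (linear_comb _ _ _ (emx_linear _)).
by apply: eq_bigr => i _; rewrite pull_basisE.
Qed.

Lemma pull_basisP : basis_of {:g} pull_basis.
Proof.
rewrite basisEdim; apply/andP; split; last first.
  by rewrite size_tuple -{1}(size_basis bb).
apply/subvP => x _; rewrite [x]pull_expand.
apply: memv_suml => i _; apply: memvZ; apply: memv_span.
by apply: mem_nth; rewrite size_tuple.
Qed.

Lemma coord_pull i x : coord pull_basis i x = coord b i (emx M x).
Proof.
rewrite {1}[x]pull_expand (coord_sum_free (fun i => coord b i (emx M x)) i) //.
exact: basis_free pull_basisP.
Qed.

Lemma pull_exists : exists q : g2_structure g,
  [/\ forall v, g2_form q v = g2_form p (fun r => emx M (v r)),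
      forall x y, g2_metric q x y = g2_metric p (emx M x) (emx M y)
    & forall v, g2_vol q v = g2_vol p (fun r => emx M (v r))].
Proof.
have fP : is_g2_form (fun v => g2_form p (fun r => emx M (v r))).
  exists pull_basis; first exact: pull_basisP.
  move=> v; rewrite fr.2 !standard_g2E; congr g2_poly.
  by apply/funext => i; apply/funext => r; rewrite coord_pull.
have iP : g2_induces (fun v => g2_form p (fun r => emx M (v r)))
    (fun x y => g2_metric p (emx M x) (emx M y))
    (fun v => g2_vol p (fun r => emx M (v r))).
  have [[lm mC mp] vN vE] := g2_inducesP p; split.
  - split=> [x c y z|x y|x x0]; [by rewrite emx_linear lm|exact: mC|].
    apply: mp; apply: contra_neq x0 => x0; rewrite -[x]emxK x0.
    exact: linear_zero (emx_linear N).
  - by move=> e on; apply: vN => i j; exact: on.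
  - move=> x y v; rewrite vE /wedge /contract.
    congr (_ * _); apply: eq_bigr => s _; congr (_ * _ * _).
    congr (_ * _); apply: eq_bigr => u _.
    by congr (_ * g2_form p _ * g2_form p _); apply/funext => r; rewrite /catv;
      case: fintype.split.
by exists (G2Structure fP iP).
Qed.

Lemma pull_psi q : (forall v, g2_form q v = g2_form p (fun r => emx M (v r))) ->
  frame q pull_basis /\ forall v, psi q v = psi p (fun r => emx M (v r)).
Proof.
move=> qE; have [q' [fE mE vE]] := pull_exists.
have qq' : g2_form q =1 g2_form q' by move=> v; rewrite qE fE.
have [mq vq] := g2_form_inj qq'.
have frq : frame q pull_basis.
  split; first exact: pull_basisP.
  move=> v; rewrite qE fr.2 !standard_g2E; congr g2_poly.
  by apply/funext => i; apply/funext => r; rewrite coord_pull.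
split=> // v; rewrite /psi.
rewrite (hodge_on (g2_ip q) frq.1 (frame_on frq)); last 2 first.
- exact: (g2_form_alt q).1.
- exact: (g2_vol_alt q).1.
rewrite (hodge_on (g2_ip p) bb (frame_on fr)); last 2 first.
- exact: (g2_form_alt p).1.
- exact: (g2_vol_alt p).1.
congr (_ * _); apply: eq_bigr => I _; rewrite qE vq vE.
congr (g2_form p _ * g2_vol p _); apply/funext => r.
  by rewrite pull_basisE // emxVK.
rewrite /catv; case: fintype.split => // a.
by rewrite pull_basisE // emxVK.
Qed.

End Pullback.

Section TransportedBracket.
Variables (R : realType) (g : vectType R) (br : g -> g -> g).
Hypothesis br_lin : [/\ forall x, linear (br x), forall y, linear (br^~ y)
  & forall x, br x x = 0].
Variables (b : 7.-tuple g) (M N : 'M[R]_7) (A0 A : nat -> nat -> R).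
Hypotheses (bb : basis_of {:g} b) (MN : M *m N = 1%:M) (NM : N *m M = 1%:M).
Hypotheses (M0j : forall j : 'I_7, j != ord0 -> M ord0 j = 0)
  (Mi0 : forall i : 'I_7, i != ord0 -> M i ord0 = 0).
Hypotheses (A0j : forall j, A0 0%N j = 0) (A00 : forall j, A 0%N j = 0).
Hypothesis MA : M *m mx_of A0 = M ord0 ord0 *: (mx_of A *m M).
Hypothesis frA0 : abelian_frame br b A0.

Lemma sum_head (V : nmodType) (F : nat -> V) :
  \sum_(i < 7) F i = F 0%N + \sum_(z <- iota 1 6) F z.
Proof.
rewrite -(big_mkord xpredT F) -[index_iota 0 7]/(0%N :: iota 1 6).
by rewrite big_cons.
Qed.

Let f := M ord0 ord0.

Lemma block_N0 (j : 'I_7) : f * N ord0 j = (ord0 == j)%:R.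
Proof.
have := congr1 (fun X : 'M[R]_7 => X ord0 j) MN; rewrite !mxE => <-.
by rewrite (bigD1 ord0) //= big1 ?addr0 // => k k0; rewrite M0j // mul0r.
Qed.

Lemma block_0N (i : 'I_7) : N i ord0 * f = (i == ord0)%:R.
Proof.
have := congr1 (fun X : 'M[R]_7 => X i ord0) NM; rewrite !mxE => <-.
by rewrite (bigD1 ord0) //= big1 ?addr0 // => k k0; rewrite Mi0 // mulr0.
Qed.

Lemma f_neq0 : f != 0.
Proof.
apply/eqP => f0; have := block_N0 ord0; rewrite f0 mul0r eqxx => /eqP.
by rewrite eq_sym oner_eq0.
Qed.

Lemma ideal_expand z : coord b ord0 z = 0 ->
  z = \sum_(j <- iota 1 6) coord b (inord j) z *: b`_j.
Proof.
move=> z0; have zE := coord_basis bb (memvf z).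
rewrite (eq_bigr (fun j : 'I_7 => coord b (inord j) z *: b`_j)) in zE; last first.
  by move=> j _; rewrite inord_val.
rewrite {1}zE (sum_head (fun j => coord b (inord j) z *: b`_j)).
have -> : inord 0 = ord0 :> 'I_7 by apply/val_inj; rewrite /= inordK.
by rewrite z0 scale0r add0r.
Qed.

Lemma br_ideal y z : coord b ord0 y = 0 -> coord b ord0 z = 0 -> br y z = 0.
Proof.
case: br_lin => lr ll _ y0 z0.
rewrite (ideal_expand y0) (ideal_expand z0) (linear_comb _ _ _ (lr _)).
rewrite big_seq big1 // => j j6.
rewrite (linear_comb _ _ _ (ll _)) big_seq big1 ?scaler0 // => i i6.
by rewrite /= frA0.1 // scaler0.
Qed.

Lemma br_transverse z : coord b ord0 z = 0 -> br b`_0 z = emx b (mx_of A0) z.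
Proof.
case: br_lin => lr ll _ z0.
rewrite {1}(ideal_expand z0) (linear_comb _ _ _ (lr _)).
rewrite [in RHS](ideal_expand z0) (linear_comb _ _ _ (emx_linear _ _)).
rewrite big_seq [RHS]big_seq; apply: eq_bigr => j j6; congr (_ *: _).
have j7 : (j < 7)%N by move: j6; rewrite mem_iota => /andP[].
rewrite frA0.2 // -[b`_j]/(b`_(Ordinal j7)) emx_basis //.
rewrite (eq_bigr (fun i : 'I_7 => A0 i j *: b`_i)) => [|i _]; last by rewrite mxE.
by rewrite (sum_head (fun i => A0 i j *: b`_i)) A0j scale0r add0r.
Qed.

(** The new transverse vector is [b`_0] divided by the entry [f] of [M], which
    cancels the factor in [M A0 = f A M]. *)
Lemma abelian_frame_pull : abelian_frame br (pull_basis b N) A.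
Proof.
case: br_lin => lr ll _.
have N0 (j : nat) : j \in iota 1 6 -> coord b ord0 (pull_basis b N)`_j = 0.
  rewrite mem_iota => /andP[j1 j7]; rewrite pull_basisE //.
  have -> : b`_j = b`_(Ordinal (j7 : (j < 7)%N)) by [].
  rewrite emx_basis // coord_sum_free ?(basis_free bb) //.
  have := block_N0 (Ordinal (j7 : (j < 7)%N)); rewrite -val_eqE /= eq_sym gtn_eqF //.
  by move/eqP; rewrite mulf_eq0 (negPf f_neq0) /= => /eqP.
split=> [i j i6 j6|j j6]; first by rewrite br_ideal // N0.
have j7 : (j < 7)%N by move: j6; rewrite mem_iota => /andP[].
have -> : (pull_basis b N)`_0 = f^-1 *: b`_0.
  rewrite pull_basisE // -[b`_0]/(b`_(@ord0 6)) emx_basis // (bigD1 ord0) //=.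
  rewrite [X in _ + X]big1 ?addr0 => [|i i0].
    congr (_ *: _); apply: (mulIf f_neq0); rewrite block_0N eqxx mulVf //.
    exact: f_neq0.
  have := block_0N i; rewrite (negPf i0) => /eqP; rewrite mulf_eq0 (negPf f_neq0) orbF.
  by move/eqP => ->; rewrite scale0r.
have -> : br (f^-1 *: b`_0) (pull_basis b N)`_j = f^-1 *: br b`_0 (pull_basis b N)`_j.
  have := ll (pull_basis b N)`_j f^-1 b`_0 0; rewrite addr0 /= => ->.
  have := ll (pull_basis b N)`_j (-1) 0 0; rewrite scaler0 addr0 /= scaleN1r addNr => ->.
  by rewrite addr0.
rewrite br_transverse ?N0 // pull_basisE //.
have A0N : mx_of A0 *m N = f *: (N *m mx_of A).
  rewrite -[LHS]mul1mx -NM -mulmxA [M *m _]mulmxA MA -scalemxAl -!scalemxAr.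
  by rewrite -!mulmxA MN mulmx1.
rewrite (emxM bb) A0N.
have emxZ c X y : emx b (c *: X) y = c *: emx b X y.
  rewrite /emx scaler_sumr; apply: eq_bigr => i _; rewrite scalerA mulr_sumr.
  by congr (_ *: _); apply: eq_bigr => k _; rewrite mxE mulrA.
rewrite emxZ scalerA mulVf ?f_neq0 // scale1r -(emxM bb).
have -> : b`_j = b`_(Ordinal j7) by [].
rewrite [emx b (mx_of A) _]emx_basis // (linear_comb _ _ _ (emx_linear _ _)).
rewrite (eq_bigr (fun i : 'I_7 => A i j *: (pull_basis b N)`_i)) => [|i _]; last first.
  by rewrite mxE pull_basisE.
by rewrite (sum_head (fun i => A i j *: (pull_basis b N)`_i)) A00 scale0r add0r.
Qed.

End TransportedBracket.

(** * Local solutions of the coflow *)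

Section MatrixCurves.
Variable R : realType.

Definition is_derive_mx m n (t : R) (F : R -> 'M[R]_(m, n)) (D : 'M[R]_(m, n)) :=
  forall i j, is_derive t 1 (fun s => F s i j) (D i j).

Lemma is_derive_mulmx m n k t (F : R -> 'M[R]_(m, n)) (G : R -> 'M[R]_(n, k)) D E :
  is_derive_mx t F D -> is_derive_mx t G E ->
  is_derive_mx t (fun s => F s *m G s) (D *m G t + F t *m E).
Proof.
move=> FD GE i j.
have -> : (fun s => (F s *m G s) i j) = fun s => \sum_l F s i l * G s l j.
  by apply/funext => s; rewrite mxE.
have -> : (D *m G t + F t *m E) i j = \sum_l (D i l * G t l j + F t i l * E l j).
  by rewrite !mxE -big_split.
by apply: is_derive_sum_seq => l; exact: is_derive_mul.
Qed.

Lemma is_derive_mx_cst m n t (C : 'M[R]_(m, n)) : is_derive_mx t (fun=> C) 0.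
Proof. by move=> i j; rewrite mxE; exact: is_derive_cst (C i j) t 1. Qed.

Lemma is_derive_scalemx m n (t : R) (h : R -> R) (d : R) (F : R -> 'M[R]_(m, n)) D :
  is_derive t 1 h d -> is_derive_mx t F D ->
  is_derive_mx t (fun s => h s *: F s) (d *: F t + h t *: D).
Proof.
move=> hd FD i j.
have -> : (fun s => (h s *: F s) i j) = fun s => h s * F s i j.
  by apply/funext => s; rewrite mxE.
by rewrite !mxE; exact: is_derive_mul.
Qed.

Lemma is_derive_subr (f h : R -> R) (t a c : R) : is_derive t 1 f a -> is_derive t 1 h c ->
  is_derive t 1 (fun s => f s - h s) (a - c).
Proof. by move=> fa hc; exact: (is_deriveB fa hc). Qed.

Lemma is_derive_submx m n t (F G : R -> 'M[R]_(m, n)) D E :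
  is_derive_mx t F D -> is_derive_mx t G E ->
  is_derive_mx t (fun s => F s - G s) (D - E).
Proof.
move=> FD GE i j.
have -> : (fun s => (F s - G s) i j) = fun s => F s i j - G s i j.
  by apply/funext => s; rewrite !mxE.
by rewrite !mxE; exact: is_derive_subr.
Qed.

Lemma linear_mx_ode_zero n k (W : R -> 'M[R]_(n, k)) (Q : R -> 'M[R]_n) (M T : R) :
  (forall t : R, `|t| < T -> is_derive_mx t W (Q t *m W t)) ->
  (forall t : R, `|t| < T -> forall i j, `|Q t i j| <= M) ->
  forall s t : R, `|s| < T -> `|t| < T -> W s = 0 -> W t = 0.
Proof.
move=> dW QM s t sT tT W0; apply/matrixP => i j; rewrite [RHS]mxE.
apply: (@linear_ode_zero R n (fun u i => W u i j) (fun u i k => Q u i k) M T _ QM s t) => //.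
  by move=> u uT l; have := dW u uT l j; rewrite mxE.
by move=> l; rewrite W0 mxE.
Qed.

End MatrixCurves.

Section LocalFlow.
Variables (R : realType) (g : vectType R) (br : g -> g -> g).
Hypothesis br_lin : [/\ forall x, linear (br x), forall y, linear (br^~ y)
  & forall x, br x x = 0].

Definition flow_at (P : R -> g2_structure g) (t : R) : Prop :=
  (forall v, {for t, continuous (fun s : R => g2_form (P s) v)}) /\
  (forall v, is_derive t (1 : R) (fun s : R => psi (P s) v)
     (hodge_laplacian4 br (P t) (psi (P t)) v)).

(** Coclosed structures with an adapted frame, in which the bracket is bounded
    by [K]. *)
Definition adapted (K : R) (p : g2_structure g) : Prop :=
  exists b x, [/\ frame p b, abelian_frame br b (A_mat x) & normA x <= K].

Lemma sp_mat_ext (x y : nat -> R) a c : (forall i, (i < 21)%N -> x i = y i) ->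
  sp_mat x a c = sp_mat y a c.
Proof.
move=> xy.
have sk j k : skew_entry x j k = skew_entry y j k.
  by case: j => [|[|[|j]]]; case: k => [|[|[|k]]] //=; rewrite xy.
have sy o j k : (o + 5 < 21)%N -> sym_entry o x j k = sym_entry o y j k.
  by case: j => [|[|j]]; case: k => [|[|k]] /= o5; apply: xy; lia.
by rewrite /sp_mat /real_mat /U1 /U2 /S1 /S2 !sk !sy.
Qed.

Lemma A_mat_ext (x y : nat -> R) a c : (forall i, (i < 21)%N -> x i = y i) ->
  A_mat x a c = A_mat y a c.
Proof. by move=> xy; case: a => [|a]; case: c => [|c] //=; exact: sp_mat_ext. Qed.

Lemma normA_ext (x y : nat -> R) : (forall i, (i < 21)%N -> x i = y i) ->
  normA x = normA y.
Proof. by move=> xy; rewrite /normA /sum3 /U1 /U2 /S1 /S2 /= !xy. Qed.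

Lemma normA_coord (x : nat -> R) i : (i < 21)%N -> x i ^+ 2 <= normA x.
Proof.
move=> i21; have s j := sqr_ge0 (x j).
have -> : normA x = 2 * (x 0%N ^+ 2 + x 1%N ^+ 2 + x 2 ^+ 2)
  + x 3 ^+ 2 + 2 * x 4 ^+ 2 + 2 * x 5 ^+ 2 + x 6 ^+ 2 + 2 * x 7 ^+ 2 + x 8 ^+ 2
  + x 9 ^+ 2 + 2 * x 10 ^+ 2 + 2 * x 11 ^+ 2 + x 12 ^+ 2 + 2 * x 13 ^+ 2 + x 14 ^+ 2
  + x 15 ^+ 2 + 2 * x 16 ^+ 2 + 2 * x 17 ^+ 2 + x 18 ^+ 2 + 2 * x 19 ^+ 2 + x 20 ^+ 2.
  by rewrite /normA /sum3 /U1 /U2 /S1 /S2 /=; ring.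
have := s 0%N; have := s 1%N; have := s 2; have := s 3; have := s 4; have := s 5.
have := s 6; have := s 7; have := s 8; have := s 9; have := s 10; have := s 11.
have := s 12; have := s 13; have := s 14; have := s 15; have := s 16; have := s 17.
have := s 18; have := s 19; have := s 20 => *.
by do 21!(case: i i21 => [_|i i21]; first lra).
Qed.

Lemma A_mat_field (x : nat -> R) :
  mx_of (A_mat (nth 0 (sp_field x))) = - (qq x *: mx_of (A_mat x)) +
    (mx_of (Q_mat x) *m mx_of (A_mat x) - mx_of (A_mat x) *m mx_of (Q_mat x)).
Proof.
apply/matrixP => i j; rewrite !mxE -sumrB.
rewrite (eq_bigr (fun k : 'I_7 => Q_mat x i k * A_mat x k j - A_mat x i k * Q_mat x k j));
  last by move=> k _; rewrite !mxE.
rewrite (sum_head (fun k => Q_mat x i k * A_mat x k j - A_mat x i k * Q_mat x k j)).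
case: i => -[|i] i7; case: j => -[|j] j7 /=.
- by rewrite unlock /=; ring.
- by rewrite unlock /=; ring.
- by rewrite unlock /=; ring.
by rewrite sp_field_bracket // unlock /=; ring.
Qed.

Lemma sp_field_entries (x : nat -> R) j k : (j < 3)%N -> (k < 3)%N ->
  [/\ U1 (nth 0 (sp_field x)) j k = dU1 x j k, U2 (nth 0 (sp_field x)) j k = dU2 x j k,
      S1 (nth 0 (sp_field x)) j k = dS1 x j k & S2 (nth 0 (sp_field x)) j k = dS2 x j k].
Proof.
have [y1 [y2 y3]] : Y1 x 1 0 = Y1 x 0 1 /\ Y1 x 2 0 = Y1 x 0 2 /\ Y1 x 2 1 = Y1 x 1 2.
  by split; [|split]; apply: Y1C.
have [z1 [z2 z3]] : Y2 x 1 0 = Y2 x 0 1 /\ Y2 x 2 0 = Y2 x 0 2 /\ Y2 x 2 1 = Y2 x 1 2.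
  by split; [|split]; apply: Y2C.
rewrite /U1 /U2 /S1 /S2.
by case: j => [|[|[|//]]]; case: k => [|[|[|//]]] _ _; split=> //=;
  rewrite /dU1 /dU2 /dS1 /dS2 /sum3 ?(y1, y2, y3, z1, z2, z3) /U1 /U2 /S1 /S2 /=; ring.
Qed.

Section Solution.
Variables (X : R -> nat -> R) (T : R).
Hypothesis dX : forall t : R, `|t| < T ->
  forall i, is_derive t 1 (fun s => X s i) (nth 0 (frame_field (X t)) i).

Lemma is_derive_sym o j k (t : R) : `|t| < T -> (o + 5 < 21)%N ->
  is_derive t 1 (fun s => sym_entry o (X s) j k) (sym_entry o (nth 0 (sp_field (X t))) j k).
Proof.
move=> tT o5; have d i : (i < 21)%N ->
    is_derive t 1 (fun s => X s i) (nth 0 (sp_field (X t)) i).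
  by move=> i21; rewrite -frame_field_sp //; exact: dX.
by case: j => [|[|j]]; case: k => [|[|k]]; apply: d; lia.
Qed.

Lemma is_derive_oppr (f : R -> R) (t a : R) : is_derive t 1 f a ->
  is_derive t 1 (fun s => - f s) (- a).
Proof. by move=> fa; exact: (is_deriveN fa). Qed.

Lemma is_derive_skew j k (t : R) : `|t| < T ->
  is_derive t 1 (fun s => skew_entry (X s) j k) (skew_entry (nth 0 (sp_field (X t))) j k).
Proof.
move=> tT; have d i : (i < 21)%N ->
    is_derive t 1 (fun s => X s i) (nth 0 (sp_field (X t)) i).
  by move=> i21; rewrite -frame_field_sp //; exact: dX.
have z := is_derive_cst (0 : R) t (1 : R).
by case: j => [|[|[|j]]]; case: k => [|[|[|k]]] /=;
  first [exact: z|apply: d|apply: is_derive_oppr; apply: d].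
Qed.

Lemma is_derive_addr (f h : R -> R) (t a c : R) : is_derive t 1 f a -> is_derive t 1 h c ->
  is_derive t 1 (fun s => f s + h s) (a + c).
Proof. by move=> fa hc; exact: (is_deriveD fa hc). Qed.

Lemma is_derive_A (t : R) : `|t| < T -> is_derive_mx t (fun s => mx_of (A_mat (X s)))
  (mx_of (A_mat (nth 0 (sp_field (X t))))).
Proof.
move=> tT i j; rewrite mxE.
have -> : (fun s => mx_of (A_mat (X s)) i j) = fun s => A_mat (X s) i j.
  by apply/funext => s; rewrite mxE.
have z := is_derive_cst (0 : R) t (1 : R).
case: i => -[|i] i7; case: j => -[|j] j7 /=; try exact: z.
rewrite /sp_mat /real_mat; case: (odd i); case: (odd j);
  by [apply: is_derive_subr; by [apply: is_derive_skew|apply: is_derive_sym]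
     |apply: is_derive_addr; by [apply: is_derive_skew|apply: is_derive_sym]].
Qed.

Lemma is_derive_normA (t : R) : `|t| < T ->
  is_derive t 1 (fun s => normA (X s))
   (2 * sum3 (fun j => sum3 (fun k => U1 (X t) j k * dU1 (X t) j k
      + U2 (X t) j k * dU2 (X t) j k + S1 (X t) j k * dS1 (X t) j k
      + S2 (X t) j k * dS2 (X t) j k))).
Proof.
move=> tT.
have sq (f : R -> R) (a : R) : is_derive t 1 f a ->
    is_derive t 1 (fun s => f s ^+ 2) (2 * (f t * a)).
  move=> fa; have -> : 2 * (f t * a) = a * f t + f t * a by ring.
  by have := is_derive_mul fa fa.
have E j k : (j < 3)%N -> (k < 3)%N -> is_derive t 1
    (fun s => U1 (X s) j k ^+ 2 + U2 (X s) j k ^+ 2 + S1 (X s) j k ^+ 2 + S2 (X s) j k ^+ 2)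
    (2 * (U1 (X t) j k * dU1 (X t) j k + U2 (X t) j k * dU2 (X t) j k
     + S1 (X t) j k * dS1 (X t) j k + S2 (X t) j k * dS2 (X t) j k)).
  move=> j3 k3; have [<- <- <- <-] := sp_field_entries (X t) j3 k3.
  rewrite !mulrDr.
  by apply: is_derive_addr; [apply: is_derive_addr; [apply: is_derive_addr|]|];
    apply: sq; by [apply: is_derive_skew|apply: is_derive_sym].
have s3 (F : nat -> R -> R) (d : nat -> R) :
    (forall j, (j < 3)%N -> is_derive t 1 (F j) (2 * d j)) ->
    is_derive t 1 (fun s => sum3 (fun j => F j s)) (2 * sum3 d).
  move=> H; rewrite /sum3 !mulrDr; apply: is_derive_addr; last exact: H.
  by apply: is_derive_addr; exact: H.
apply: (s3 (fun j s => sum3 (fun k => U1 (X s) j k ^+ 2 + U2 (X s) j k ^+ 2 +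
  S1 (X s) j k ^+ 2 + S2 (X s) j k ^+ 2))) => j j3.
apply: (s3 (fun k s => U1 (X s) j k ^+ 2 + U2 (X s) j k ^+ 2 +
  S1 (X s) j k ^+ 2 + S2 (X s) j k ^+ 2)) => k k3.
exact: E.
Qed.

End Solution.
End LocalFlow.

Section LocalFlowExistence.
Variables (R : realType) (g : vectType R) (br : g -> g -> g).
Hypothesis br_lin : [/\ forall x, linear (br x), forall y, linear (br^~ y)
  & forall x, br x x = 0].

Section Curve.
Variables (X : R -> nat -> R) (T M : R) (x : nat -> R).
Hypothesis dX : forall t : R, `|t| < T ->
  forall i, is_derive t 1 (fun s => X s i) (nth 0 (frame_field (X t)) i).
Hypothesis QM : forall t : R, `|t| < T -> forall i j : 'I_7, `|Q_mat (X t) i j| <= M.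
Hypothesis T0 : 0 < T.

Let Th t := mx_of (frame_mat (X t)).
Let A t := mx_of (A_mat (X t)).
Let Q t := mx_of (Q_mat (X t)).

Lemma Th_derive (t : R) : `|t| < T -> is_derive_mx t Th (Q t *m Th t).
Proof.
move=> tT i j.
have -> : (fun s => Th s i j) = fun s => frame_mat (X s) i j.
  by apply/funext => s; rewrite mxE.
have -> : (Q t *m Th t) i j = frame_mat (nth 0 (frame_field (X t))) i j.
  rewrite frame_field_mat // mxE.
  have -> : iota 0 7 = index_iota 0 7 by [].
  by rewrite big_mkord; apply: eq_bigr => k _; rewrite !mxE.
have z := is_derive_cst (0 : R) t (1 : R).
by case: i => -[|i] i7; case: j => -[|j] j7 /=; try exact: z; exact: dX.
Qed.

Lemma Q_bound (t : R) : `|t| < T -> forall i j, `|Q t i j| <= M.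
Proof. by move=> tT i j; rewrite mxE; exact: QM. Qed.

Hypothesis Th0 : Th 0 = 1%:M.

(** A vector that is killed by Theta at some time solves the linear equation and is
    killed at time 0, where Theta is the identity. *)
Lemma Th_unit (t : R) : `|t| < T -> Th t \in unitmx.
Proof.
move=> tT; rewrite -unitmx_tr unitmxE unitfE; apply/det0P => -[v v0 vT].
move/eqP: v0; apply; apply: (can_inj trmxK); rewrite trmx0.
rewrite -[v^T]mul1mx -Th0.
apply: (@linear_mx_ode_zero R 7 1 (fun s => Th s *m v^T) Q M T _ Q_bound t 0) => //.
- move=> s sT; have := is_derive_mulmx (Th_derive sT) (is_derive_mx_cst s v^T).
  by rewrite mulmx0 addr0 mulmxA.
- by rewrite normr0.
- by apply: (can_inj trmxK); rewrite trmx_mul trmxK vT trmx0.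
Qed.

(** The difference Z of the two sides satisfies Z' = Q Z and vanishes at time 0. *)
Lemma Th_conj (t : R) : `|t| < T -> Th t *m A 0 = Th t ord0 ord0 *: (A t *m Th t).
Proof.
move=> tT; apply/eqP; rewrite -subr_eq0; apply/eqP.
have fE s : Th s ord0 ord0 = X s 21%N by rewrite mxE.
apply: (@linear_mx_ode_zero R 7 7
  (fun s => Th s *m A 0 - Th s ord0 ord0 *: (A s *m Th s)) Q M T _ Q_bound 0 t) => //.
- move=> s sT; have dTh := Th_derive sT.
  have df : is_derive s 1 (fun u => Th u ord0 ord0) (qq (X s) * Th s ord0 ord0).
    have := dTh ord0 ord0; rewrite mxE (bigD1 ord0) //= big1 ?addr0 => [|k k0].
      by rewrite !mxE.
    by rewrite mxE; case: k k0 => -[|k] //= *; rewrite mul0r.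
  have := is_derive_submx (is_derive_mulmx dTh (is_derive_mx_cst s (A 0)))
    (is_derive_scalemx df (is_derive_mulmx (is_derive_A dX sT) dTh)).
  rewrite mulmx0 addr0 A_mat_field -/(A s) -/(Q s).
  have -> // : Q s *m Th s *m A 0 - ((qq (X s) * Th s ord0 ord0) *: (A s *m Th s) +
      Th s ord0 ord0 *: ((- (qq (X s) *: A s) + (Q s *m A s - A s *m Q s)) *m Th s +
       A s *m (Q s *m Th s))) =
    Q s *m (Th s *m A 0 - Th s ord0 ord0 *: (A s *m Th s)).
  rewrite mulmxBr; congr (_ - _); first by rewrite mulmxA.
  rewrite mulmxDl mulNmx mulmxBl -!scalemxAl -!scalemxAr !mulmxA.
  rewrite -[- _ + _ + _]addrA subrK scalerDr scalerN scalerA addrA.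
  by rewrite [_ * qq (X s)]mulrC subrr add0r.
- by rewrite normr0.
- by rewrite Th0 mul1mx mulmx1 mxE eqxx scale1r subrr.
Qed.

Variables (p : g2_structure g) (b : 7.-tuple g).
Hypothesis fr : frame p b.

Definition coframe_map t := emx b (Th t).

Lemma coframe_derive k (a : form g k) v (t : R) : multilinear a -> `|t| < T ->
  is_derive t 1 (fun s => a (fun r => coframe_map s (v r)))
    (form_der (mat_end b (Q_mat (X t))) a (fun r => coframe_map t (v r))).
Proof.
move=> la tT; pose c s r i := \sum_(j < 7) Th s i j * coord b j (v r).
pose d r i := \sum_(j < 7) (Q t *m Th t) i j * coord b j (v r).
have := @is_derive_multilinear R g k a 7 (fun i => b`_i) c d t la.
have -> : \sum_r a (upd (fun r => \sum_i c t r i *: b`_i) r (\sum_i d r i *: b`_i)) =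
  form_der (mat_end b (Q_mat (X t))) a (fun r => coframe_map t (v r)).
  apply: eq_bigr => r _; congr (a (upd _ _ _)).
  by rewrite mat_endE ?fr.1 // -/(Q t) (emxM fr.1).
apply=> r i; apply: is_derive_sum_seq => j.
have := is_derive_mul (Th_derive tT i j) (is_derive_cst (coord b j (v r)) t (1 : R)).
by rewrite mulr0 addr0.
Qed.

End Curve.

(** The solution is the pullback of the initial structure by Theta. The Laplacian at
    time t is the action of Q in the transported frame, which is the velocity of that
    pullback. *)
Theorem local_flow (K : R) : exists2 T : R, 0 < T & forall p, adapted br K p ->
  exists P : R -> g2_structure g, g2_form (P 0) =1 g2_form p /\
    forall t : R, `|t| < T -> flow_at br P t /\ (0 <= t -> adapted br K (P t)).
Proof.
have K10 : 0 <= `|K| + 1 by rewrite addr_ge0.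
have [T T0 HT] := frame_ode K10; exists T => // p [b [x [fr frA xK]]].
have [M M0 HM] := Q_mat_bound (`|K| + 1 + 1).
(* The bracket, followed by the identity as initial coframe transformation. *)
pose x0 : nat -> R := fun i => if (i < 21)%N then x i else
  if i == 21%N then 1 else if (i < 58)%N then ((i - 22) %/ 6 == (i - 22) %% 6)%N%:R else 0.
have x0K i : `|x0 i| <= `|K| + 1.
  rewrite /x0; case: ifP => [i21|_].
    have h := le_trans (normA_coord x i21) (le_trans xK (ler_norm K)).
    have := sqr_ge0 (`|x i| - 1); rewrite sqrrB expr1n mulr1 -normrX ger0_norm ?sqr_ge0 //.
    by have := normr_ge0 (x i); lra.
  case: ifP => _; first by rewrite normr1 lerDr.
  by case: ifP => _; [case: eqP => _|]; rewrite ?normr1 ?normr0 ?lerDr.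
have [X [X0 HX]] := HT x0 x0K.
have dX (t : R) : `|t| < T -> forall i,
    is_derive t 1 (fun s => X s i) (nth 0 (frame_field (X t)) i).
  by move=> tT; exact: (HX t tT).2.
have QM (t : R) : `|t| < T -> forall i j : 'I_7, `|Q_mat (X t) i j| <= M.
  by move=> tT; apply: HM; exact: (HX t tT).1.
have x0x i : (i < 21)%N -> x0 i = x i by rewrite /x0 => ->.
have Th0 : mx_of (frame_mat (X 0)) = 1%:M.
  apply/matrixP => i j; rewrite !mxE X0 -val_eqE.
  case: i => -[|i] i7; case: j => -[|j] j7 //=; rewrite /x0.
  have -> : (22 + (6 * i + j) < 21)%N = false by lia.
  have -> : (22 + (6 * i + j) == 21)%N = false by lia.
  have -> : (22 + (6 * i + j) < 58)%N by lia.
  rewrite addKn mulnC divnMDl // divn_small // addn0 modnMDl modn_small //.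
have Thu := Th_unit dX QM T0 Th0.
have [P HP] : exists P : R -> g2_structure g, forall t : R, `|t| < T ->
    forall v, g2_form (P t) v = g2_form p (fun r => emx b (mx_of (frame_mat (X t))) (v r)).
  have : forall t, exists q : g2_structure g, `|t| < T ->
    forall v, g2_form q v = g2_form p (fun r => emx b (mx_of (frame_mat (X t))) (v r)).
    move=> t; have [tT|ntT] := pselect (`|t| < T); last by exists p => /ntT.
    have [q [qE _ _]] := pull_exists fr.1 fr (mulVmx (Thu t tT)).
    by exists q.
  by case/choice => P HP; exists P.
have HPpsi (t : R) : `|t| < T ->
    frame (P t) (pull_basis b (invmx (mx_of (frame_mat (X t))))) /\
    forall v, psi (P t) v = psi p (fun r => emx b (mx_of (frame_mat (X t))) (v r)).
  by move=> tT; apply: (pull_psi fr.1 fr (mulmxV (Thu t tT)) (mulVmx (Thu t tT)) (HP t tT)).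
have frAt (t : R) : `|t| < T ->
    abelian_frame br (pull_basis b (invmx (mx_of (frame_mat (X t))))) (A_mat (X t)).
  move=> tT.
  apply: (abelian_frame_pull br_lin fr.1 (mulmxV (Thu t tT)) (mulVmx (Thu t tT))
    (A0 := A_mat x)) => //.
  - by move=> j j0; rewrite mxE; case: j j0 => -[].
  - by move=> i i0; rewrite mxE; case: i i0 => -[].
  - have -> : mx_of (A_mat x) = mx_of (A_mat (X 0)).
      by apply/matrixP => i j; rewrite !mxE X0; apply: A_mat_ext => k k21; rewrite x0x.
    have H := Th_conj dX QM T0 Th0 tT. exact H.
have nearT (t : R) : `|t| < T -> \forall s \near t, `|s| < T.
  move=> tT; have tI : t \in `](- T), T[ by rewrite in_itv /= -ltr_norml.
  near=> s; have : s \in `](- T), T[ by near: s; exact: near_in_itvoo.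
  by rewrite in_itv /= -ltr_norml.
exists P; split=> [v|t tT].
  rewrite HP ?normr0 // Th0; congr (g2_form p); apply/funext => r.
  by rewrite (emx1 fr.1).
split; [split=> v|move=> t0].
- apply: is_derive_continuous.
  apply: near_eq_is_derive (coframe_derive dX fr v (g2_form_alt p).1 tT).
  by near=> s; rewrite HP //; near: s; exact: nearT.
- rewrite (laplacian_psi br_lin (HPpsi t tT).1 (frAt t tT)).
  have -> : form_der (mat_end (pull_basis b (invmx (mx_of (frame_mat (X t)))))
      (Q_mat (X t))) (psi (P t)) v =
    form_der (mat_end b (Q_mat (X t))) (psi p) (fun r => coframe_map X b t (v r)).
    apply: eq_bigr => r _; rewrite (HPpsi t tT).2; congr (psi p); apply/funext => l.
    rewrite /upd; case: eqP => // _.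
    rewrite (mat_endE (pull_basisP fr.1 (mulVmx (Thu t tT)))) (mat_endE fr.1).
    set Mt := mx_of (frame_mat (X t)); set b' := pull_basis b (invmx Mt).
    transitivity (emx b Mt (\sum_(i < 7) (\sum_(j < 7)
      mx_of (Q_mat (X t)) i j * coord b' j (v r)) *: b'`_i)); first by [].
    rewrite (linear_comb _ _ _ (emx_linear _ _)) [RHS]/emx; apply: eq_bigr => i _.
    rewrite pull_basisE // (emxVK fr.1 (mulmxV (Thu t tT))); congr (_ *: _).
    by apply: eq_bigr => k _; rewrite (coord_pull fr.1 (mulVmx (Thu t tT))).
  apply: near_eq_is_derive (coframe_derive dX fr v (psi_alt p).1 tT).
  by near=> s; rewrite (HPpsi s _).2 //; near: s; exact: nearT.
exists (pull_basis b (invmx (mx_of (frame_mat (X t))))), (X t); split.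
- exact: (HPpsi t tT).1.
- exact: frAt.
apply: le_trans xK; have -> : normA x = normA (X 0).
  by rewrite X0; apply: normA_ext => i i21; rewrite x0x.
have uT u : 0 <= u <= t -> `|u| < T.
  case/andP=> u0 ut; rewrite ger0_norm //; apply: le_lt_trans ut _.
  by rewrite -(ger0_norm t0).
apply: (derive_le0 t0 (fun u hu => is_derive_normA dX (uT u hu))) => u hu.
by rewrite mulr_ge0_le0 // normA_decreasing.
Unshelve. all: by end_near.
Qed.

End LocalFlowExistence.

(** * Recovering the structure from the 4-form *)

Section Reference.
Variables (R : realType) (g : vectType R).

Lemma wedge_scale k l (a : form g k) (c : form g l) s t v :
  wedge (fun u => s * a u) (fun u => t * c u) v = s * t * wedge a c v.
Proof.
rewrite /wedge mulrCA; congr (_ * _); rewrite mulr_sumr; apply: eq_bigr => u _.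
by move: ((-1) ^+ _) (a _) (c _) => x y z; ring.
Qed.

Lemma hodge_scale k l m (vol : form g (k + l)) (a : form g k) s v :
  hodge m vol (fun u => s * a u) v = s * hodge m vol a v.
Proof.
rewrite /hodge mulrCA; congr (_ * _); rewrite mulr_sumr; apply: eq_bigr => I _.
by rewrite mulr_sumr; apply: eq_bigr => J _; rewrite mulrCA !mulrA.
Qed.

Variables (p0 : g2_structure g) (b0 : 7.-tuple g).
Hypothesis fr0 : frame p0 b0.
Let bb := fr0.1.
Let e := nth 0 b0.

Lemma ref_vol M u : g2_vol p0 (fun r => emx b0 M (u r)) = \det M * g2_vol p0 u.
Proof.
rewrite (top_form _ bb (g2_vol_alt p0)) [g2_vol p0 u](top_form _ bb (g2_vol_alt p0)).
rewrite mulrCA; congr (_ * _); rewrite mulrC -[\det M]det_tr -det_mulmx.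
rewrite /det_form; congr (\det _); apply/matrixP => i j.
by rewrite !mxE coord_emx //; apply: eq_bigr => k _; rewrite !mxE mulrC.
Qed.

Lemma star_star (chi : form g 3) : alt_form chi ->
  hodge (k := 4) (l := 3) (g2_metric p0) (g2_vol p0)
    (hodge (k := 3) (l := 4) (g2_metric p0) (g2_vol p0) chi) = chi.
Proof.
move=> ac; apply/funext; apply: (alternating_ext (e := e) (N := 7)) => //.
- exact: spanning_basis bb.
- by apply: hodge_alt; exact: g2_vol_alt.
have v1 := frame_vol fr0; have av := g2_vol_alt p0.
move=> l sl al ssl; have ul := sorted_uniq ltn_trans ltnn ssl.
have ah : alt_form (hodge (k := 3) (l := 4) (g2_metric p0) (g2_vol p0) chi).
  by apply: hodge_alt; exact: av.
have sc : size (compl 7 l) = 4%N by rewrite size_compl // sl.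
rewrite (star_comp fr0 (erefl : (4 + 3)%N = 7) ah av v1 sl al).
rewrite (star_comp fr0 (erefl : (3 + 4)%N = 7) ac av v1 sc (compl_lt _ _)) mulrA -intrM.
have [-> ->] : star_sgn l * star_sgn (compl 7 l) = 1 /\ compl 7 (compl 7 l) = l.
  have : l \in combs 3 (iota 0 7) by exact: sorted_combs.
  move: (l); apply: all_listP.
  by vm_compute.
by rewrite mul1r.
Qed.

(** The G2-structures form a single orbit of GL(7). *)
Lemma ref_matrix p : exists M N : 'M[R]_7, [/\ M *m N = 1%:M, N *m M = 1%:M,
  forall v, g2_form p v = g2_form p0 (fun r => emx b0 M (v r)),
  forall x y, g2_metric p x y = g2_metric p0 (emx b0 M x) (emx b0 M y)
  & forall v, g2_vol p v = \det M * g2_vol p0 v].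
Proof.
have [b [bbp pE]] := frame_exists p.
pose N : 'M[R]_7 := \matrix_(i, a) coord b0 i b`_a.
pose M : 'M[R]_7 := \matrix_(i, a) coord b i b0`_a.
have NM : N *m M = 1%:M.
  apply/matrixP => i j; rewrite !mxE.
  transitivity (coord b0 i b0`_j); last by rewrite coord_free ?(basis_free bb) // eq_sym.
  rewrite [in RHS](coord_basis bbp (memvf b0`_j)) linear_sum /=; apply: eq_bigr => k _.
  by rewrite !mxE linearZ /= mulrC.
have MN : M *m N = 1%:M by exact: mulmx1C.
have [q [fE mE vE]] := pull_exists bb fr0 NM.
have pq : g2_form p =1 g2_form q.
  move=> v; rewrite fE pE fr0.2 !standard_g2E; congr g2_poly.
  apply/funext => i; apply/funext => r; rewrite coord_emx //.
  rewrite {1}(coord_basis bb (memvf (v r))) linear_sum /=; apply: eq_bigr => k _.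
  by rewrite linearZ /= mxE mulrC.
have [mq vq] := g2_form_inj pq.
exists M, N; split=> //; first by move=> v; rewrite pq fE.
  by move=> x y; rewrite mq mE.
by move=> v; rewrite vq vE ref_vol.
Qed.

(** The volume of the reference frame. *)
Definition ref_v p := g2_vol p (fun i : 'I_7 => b0`_i).

Lemma ref_vol0 : g2_vol p0 (fun i : 'I_7 => b0`_i) = 1.
Proof.
rewrite -(frame_vol fr0); congr (g2_vol p0); apply/funext => i.
by rewrite nth_iota.
Qed.

(** The star of the reference structure makes this a cubic polynomial in the 4-form
    [psi p] alone. It is the expression that defines the metric of a G2-structure,
    evaluated at a 3-form which encodes the inverse metric. *)
Definition ref_cubic p : 'M[R]_7 := \matrix_(i, j)
  let s := hodge (k := 4) (l := 3) (g2_metric p0) (g2_vol p0) (psi p) in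
  wedge (wedge (contract (k := 2) b0`_i s) (contract (k := 2) b0`_j s)) s
    (fun r : 'I_7 => b0`_r).

Lemma contract_comp (K : g -> g) x (a : form g 3) :
  contract (k := 2) x (fun u => a (fun r => K (u r))) =
  (fun u => contract (k := 2) (K x) a (fun r => K (u r))).
Proof.
apply/funext => u; rewrite /contract; congr a; apply/funext => r.
by rewrite /catv; case: fintype.split.
Qed.

Lemma ref_metric M x y : g2_metric p0 (emx b0 M x) (emx b0 M y) =
  \sum_k (\sum_i M k i * coord b0 i x) * (\sum_j M k j * coord b0 j y).
Proof.
have [_ mC _] := g2_ip p0.
rewrite {2}/emx (ip_sumr (g2_ip p0)); apply: eq_bigr => k _.
rewrite mulrC mC {1}/emx (ip_sumr (g2_ip p0)); congr (_ * _).
rewrite (bigD1 k) //= [X in _ + X]big1 ?addr0 => [|i ik].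
  by rewrite (frame_on fr0) eqxx mulr1.
by rewrite (frame_on fr0) eq_sym (negPf ik) mulr0.
Qed.

Lemma coord_b0 (i j : 'I_7) : coord b0 i b0`_j = (i == j)%:R.
Proof. by rewrite coord_free ?(basis_free bb) // eq_sym. Qed.

Lemma sum_delta (F : 'I_7 -> R) (j : 'I_7) : \sum_i F i * coord b0 i b0`_j = F j.
Proof.
rewrite (bigD1 j) //= big1 ?addr0 => [|i ij]; first by rewrite coord_b0 eqxx mulr1.
by rewrite coord_b0 (negPf ij) mulr0.
Qed.

(** If [p] is the pullback of [p0] by [M], the 3-form obtained from [psi p] by the star
    of [p0] is [det M] times the pullback of [g2_form p0] by the inverse transpose of
    [M]. Its cubic expression is therefore the inverse metric of [p] times
    6 (det M)^2, and its determinant recovers the volume up to sign. *)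
Lemma ref_facts p : exists H : 'M[R]_7,
  [/\ inv_metric (g2_metric p) (fun i : 'I_7 => b0`_i) H,
      ref_cubic p = (6 * ref_v p ^+ 2) *: H,
      \det (ref_cubic p) = 6 ^+ 7 * ref_v p ^+ 12,
      ref_v p != 0 & forall u, g2_vol p u = ref_v p * g2_vol p0 u].
Proof.
have [M [N [MN NM fE mE vE]]] := ref_matrix p.
have vM : ref_v p = \det M by rewrite /ref_v vE ref_vol0 mulr1.
have dMN : \det M * \det N = 1 by rewrite -det_mulmx MN det1.
have dM0 : \det M != 0.
  by apply/eqP => d0; move: dMN; rewrite d0 mul0r => /eqP; rewrite eq_sym oner_eq0.
pose chi : form g 3 := fun u => g2_form p0 (fun r => emx b0 N^T (u r)).
have achi : alt_form chi.
  have [lf zf] := g2_form_alt p0; split=> [v i c x y|v i j ij vij].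
    have E z : (fun r => emx b0 N^T (upd v i z r)) =
        upd (fun r => emx b0 N^T (v r)) i (emx b0 N^T z).
      by apply/funext => r; rewrite /upd; case: eqP.
    by rewrite /chi !E emx_linear lf.
  by rewrite /chi (zf _ i j) // vij.
have psiE w : psi p w = \det M *
    hodge (k := 3) (l := 4) (g2_metric p0) (g2_vol p0) chi w.
  have [_ ->] := pull_psi bb fr0 MN NM fE.
  have lv := (g2_vol_alt p0).1; have lf := (g2_form_alt p0).1.
  rewrite /psi !(hodge_on (g2_ip p0) bb (frame_on fr0)) //; last exact: achi.1.
  rewrite mulrCA; congr (_ * _).
  transitivity (\det M * \sum_(I : {ffun 'I_3 -> 'I_7}) g2_form p0 (fun r => b0`_(I r)) *
      \sum_(J : {ffun 'I_3 -> 'I_7}) (\prod_r N (J r) (I r)) *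
        g2_vol p0 (catv (fun r => b0`_(J r)) w)).
    rewrite mulr_sumr; apply: eq_bigr => I _; rewrite mulrCA; congr (_ * _).
    have -> : catv (fun r => b0`_(I r)) (fun r => emx b0 M (w r)) =
        fun r => emx b0 M (catv (fun r => emx b0 N b0`_(I r)) w r).
      apply/funext => r; rewrite /catv; case: fintype.split => // a.
      by rewrite (emxVK bb MN).
    rewrite ref_vol; congr (_ * _).
    have lw : multilinear (fun u : 'I_3 -> g => g2_vol p0 (catv u w)).
      by move=> u i c x y; rewrite !catv_updl lv.
    have /= <- := multilinear_expand (fun r i => N i (I r)) (fun i => b0`_i) lw.
    congr (g2_vol p0 (catv (k := 3) (l := 4) _ w)); apply/funext => r; exact: emx_basis.
  congr (_ * _); under eq_bigr => I _ do rewrite mulr_sumr.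
  rewrite exchange_big /=; apply: eq_bigr => J _.
  have -> : chi (fun r => b0`_(J r)) = \sum_(I : {ffun 'I_3 -> 'I_7})
     (\prod_r N (J r) (I r)) * g2_form p0 (fun r => b0`_(I r)).
    have /= <- := multilinear_expand (fun r i => N (J r) i) (fun i => b0`_i) lf.
    congr (g2_form p0); apply/funext => r; rewrite emx_basis //.
    by apply: eq_bigr => i _; rewrite mxE.
  by rewrite mulr_suml; apply: eq_bigr => I _; rewrite mulrCA mulrA.
have sE : hodge (k := 4) (l := 3) (g2_metric p0) (g2_vol p0) (psi p) =
    fun u => \det M * chi u.
  apply/funext => u; rewrite (funext psiE) hodge_scale.
  by rewrite (star_star achi).
have cE : ref_cubic p = (6 * ref_v p ^+ 2) *: (N *m N^T).
  apply/matrixP => i j; rewrite !mxE /= sE.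
  transitivity (\det M ^+ 3 * wedge (wedge (contract (k := 2) b0`_i chi)
      (contract (k := 2) b0`_j chi)) chi (fun r : 'I_7 => b0`_r)).
    have -> : wedge (contract (k := 2) b0`_i (fun u => \det M * chi u))
        (contract (k := 2) b0`_j (fun u => \det M * chi u)) =
        fun u => \det M * \det M * wedge (contract (k := 2) b0`_i chi)
      (contract (k := 2) b0`_j chi) u.
      by apply/funext => u; rewrite -wedge_scale.
    rewrite wedge_scale; congr (_ * _); ring.
  rewrite !contract_comp.
  have [_ _ BE] := g2_inducesP p0.
  have -> : wedge (wedge (fun u : 'I_2 -> g => contract (k := 2) (emx b0 N^T b0`_i)
       (g2_form p0) (fun r => emx b0 N^T (u r)))
     (fun u : 'I_2 -> g => contract (k := 2) (emx b0 N^T b0`_j) (g2_form p0)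
       (fun r => emx b0 N^T (u r)))) chi (fun r : 'I_7 => b0`_r) =
    wedge (wedge (contract (k := 2) (emx b0 N^T b0`_i) (g2_form p0))
      (contract (k := 2) (emx b0 N^T b0`_j) (g2_form p0))) (g2_form p0)
      (fun r : 'I_7 => emx b0 N^T b0`_r) by [].
  rewrite -BE ref_vol ref_vol0 ref_metric det_tr vM.
  have -> : \sum_k (\sum_i0 N^T k i0 * coord b0 i0 b0`_i) *
      (\sum_j0 N^T k j0 * coord b0 j0 b0`_j) = \sum_k N i k * N^T k j.
    by apply: eq_bigr => k _; rewrite !sum_delta !mxE.
  transitivity (6 * \det M ^+ 2 * (\sum_k N i k * N^T k j) * (\det M * \det N)).
    by ring.
  by rewrite dMN mulr1.
exists (N *m N^T); split=> //.
- move=> x; rewrite {1}(coord_basis bb (memvf x)) exchange_big /=.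
  apply: eq_bigr => q _; rewrite -scaler_suml; congr (_ *: _).
  rewrite -[x in LHS](emxK bb NM) coord_emx //.
  transitivity (\sum_k (\sum_p1 (N *m N^T) p1 q * M k p1) * coord b0 k (emx b0 M x)).
    apply: eq_bigr => k _; congr (_ * _).
    transitivity ((N *m (N^T *m M^T)) q k).
      by rewrite -trmx_mul MN trmx1 mulmx1.
    rewrite mulmxA mxE; apply: eq_bigr => l _; rewrite [M^T l k]mxE; congr (_ * _).
    by rewrite !mxE; apply: eq_bigr => z _; rewrite !mxE mulrC.
  under eq_bigr => k _ do rewrite mulr_suml.
  rewrite exchange_big /=; apply: eq_bigr => l _.
  rewrite mE ref_metric mulr_sumr; apply: eq_bigr => k _.
  by rewrite sum_delta coord_emx // -mulrA [M k l * _]mulrC.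
- rewrite cE detZ det_mulmx det_tr exprMn -exprM vM.
  have dN : \det N = (\det M)^-1 by apply: (mulfI dM0); rewrite dMN mulfV.
  by rewrite dN; field.
- by rewrite vM.
- by move=> u; rewrite vE vM.
Qed.

(** The even power in [ref_facts] does not see the orientation; this odd power, a
    polynomial in the 3-form, does. *)
Lemma ref_orientation p : ref_v p ^+ 9 = \det (\matrix_(i, j < 7) (6^-1 *
  wedge (wedge (contract (k := 2) b0`_i (g2_form p)) (contract (k := 2) b0`_j (g2_form p)))
    (g2_form p) (fun r : 'I_7 => b0`_r))).
Proof.
have [M [N [MN NM fE mE vE]]] := ref_matrix p.
have vM : ref_v p = \det M by rewrite /ref_v vE ref_vol0 mulr1.
have [_ _ BE] := g2_inducesP p.
rewrite [RHS](_ : _ = \det (ref_v p *: (M^T *m M))).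
  by rewrite detZ det_mulmx det_tr -vM -expr2 -exprD.
congr (\det _); apply/matrixP => i j; rewrite !mxE -BE -/(ref_v p) mE ref_metric.
have -> : \sum_k (\sum_i0 M k i0 * coord b0 i0 b0`_i) *
      (\sum_j0 M k j0 * coord b0 j0 b0`_j) = \sum_k M^T i k * M k j.
  by apply: eq_bigr => k _; rewrite !sum_delta !mxE.
by field.
Qed.

End Reference.

(** * Uniqueness of the flow *)

(** A class of real functions that contains the constants and is closed under
    sums and products contains everything computed from its members by the
    operations on forms. The class of continuous functions and the class of
    functions that agree on two curves up to the distance of the curves are
    both of this kind. *)
Section FunctionAlgebra.
Variables (R : realType) (X : Type) (A : (X -> R) -> Prop).
Hypothesis A_cst : forall c, A (fun=> c).
Hypothesis A_add : forall f h, A f -> A h -> A (fun x => f x + h x).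
Hypothesis A_mul : forall f h, A f -> A h -> A (fun x => f x * h x).

Lemma A_sum (I : Type) (r : seq I) (P : pred I) (F : I -> X -> R) :
  (forall i, A (F i)) -> A (fun x => \sum_(i <- r | P i) F i x).
Proof.
move=> H; elim: r => [|i r IH].
  by rewrite (_ : (fun x => _) = fun=> 0) //; apply/funext => x; rewrite big_nil.
rewrite (_ : (fun x => _) = fun x =>
  (if P i then F i x else 0) + \sum_(j <- r | P j) F j x).
  by apply: A_add => //; case: (P i) => //; exact: A_cst.
by apply/funext => x; rewrite big_cons; case: (P i); rewrite ?add0r.
Qed.

Lemma A_prod (I : Type) (r : seq I) (F : I -> X -> R) :
  (forall i, A (F i)) -> A (fun x => \prod_(i <- r) F i x).
Proof.
move=> H; elim: r => [|i r IH].
  by rewrite (_ : (fun x => _) = fun=> 1) //; apply/funext => x; rewrite big_nil.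
rewrite (_ : (fun x => _) = fun x => F i x * \prod_(j <- r) F j x).
  exact: A_mul.
by apply/funext => x; rewrite big_cons.
Qed.

Lemma A_opp f : A f -> A (fun x => - f x).
Proof.
move=> Af; rewrite (_ : (fun x => _) = fun x => (-1) * f x); last first.
  by apply/funext => x; rewrite mulN1r.
by apply: A_mul => //; exact: A_cst.
Qed.

Lemma A_det n (M : X -> 'M[R]_n) :
  (forall i j, A (fun x => M x i j)) -> A (fun x => \det (M x)).
Proof.
move=> H; apply: A_sum => s; apply: A_mul; first exact: A_cst.
by apply: A_prod => i.
Qed.

Variable g : vectType R.

Lemma A_wedge k l (a : X -> form g k) (c : X -> form g l) :
  (forall v, A (fun x => a x v)) -> (forall v, A (fun x => c x v)) ->
  forall v, A (fun x => wedge (a x) (c x) v).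
Proof.
move=> Ha Hc v; apply: A_mul; first exact: A_cst.
apply: A_sum => s; apply: A_mul => //; apply: A_mul => //; exact: A_cst.
Qed.

Lemma A_hodge k l (m : X -> g -> g -> R) (vol : X -> form g (k + l)) (a : X -> form g k) :
  (forall i j, A (fun x => invmx (gram (m x)) i j)) ->
  (forall v, A (fun x => vol x v)) -> (forall v, A (fun x => a x v)) ->
  forall v, A (fun x => hodge (m x) (vol x) (a x) v).
Proof.
move=> Hm Hv Ha v; apply: A_mul; first exact: A_cst.
apply: A_sum => I; apply: A_sum => J; apply: A_mul => //; apply: A_mul => //.
by apply: A_prod => r.
Qed.

Lemma A_ext_d (br : g -> g -> g) k (a : X -> form g k) :
  (forall v, A (fun x => a x v)) -> forall v, A (fun x => ext_d br (a x) v).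
Proof.
move=> Ha v; apply: A_sum => j; apply: A_sum => i; apply: A_mul => //; exact: A_cst.
Qed.

Lemma A_multilinear k (a : X -> form g k) N (e : 'I_N -> g) :
  (forall x, multilinear (a x)) -> (forall v, exists c : 'I_k -> 'I_N -> R,
    v = fun r => \sum_i c r i *: e i) ->
  (forall I : {ffun 'I_k -> 'I_N}, A (fun x => a x (fun r => e (I r)))) ->
  forall v, A (fun x => a x v).
Proof.
move=> la sp H v; have [c ->] := sp v.
rewrite (_ : (fun x => _) = fun x => \sum_(I : {ffun 'I_k -> 'I_N})
  (\prod_r c r (I r)) * a x (fun r => e (I r))); last first.
  by apply/funext => x; rewrite multilinear_expand.
by apply: A_sum => I; apply: A_mul => //; exact: A_cst.
Qed.

Variables (p0 : g2_structure g) (b0 : 7.-tuple g).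
Hypothesis fr0 : frame p0 b0.
Variable PP : X -> g2_structure g.
Hypothesis A_psi : forall v, A (fun x => psi (PP x) v).

Lemma A_ref_cubic i j : A (fun x => ref_cubic p0 b0 (PP x) i j).
Proof.
rewrite (_ : (fun x => _) = fun x =>
  let s := hodge (k := 4) (l := 3) (g2_metric p0) (g2_vol p0) (psi (PP x)) in
  wedge (wedge (contract (k := 2) b0`_i s) (contract (k := 2) b0`_j s)) s
    (fun r : 'I_7 => b0`_r)); last by apply/funext => x; rewrite mxE.
have As v : A (fun x => hodge (k := 4) (l := 3) (g2_metric p0) (g2_vol p0) (psi (PP x)) v).
  apply: (@A_hodge 4 3 (fun=> g2_metric p0) (fun=> g2_vol p0) _ _ _ A_psi) => *; exact: A_cst.
by apply: A_wedge => // v; apply: A_wedge => // u; exact: As.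
Qed.

Lemma A_ref_v12 : A (fun x => ref_v b0 (PP x) ^+ 12).
Proof.
rewrite (_ : (fun x => _) = fun x => (6 ^+ 7)^-1 * \det (ref_cubic p0 b0 (PP x))).
  by apply: A_mul; [exact: A_cst|apply: A_det; exact: A_ref_cubic].
apply/funext => x; have [H [_ _ -> _ _]] := ref_facts fr0 (PP x).
by rewrite mulKf // expf_neq0 // pnatr_eq0.
Qed.

Hypothesis A_v : A (fun x => ref_v b0 (PP x)).
Hypothesis A_vV : A (fun x => (ref_v b0 (PP x))^-1).

Lemma A_vol u : A (fun x => g2_vol (PP x) u).
Proof.
rewrite (_ : (fun x => _) = fun x => ref_v b0 (PP x) * g2_vol p0 u).
  by apply: A_mul => //; exact: A_cst.
by apply/funext => x; have [H [_ _ _ _ ->]] := ref_facts fr0 (PP x).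
Qed.

Lemma A_inv_gram i j : A (fun x => invmx (gram (g2_metric (PP x))) i j).
Proof.
pose D : 'M[R]_(7, \dim {:g}) := \matrix_(p, i) coord (vbasis {:g}) i b0`_p.
rewrite (_ : (fun x => _) = fun x => \sum_q (\sum_p D p i *
   (6^-1 * ((ref_v b0 (PP x))^-1 * (ref_v b0 (PP x))^-1) * ref_cubic p0 b0 (PP x) p q)) * D q j).
  apply: A_sum => q; apply: A_mul; last exact: A_cst.
  apply: A_sum => p; apply: A_mul; first exact: A_cst.
  by apply: A_mul (A_ref_cubic _ _); apply: A_mul; [exact: A_cst|exact: A_mul].
apply/funext => x; have [H [eM cE _ v0 _]] := ref_facts fr0 (PP x).
rewrite cE (invmx_gram (g2_ip _) eM) mxE; apply: eq_bigr => q _; rewrite !mxE.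
congr (_ * _); apply: eq_bigr => p _; rewrite !mxE; congr (_ * _).
by field.
Qed.

Lemma A_form v : A (fun x => g2_form (PP x) v).
Proof.
rewrite (_ : (fun x => _) = fun x =>
  hodge (k := 4) (l := 3) (g2_metric (PP x)) (g2_vol (PP x)) (psi (PP x)) v).
  by apply: A_hodge => // *; [exact: A_inv_gram|exact: A_vol].
by apply/funext => x; have [b fr] := frame_exists (PP x); rewrite (psi_star fr).
Qed.

Lemma A_laplacian br v : A (fun x => hodge_laplacian4 br (PP x) (psi (PP x)) v).
Proof.
have Ai := A_inv_gram; have Av := A_vol.
apply: A_add.
  apply: A_ext_d => u; apply: A_hodge => // w; apply: A_ext_d => z.
  by apply: A_hodge.
apply: A_opp; apply: A_hodge => // w; apply: A_ext_d => z; apply: A_hodge => // y.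
exact: A_ext_d.
Qed.

End FunctionAlgebra.

Section FlowUniqueness.
Variable R : realType.

(** A change of sign would produce a zero. *)
Lemma nonzero_sign (f : R -> R) s t :
  (forall u, Num.min s t <= u <= Num.max s t -> {for u, continuous f} /\ f u != 0) ->
  0 < f s * f t.
Proof.
wlog st : s t / s <= t.
  move=> H K; case/orP: (le_total s t) => [st|ts]; first exact: (H s t st).
  by rewrite mulrC; apply: (H t s ts) => u; rewrite minC maxC => /K.
rewrite min_l // max_r // => H; rewrite ltNge; apply/negP => ft.
have cf : ({within `[s, t], continuous f})%classic.
  by apply: continuous_in_subspaceT => u; rewrite inE /= in_itv /= => /H[].
have [|c cst fc] := IVT (v := 0) st cf; last first.
  by move: (cst); rewrite in_itv /= => /H[_]; rewrite fc eqxx.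
rewrite ge_min le_max; move: ft; have [a|a] := leP (f s) 0; have [b|b] := leP 0 (f t);
  rewrite ?orbT //=.
- by rewrite orbF !leNgt => h; apply: contra h => fs0; rewrite nmulr_rgt0.
- by rewrite pmulr_rle0 // => h; rewrite h.
- by rewrite (ltW a) (ltW b).
Qed.

Variables (s0 e0 : R).
Let J u := s0 <= u <= e0.

Lemma segment_bounded (f : R -> R) : s0 <= e0 ->
  (forall u, J u -> {for u, continuous f}) -> exists2 C, 0 <= C & forall u, J u -> `|f u| <= C.
Proof.
move=> se cf; have [] := @EVT_max R (fun u => `|f u|) s0 e0 se.
  apply: continuous_in_subspaceT => u; rewrite inE /= in_itv /= => /cf fu.
  by apply: continuous_comp fu _; exact: norm_continuous.
by move=> c _ H; exists `|f c| => // u Ju; apply: H; rewrite in_itv.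
Qed.

Lemma segment_positive (f : R -> R) : s0 <= e0 ->
  (forall u, J u -> {for u, continuous f} /\ 0 < f u) ->
  exists2 c, 0 < c & forall u, J u -> c <= f u.
Proof.
move=> se cf; have [] := @EVT_min R f s0 e0 se.
  by apply: continuous_in_subspaceT => u; rewrite inE /= in_itv /= => /cf[].
move=> c; rewrite in_itv /= => Jc H; have [_ fc] := cf c Jc.
by exists (f c) => // u Ju; apply: H; rewrite in_itv.
Qed.

End FlowUniqueness.

(** Functions on two curves whose values are bounded and differ by at most a
    multiple of the distance [nrm] of the curves. *)
Section Closeness.
Variables (R : realType) (J : R -> Prop) (nrm : R -> R).
Hypothesis nrm0 : forall u, 0 <= nrm u.

Definition close (f : bool * R -> R) : Prop := exists2 C, 0 <= C &
  forall u, J u -> [/\ `|f (true, u)| <= C, `|f (false, u)| <= C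
    & `|f (true, u) - f (false, u)| <= C * nrm u].

Lemma close_cst c : close (fun=> c).
Proof. by exists `|c| => // u _; split; rewrite // subrr normr0 mulr_ge0. Qed.

Lemma close_add f h : close f -> close h -> close (fun x => f x + h x).
Proof.
move=> [C C0 Cf] [D D0 Dh]; exists (C + D); first exact: addr_ge0.
move=> u Ju; have [f1 f2 f12] := Cf u Ju; have [h1 h2 h12] := Dh u Ju.
split; try by apply: le_trans (ler_normD _ _) _; exact: lerD.
rewrite opprD addrACA mulrDl; apply: le_trans (ler_normD _ _) _; exact: lerD.
Qed.

Lemma close_mul f h : close f -> close h -> close (fun x => f x * h x).
Proof.
move=> [C C0 Cf] [D D0 Dh]; have CD : 0 <= C * D by rewrite mulr_ge0.
exists (C * D + C * D); first by rewrite addr_ge0.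
move=> u Ju; have [f1 f2 f12] := Cf u Ju; have [h1 h2 h12] := Dh u Ju.
have le x y : `|x| <= C -> `|y| <= D -> `|x * y| <= C * D + C * D.
  move=> xC yD; rewrite normrM; apply: (@le_trans _ _ (C * D)); last by rewrite lerDl.
  exact: ler_pM.
split; try exact: le.
have -> : f (true, u) * h (true, u) - f (false, u) * h (false, u) =
  f (true, u) * (h (true, u) - h (false, u)) + (f (true, u) - f (false, u)) * h (false, u).
  by ring.
rewrite [leRHS]mulrDl; apply: le_trans (ler_normD _ _) _; rewrite !normrM; apply: lerD.
  by rewrite -mulrA ler_pM.
by rewrite mulrAC ler_pM.
Qed.

(** As the two values have the same sign, the cofactor in the factorisation of
    x^(n+1) - y^(n+1) by x - y is a sum of terms of one sign, bounded below by c^n. *)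
Lemma close_root f n c : 0 < c -> c <= 1 -> (forall i u, J u -> c <= `|f (i, u)|) ->
  (forall u, J u -> 0 < f (true, u) * f (false, u)) ->
  close (fun x => f x ^+ n.+1) -> close f.
Proof.
move=> c0 c1 cf sg [C C0 Cf]; exists (1 + C / c ^+ n).
  by rewrite addr_ge0 // divr_ge0 // exprn_ge0 // ltW.
have bnd x : `|x ^+ n.+1| <= C -> `|x| <= 1 + C / c ^+ n.
  move=> xC; have CcC : C <= C / c ^+ n.
    rewrite ler_pdivlMr ?exprn_gt0 // ler_piMr // exprn_ile1 //; exact: ltW.
  have [x1|x1] := leP `|x| 1.
    by apply: le_trans x1 _; rewrite lerDl; exact: le_trans CcC.
  apply: (@le_trans _ _ C); last by apply: le_trans CcC _; rewrite lerDr.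
  by apply: le_trans xC; rewrite normrX; apply: ler_eXnr => //; exact: ltW.
move=> u Ju; have [f1 f2 f12] := Cf u Ju; split; try exact: bnd.
set x := f (true, u) in f1 f12 *; set y := f (false, u) in f2 f12 *.
have xy : 0 < x * y := sg u Ju.
rewrite mulrDl mul1r; apply: (@le_trans _ _ (C / c ^+ n * nrm u)); last by rewrite lerDr.
have E : `|x ^+ n.+1 - y ^+ n.+1| = `|x - y| * `|\sum_(i < n.+1) x ^+ (n.+1.-1 - i) * y ^+ i|.
  by rewrite subrXX normrM.
have S : c ^+ n <= `|\sum_(i < n.+1) x ^+ (n.+1.-1 - i) * y ^+ i|.
  have pos (i : 'I_n.+1) : 0 <= (x ^+ (n - i) * y ^+ i) * x ^+ n.
    have -> : x ^+ n = x ^+ (n - i) * x ^+ i by rewrite -exprD subnK // -ltnS.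
    rewrite mulrACA -(exprMn i y x) mulr_ge0 //; last by rewrite exprn_ge0 // [y * x]mulrC ltW.
    by rewrite -expr2 sqr_ge0.
  have x0 : 0 < `|x ^+ n| by rewrite normr_gt0 expf_neq0 //; apply: contraTneq xy => ->; rewrite mul0r ltxx.
  rewrite -(ler_pM2r x0) -normrM mulr_suml big_ord_recl /= subn0 expr0 mulr1.
  rewrite [leRHS]ger0_norm; last first.
    rewrite addr_ge0 //; first by rewrite -expr2 sqr_ge0.
    by apply: sumr_ge0 => i _; exact: pos (lift ord0 i).
  apply: (@le_trans _ _ (x ^+ n * x ^+ n)); last first.
    by rewrite lerDl; apply: sumr_ge0 => i _; exact: pos (lift ord0 i).
  have -> : x ^+ n * x ^+ n = `|x ^+ n| * `|x ^+ n|.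
    by rewrite -normrM ger0_norm // -expr2 sqr_ge0.
  rewrite ler_wpM2r //.
  by rewrite normrX lerXn2r ?nnegrE ?(ltW c0) //; exact: cf.
rewrite mulrAC ler_pdivlMr ?exprn_gt0 //; apply: le_trans f12; rewrite E.
by rewrite ler_wpM2l.
Qed.

Lemma close_inv f c : 0 < c -> (forall i u, J u -> c <= `|f (i, u)|) ->
  close f -> close (fun x => (f x)^-1).
Proof.
move=> c0 cf [C C0 Cf]; exists (c^-1 + C / c ^+ 2).
  by rewrite addr_ge0 ?invr_ge0 ?divr_ge0 ?sqr_ge0 // ltW.
have d0 : 0 <= C / c ^+ 2 by rewrite divr_ge0 ?sqr_ge0.
have bnd i u : J u -> `|(f (i, u))^-1| <= c^-1.
  move=> Ju; have h := cf i u Ju; rewrite normfV lef_pV2 ?posrE //.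
  exact: lt_le_trans h.
have n0 i u : J u -> f (i, u) != 0.
  by move=> Ju; rewrite -normr_gt0; exact: lt_le_trans (cf i u Ju).
move=> u Ju; split; try by apply: le_trans (bnd _ _ Ju) _; rewrite lerDl.
have [_ _ f12] := Cf u Ju.
have -> : (f (true, u))^-1 - (f (false, u))^-1 =
   - ((f (true, u) - f (false, u)) * ((f (true, u))^-1 * (f (false, u))^-1)).
  by field; rewrite !n0.
rewrite normrN normrM mulrDl; apply: (@le_trans _ _ (C / c ^+ 2 * nrm u)); last first.
  by rewrite lerDr mulr_ge0 // invr_ge0 ltW.
rewrite mulrAC ler_pM // normrM expr2 invfM.
by apply: ler_pM; rewrite ?normr_ge0 ?bnd.
Qed.

End Closeness.

Section FlowUnique.
Variables (R : realType) (g : vectType R) (br : g -> g -> g).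
Variables (P1 P2 : R -> g2_structure g) (t0 t : R).
Let J u := Num.min t0 t <= u <= Num.max t0 t.
Hypothesis flows : forall u, J u -> flow_at br P1 u /\ flow_at br P2 u.
Hypothesis start : g2_form (P1 t0) =1 g2_form (P2 t0).

Let P (i : bool) := if i then P1 else P2.
Let flowP i u : J u -> flow_at br (P i) u.
Proof. by case: i => /flows[]. Qed.

Let se : Num.min t0 t <= Num.max t0 t.
Proof. by rewrite ge_min !le_max !lexx. Qed.

Let cont (f : R -> R) := forall u, J u -> {for u, continuous f}.

Let cont_cst c : cont (fun=> c).
Proof. by move=> u _; exact: cst_continuous. Qed.
Let cont_add f h : cont f -> cont h -> cont (fun x => f x + h x).
Proof. by move=> cf ch u Ju; apply: continuousD; [exact: cf|exact: ch]. Qed.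
Let cont_mul f h : cont f -> cont h -> cont (fun x => f x * h x).
Proof. by move=> cf ch u Ju; apply: continuousM; [exact: cf|exact: ch]. Qed.

Let cont_psi i v : cont (fun s => psi (P i s) v).
Proof. by move=> u Ju; have [_ /(_ v)/is_derive_continuous] := flowP i Ju. Qed.
Let cont_form i v : cont (fun s => g2_form (P i s) v).
Proof. by move=> u Ju; have [/(_ v)] := flowP i Ju. Qed.

(** The 4-form determines the structure up to orientation with Lipschitz
    constants that are uniform along the two curves, and the orientation cannot
    change; so the flow is governed by a Lipschitz equation in the 4-form. *)
Lemma flow_unique : g2_form (P1 t) =1 g2_form (P2 t).
Proof.
have [b0 fr0] := frame_exists (P1 t0).
have v0 i u : ref_v b0 (P i u) != 0 by have [H []] := ref_facts fr0 (P i u).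
have [c [c0 c1 cv]] : exists c : R, [/\ 0 < c, c <= 1
    & forall i u, J u -> c <= `|ref_v b0 (P i u)|].
  have H i : exists2 c : R, 0 < c & forall u, J u -> c <= ref_v b0 (P i u) ^+ 12.
    have c12 : cont (fun s => ref_v b0 (P i s) ^+ 12).
      exact: (A_ref_v12 cont_cst cont_add cont_mul fr0 (@cont_psi i)).
    apply: segment_positive se _ => u Ju; split; first exact: c12.
    by rewrite (_ : 12 = 6 * 2)%N // exprM lt_neqAle sqr_ge0 andbT eq_sym !expf_neq0.
  have [c1 c10 H1] := H true; have [c2 c20 H2] := H false.
  exists (Num.min 1 (Num.min c1 c2)); split.
  - by rewrite !lt_min ltr01 c10.
  - by rewrite ge_min lexx.
  move=> i u Ju; have [v1|v1] := leP 1 `|ref_v b0 (P i u)|; first by rewrite ge_min v1.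
  have : ref_v b0 (P i u) ^+ 12 <= `|ref_v b0 (P i u)|.
    apply: le_trans (ler_norm _) _; rewrite normrX exprS ler_piMr //.
    by apply: exprn_ile1 => //; exact: ltW.
  apply: le_trans; rewrite !ge_min; apply/orP; right; apply/orP.
  by case: i {v1}; [left; exact: H1|right; exact: H2].
(* The orientations agree at the initial time and cannot change. *)
have sg u : J u -> 0 < ref_v b0 (P1 u) * ref_v b0 (P2 u).
  move=> Ju; pose w s := (ref_v b0 (P1 s) * ref_v b0 (P2 s)) ^+ 9.
  have cw : cont w.
    have c9 i : cont (fun s => ref_v b0 (P i s) ^+ 9).
      rewrite (_ : (fun s => _) = fun s => \det (\matrix_(i0, j < 7) (6^-1 *
        wedge (wedge (contract (k := 2) b0`_i0 (g2_form (P i s)))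
          (contract (k := 2) b0`_j (g2_form (P i s)))) (g2_form (P i s))
          (fun r : 'I_7 => b0`_r)))); last by apply/funext => s; exact: (ref_orientation fr0).
      apply: (A_det cont_cst cont_add cont_mul) => a d.
      rewrite (_ : (fun s => _) = fun s => 6^-1 *
        wedge (wedge (contract (k := 2) b0`_a (g2_form (P i s)))
          (contract (k := 2) b0`_d (g2_form (P i s)))) (g2_form (P i s))
          (fun r : 'I_7 => b0`_r)); last by apply/funext => s; rewrite mxE.
      apply: cont_mul; first exact: cont_cst.
      apply: (A_wedge cont_cst cont_add cont_mul) => [v|]; last exact: cont_form.
      by apply: (A_wedge cont_cst cont_add cont_mul) => x; exact: cont_form.
    rewrite (_ : w = fun s => ref_v b0 (P true s) ^+ 9 * ref_v b0 (P false s) ^+ 9).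
      exact: cont_mul.
    by apply/funext => s; rewrite /w exprMn.
  have : 0 < w t0 * w u.
    apply: nonzero_sign => s su; have Js : J s.
      move: Ju su; rewrite /J !ge_min !le_max => /andP[/orP h1 /orP h2] /andP[/orP h3 /orP h4].
      by apply/andP; split; apply/orP;
        case: h1; case: h2; case: h3; case: h4; move=> *; lra.
    by split; [exact: cw|rewrite expf_neq0 // mulf_neq0 // (v0 true, v0 false)].
  have pw s : 0 < w s -> 0 < ref_v b0 (P1 s) * ref_v b0 (P2 s).
    rewrite !ltNge; apply: contra => h; rewrite /w exprS.
    by rewrite mulr_le0_ge0 // exprn_even_ge0.
  move=> h; apply: pw; move: h; rewrite pmulr_rgt0 // /w.
  rewrite /ref_v (g2_form_inj start).2 exprn_gt0 // -expr2.
  by rewrite lt_neqAle sqr_ge0 andbT eq_sym sqrf_eq0; exact: (v0 false).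
pose d (I : {ffun 'I_4 -> 'I_7}) u := psi (P1 u) (fun r : 'I_4 => b0`_(I r)) - psi (P2 u) (fun r : 'I_4 => b0`_(I r)).
pose nrm u := \sum_(I : {ffun 'I_4 -> 'I_7}) `|d I u|.
have nrm0 u : 0 <= nrm u by apply: sumr_ge0.
pose PP (x : bool * R) := P x.1 x.2.
have K_cst := close_cst J nrm0; have K_add := @close_add R J nrm.
have K_mul := @close_mul R J nrm.
have K_psi v : close J nrm (fun x => psi (PP x) v).
  apply: (A_multilinear K_cst K_add K_mul (a := fun x => psi (PP x)) (e := fun i : 'I_7 => b0`_i)).
  - by move=> x; exact: (psi_alt _).1.
  - move=> u; exists (fun r i => coord b0 i (u r)); apply/funext => r.
    by rewrite -(coord_basis fr0.1) ?memvf.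
  move=> I; set vI := (fun r : 'I_4 => b0`_(I r)).
  have [C C0 HC] := segment_bounded se (@cont_psi true vI).
  have [D D0 HD] := segment_bounded se (@cont_psi false vI).
  exists (1 + C + D); first by rewrite !addr_ge0.
  move=> u Ju; split.
  - by apply: le_trans (HC u Ju) _; lra.
  - by apply: le_trans (HD u Ju) _; lra.
  apply: (@le_trans _ _ (nrm u)); first by rewrite /nrm (bigD1 I) //= lerDl sumr_ge0.
  by rewrite ler_peMl //; lra.
have K_v : close J nrm (fun x => ref_v b0 (PP x)).
  apply: (close_root (n := 11) nrm0 c0 c1) => [i u|u /sg|] //; first exact: cv.
  exact: (A_ref_v12 K_cst K_add K_mul fr0 K_psi).
have K_vV : close J nrm (fun x => (ref_v b0 (PP x))^-1).
  apply: (close_inv nrm0 c0) K_v => i u; exact: cv.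
pose L i u (I : {ffun 'I_4 -> 'I_7}) :=
  hodge_laplacian4 br (P i u) (psi (P i u)) (fun r : 'I_4 => b0`_(I r)).
have /choice[C HC] : forall I, exists C : R, 0 <= C /\ forall u, J u ->
    `|L true u I - L false u I| <= C * nrm u.
  move=> I; have [C C0 HC] := A_laplacian K_cst K_add K_mul fr0 K_psi K_v K_vV br
    (fun r : 'I_4 => b0`_(I r)).
  by exists C; split=> // u /HC[].
pose D u := \sum_I d I u * d I u.
pose dD u := \sum_I ((L true u I - L false u I) * d I u + d I u * (L true u I - L false u I)).
have sq0 I u : 0 <= d I u * d I u by rewrite -expr2 sqr_ge0.
have dD' I u : d I u * d I u <= D u.
  by rewrite /D (bigD1 I) //= lerDl; apply: sumr_ge0 => K _; exact: sq0.
have D0 u : 0 <= D u by apply: sumr_ge0 => I _; exact: sq0.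
pose N : R := #|{ffun 'I_4 -> 'I_7}|%:R.
have dn I u : `|d I u| * nrm u <= N * D u.
  rewrite /nrm mulr_sumr /N mulr_natl -sumr_const; apply: ler_sum => K _.
  have := dD' I u; have := dD' K u; have := sqr_ge0 (`|d I u| - `|d K u|).
  rewrite sqrrB !expr2 -!normrM !(ger0_norm (sq0 _ _)) normrM mulr2n; lra.
have Dt : D t = 0.
  apply: (@gronwall R D dD (2 * N * \sum_I C I) t0 t).
  - move=> u Ju; apply: is_derive_sum_seq => I.
    have dI : is_derive u 1 (d I) (L true u I - L false u I).
      by apply: is_deriveB; [exact: (flowP true Ju).2|exact: (flowP false Ju).2].
    exact: is_derive_mul.
  - move=> u Ju; apply: le_trans (ler_norm_sum _ _ _) _.
    rewrite mulrAC mulr_sumr; apply: ler_sum => I _; have [CI0 /(_ u Ju) HI] := HC I.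
    have -> : (L true u I - L false u I) * d I u + d I u * (L true u I - L false u I) =
      2 * ((L true u I - L false u I) * d I u).
      by move: (L true u I - L false u I) (d I u) => x y; ring.
    rewrite !normrM ger0_norm // -!mulrA ler_pM2l //.
    apply: (@le_trans _ _ (C I * nrm u * `|d I u|)); first by rewrite ler_wpM2r.
    rewrite -mulrA [nrm u * _]mulrC [N * _]mulrA [leRHS]mulrC.
    by rewrite ler_wpM2l.
  - by apply: big1 => I _; rewrite /d (psi_inj start) subrr mul0r.
  - exact: D0.
have nt : nrm t = 0.
  apply: big1 => I _; apply/eqP; rewrite normr_eq0 -sqrf_eq0 expr2.
  by apply/eqP/le_anti; rewrite sq0 andbT -Dt.
have Jt : J t by rewrite /J ge_min le_max !lexx !orbT.
move=> v; have [C0 C00 HC0] := A_form K_cst K_add K_mul fr0 K_psi K_v K_vV v.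
have [_ _] := HC0 t Jt; rewrite nt mulr0 normr_le0 subr_eq0.
by move/eqP.
Qed.

End FlowUnique.

(** * A frame adapted to the Abelian ideal *)

Section Rotations.
Variable R : realType.

(** Rotation by an angle in the plane [(i, j)] and by the opposite angle in the
    plane [(p, q)]. *)
Definition rot (i j p q : nat) (c s : R) (y : nat -> R) : nat -> R := fun a =>
  if a == i then c * y i + s * y j else if a == j then c * y j - s * y i else
  if a == p then c * y p - s * y q else if a == q then c * y q + s * y p else y a.

Definition rot_mx i j p q c s : 'M[R]_7 :=
  \matrix_(a, k) rot i j p q c s (fun l => (l == k)%:R) a.

(** The planes for which [rot] preserves the standard 3-form. *)
Definition g2_planes i j p q : Prop := [/\ (i < 7)%N, (j < 7)%N, (p < 7)%N, (q < 7)%N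
  & forall c s, c ^+ 2 + s ^+ 2 = 1 ->
    (forall y z, \sum_(a <- iota 0 7) rot i j p q c s y a * rot i j p q c s z a =
       \sum_(a <- iota 0 7) y a * z a) /\
    forall x, g2_poly (fun a r => rot i j p q c s (x^~ r) a) = g2_poly x].

Lemma kill_angle (a b : R) : exists c s : R, c ^+ 2 + s ^+ 2 = 1 /\ c * a + s * b = 0.
Proof.
have [ab0|ab0] := eqVneq (a ^+ 2 + b ^+ 2) 0.
  exists 1, 0; split; first by rewrite expr1n expr0n addr0.
  move/eqP: ab0; rewrite paddr_eq0 ?sqr_ge0 // sqrf_eq0 => /andP[/eqP-> _].
  by rewrite mulr0 mul0r addr0.
have r0 : 0 <= a ^+ 2 + b ^+ 2 by rewrite addr_ge0 ?sqr_ge0.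
pose r := Num.sqrt (a ^+ 2 + b ^+ 2).
have r2 : r ^+ 2 = a ^+ 2 + b ^+ 2 by rewrite sqr_sqrtr.
have rn : r != 0 by rewrite -sqrf_eq0 r2.
exists (b / r), (- a / r); split; last by field.
by rewrite !expr_div_n sqrrN -mulrDl r2 addrC divff.
Qed.

Lemma sum_delta7 (i : nat) (y : nat -> R) : (i < 7)%N ->
  \sum_(k < 7) (i == k)%:R * y k = y i.
Proof.
move=> i7; rewrite (bigD1 (Ordinal i7)) //= eqxx mul1r big1 ?addr0 // => k.
by rewrite -val_eqE /= eq_sym => /negPf->; rewrite mul0r.
Qed.

Lemma rot_mxE i j p q c s (y : nat -> R) (a : 'I_7) :
  (i < 7)%N -> (j < 7)%N -> (p < 7)%N -> (q < 7)%N ->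
  \sum_k rot_mx i j p q c s a k * y k = rot i j p q c s y a.
Proof.
move=> i7 j7 p7 q7; under eq_bigr => k _ do rewrite mxE.
have E u v w z : (u < 7)%N -> (v < 7)%N ->
    \sum_(k < 7) (w * (u == k)%:R + z * (v == k)%:R) * y k = w * y u + z * y v.
  move=> u7 v7; rewrite -(sum_delta7 y u7) -(sum_delta7 y v7) !mulr_sumr -big_split /=.
  by apply: eq_bigr => k _; rewrite mulrDl !mulrA.
rewrite /rot; case: ifP => _; first exact: E.
case: ifP => _; first by under eq_bigr => k _ do rewrite -mulNr; rewrite E // mulNr.
case: ifP => _; first by under eq_bigr => k _ do rewrite -mulNr; rewrite E // mulNr.
case: ifP => _; first exact: E.
exact: sum_delta7.
Qed.

Lemma g2_poly_ext (x y : nat -> 'I_3 -> R) :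
  (forall a r, (a < 7)%N -> x a r = y a r) -> g2_poly x = g2_poly y.
Proof. by move=> H; rewrite /g2_poly /det3 !H. Qed.

Lemma sum7 (F : nat -> R) : \sum_(a <- iota 0 7) F a =
  F 0%N + F 1%N + F 2%N + F 3%N + F 4%N + F 5%N + F 6%N.
Proof. by rewrite /= !big_cons big_nil addr0 !addrA. Qed.

Variable g : vectType R.

Lemma scalar_comb (lam : g -> R) (I : Type) (r : seq I) (c : I -> R) (y : I -> g) :
  scalar lam -> lam (\sum_(i <- r) c i *: y i) = \sum_(i <- r) c i * lam (y i).
Proof.
move=> lin; elim: r => [|i r IH]; last by rewrite !big_cons lin IH.
by rewrite !big_nil; have := lin (-1) 0 0; rewrite scaler0 addr0 /= mulN1r addNr.
Qed.

Lemma rotate_frame (p0 : g2_structure g) b (lam : g -> R) i j p q :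
  g2_planes i j p q -> scalar lam -> frame p0 b ->
  exists c s b', [/\ c * lam b`_i + s * lam b`_j = 0, frame p0 b'
    & forall a, (a < 7)%N -> lam b'`_a = rot i j p q c s (fun k => lam b`_k) a].
Proof.
move=> [i7 j7 p7 q7 H] lin fr.
have [c [s [cs kill]]] := kill_angle (lam b`_i) (lam b`_j).
have [iso pres] := H c s cs; exists c, s.
pose M := rot_mx i j p q c s.
have MM : M^T *m M = 1%:M.
  apply/matrixP => a d; rewrite !mxE.
  transitivity (\sum_(k <- iota 0 7) rot i j p q c s (fun l => (l == a)%:R) k *
    rot i j p q c s (fun l => (l == d)%:R) k).
    have -> : iota 0 7 = index_iota 0 7 by [].
    by rewrite big_mkord; apply: eq_bigr => k _; rewrite !mxE.
  rewrite iso; have -> : iota 0 7 = index_iota 0 7 by [].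
  rewrite big_mkord; under eq_bigr => k _ do rewrite eq_sym.
  by rewrite (sum_delta7 (fun k => (k == d)%:R)).
have MM' := mulmx1C MM.
have [q0 [fE _ _]] := pull_exists fr.1 fr MM.
have [fr' _] := pull_psi fr.1 fr MM' MM fE.
exists (pull_basis b M^T); split=> //.
  split; first exact: fr'.1.
  move=> v; rewrite -fr'.2 fE !fr.2 !standard_g2E -[LHS]pres; apply: g2_poly_ext => a r a7.
  rewrite (coord_emx fr.1).
  have := rot_mxE c s (fun k => coord b (inord k) (v r)) (inord a) i7 j7 p7 q7.
  by rewrite inordK // => <-; apply: eq_bigr => k _; rewrite inord_val.
move=> a a7; rewrite pull_basisE // (emx_basis fr.1 _ (Ordinal a7)).
transitivity (\sum_k M^T k (Ordinal a7) * lam b`_k).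
  by rewrite (scalar_comb _ _ _ lin).
rewrite -(rot_mxE c s (fun k => lam b`_k) (Ordinal a7)) //.
by apply: eq_bigr => k _; rewrite mxE.
Qed.

(** Through an index k pass three lines {k, i, j}, {k, p, q}, {k, m, n}. Opposite
    rotations of the planes (i, j) and (p, q) leave the term [l] of the third line
    unchanged and multiply the sum of the other six terms by c^2 + s^2. *)
Lemma g2_planesP i j p q (l : (nat -> 'I_3 -> R) -> R) :
  [&& i < 7, j < 7, p < 7 & q < 7]%N ->
  (forall c s y z, \sum_(a <- iota 0 7) rot i j p q c s y a * rot i j p q c s z a -
     \sum_(a <- iota 0 7) y a * z a =
     (c ^+ 2 + s ^+ 2 - 1) * (y i * z i + y j * z j + y p * z p + y q * z q)) ->
  (forall c s x, g2_poly (fun a r => rot i j p q c s (x^~ r) a) - g2_poly x =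
     (c ^+ 2 + s ^+ 2 - 1) * (g2_poly x - l x)) ->
  g2_planes i j p q.
Proof.
case/and4P=> i7 j7 p7 q7 H K; split=> // c s cs.
split=> [y z|x]; apply/eqP; rewrite -subr_eq0; [rewrite H|rewrite K].
  by rewrite cs subrr mul0r.
by rewrite cs subrr mul0r.
Qed.

Lemma planes_60_13 : g2_planes 6 0 1 3.
Proof.
by apply: (g2_planesP (l := fun x => - det3 x 2 4 5)) => // [c s y z|c s x];
  [rewrite !sum7 | rewrite /g2_poly /det3]; rewrite /rot /=; ring.
Qed.

Lemma planes_50_14 : g2_planes 5 0 1 4.
Proof.
by apply: (g2_planesP (l := fun x => - det3 x 2 3 6)) => // [c s y z|c s x];
  [rewrite !sum7 | rewrite /g2_poly /det3]; rewrite /rot /=; ring.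
Qed.

Lemma planes_12_56 : g2_planes 1 2 5 6.
Proof.
by apply: (g2_planesP (l := fun x => det3 x 0 3 4)) => // [c s y z|c s x];
  [rewrite !sum7 | rewrite /g2_poly /det3]; rewrite /rot /=; ring.
Qed.

Lemma planes_34_56 : g2_planes 3 4 5 6.
Proof.
by apply: (g2_planesP (l := fun x => det3 x 0 1 2)) => // [c s y z|c s x];
  [rewrite !sum7 | rewrite /g2_poly /det3]; rewrite /rot /=; ring.
Qed.

Lemma planes_42_13 : g2_planes 4 2 1 3.
Proof.
by apply: (g2_planesP (l := fun x => det3 x 0 5 6)) => // [c s y z|c s x];
  [rewrite !sum7 | rewrite /g2_poly /det3]; rewrite /rot /=; ring.
Qed.

Lemma planes_20_35 : g2_planes 2 0 3 5.
Proof.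
by apply: (g2_planesP (l := fun x => - det3 x 1 4 6)) => // [c s y z|c s x];
  [rewrite !sum7 | rewrite /g2_poly /det3]; rewrite /rot /=; ring.
Qed.

(** The group G2 acts transitively on the unit sphere of R^7, so that a frame
    can be turned until a given hyperplane is spanned by its last six vectors. *)
Lemma frame_kernel (p : g2_structure g) (lam : g -> R) : scalar lam ->
  exists b, frame p b /\ forall j, j \in iota 1 6 -> lam b`_j = 0.
Proof.
move=> lin; have [b0 fr0] := frame_exists p.
(* Each rotation kills one value of [lam]; the order is such that the values that
   are already zero are fixed or rotated among themselves. *)
have [c1 [s1 [b1 [k1 fr1 l1]]]] := rotate_frame planes_60_13 lin fr0.
have [c2 [s2 [b2 [k2 fr2 l2]]]] := rotate_frame planes_50_14 lin fr1.
have [c3 [s3 [b3 [k3 fr3 l3]]]] := rotate_frame planes_12_56 lin fr2.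
have [c4 [s4 [b4 [k4 fr4 l4]]]] := rotate_frame planes_34_56 lin fr3.
have [c5 [s5 [b5 [k5 fr5 l5]]]] := rotate_frame planes_42_13 lin fr4.
have [c6 [s6 [b6 [k6 fr6 l6]]]] := rotate_frame planes_20_35 lin fr5.
have e6 : lam b1`_6 = 0 by rewrite l1.
have [e26 e25] : lam b2`_6 = 0 /\ lam b2`_5 = 0 by rewrite !l2 // /rot /= e6 k2.
have [e36 e35 e31] : [/\ lam b3`_6 = 0, lam b3`_5 = 0 & lam b3`_1 = 0].
  by rewrite !l3 // /rot /= e26 e25 k3 !mulr0 subrr addr0.
have [e46 e45 e41 e43] : [/\ lam b4`_6 = 0, lam b4`_5 = 0, lam b4`_1 = 0 & lam b4`_3 = 0].
  by rewrite !l4 // /rot /= e36 e35 e31 k4 !mulr0 subrr addr0.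
have [e56 e55 e51 [e53 e54]] : [/\ lam b5`_6 = 0, lam b5`_5 = 0, lam b5`_1 = 0 &
    lam b5`_3 = 0 /\ lam b5`_4 = 0].
  by rewrite !l5 // /rot /= e46 e45 e41 e43 k5 !mulr0 subrr addr0.
exists b6; split=> // j; rewrite mem_iota => /andP[j1 j7].
rewrite l6 // /rot; case: j j1 j7 => [|[|[|[|[|[|[|//]]]]]]] //= _ _;
  by rewrite ?k6 ?e56 ?e55 ?e51 ?e53 ?e54 ?mulr0 ?subrr ?addr0.
Qed.

End Rotations.

Section AdaptedFrame.
Variables (R : realType) (g : vectType R) (br : g -> g -> g).

Lemma hyperplane_functional (h : {vspace g}) : (\dim h).+1 = \dim {:g} ->
  exists lam : g -> R, scalar lam /\ forall x, (lam x = 0 <-> x \in h).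
Proof.
move=> dh; have d1 : \dim h^C = 1%N by rewrite dimv_compl -dh subSnn.
pose x0 := vpick h^C; have x00 : x0 != 0 by rewrite vpick0 -dimv_eq0 d1.
have hC : (h^C = <[x0]>)%VS.
  apply/eqP; rewrite eq_sym eqEdim -memvE memv_pick /= d1 dim_vline x00 //.
pose pr := (\1 - projv h)%VF; have prE x : pr x = x - projv h x.
  by rewrite add_lfunE opp_lfunE id_lfunE.
exists (fun x => coord [tuple x0] ord0 (pr x)); split=> [c x y|x].
  by rewrite !linearP.
have fx : free [tuple x0] by rewrite seq1_free.
have /vlineP[k prx] : pr x \in <[x0]>%VS by rewrite prE -hC memv_projC.
have -> : coord [tuple x0] ord0 (pr x) = k.
  rewrite prx linearZ /= -[X in coord _ _ X]/([tuple x0]`_(@ord0 0)) coord_free // eqxx.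
  by rewrite mulr1.
split=> [k0|xh].
  have <- : projv h x = x by apply/eqP; rewrite eq_sym -subr_eq0 -prE prx k0 scale0r.
  exact: memv_proj.
move/eqP: prx; rewrite prE projv_id // subrr eq_sym scaler_eq0 (negPf x00) orbF.
by move/eqP.
Qed.

Lemma abelian_frame_exists p : lie_bracket br -> almost_abelian br ->
  exists b A, frame p b /\ abelian_frame br b A.
Proof.
move=> [lr ll _ _] [h [dh ih ah]].
have [lam [lin lamE]] := hyperplane_functional dh.
have [b [fr l0]] := frame_kernel p lin; have bb := fr.1.
have bh j : j \in iota 1 6 -> b`_j \in h by move=> j6; apply/lamE; exact: l0.
have lamx x : lam x = coord b ord0 x * lam b`_0.
  rewrite {1}(coord_basis bb (memvf x)) (scalar_comb _ _ _ lin) (bigD1 ord0) //=.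
  rewrite [X in _ + X]big1 ?addr0 // => j j0; rewrite l0 ?mulr0 // mem_iota.
  by rewrite lt0n -val_eqE /= in j0 *; rewrite j0 /=.
have lam0 : lam b`_0 != 0.
  apply/eqP => b00; have : (fullv <= h)%VS.
    by apply/subvP => x _; apply/lamE; rewrite lamx b00 mulr0.
  by move/dimvS; rewrite -dh ltnn.
exists b, (fun z j => coord b (inord z) (br b`_0 b`_j)); split=> //; split.
  by move=> i j i6 j6; rewrite ah ?bh.
move=> j j6; apply: ideal_expand bb _ _.
have /lamE/eqP : br b`_0 b`_j \in h by rewrite ih ?bh.
by rewrite lamx mulf_eq0 (negPf lam0) orbF => /eqP.
Qed.

Lemma adapted_exists p : lie_bracket br -> almost_abelian br -> coclosed br p ->
  exists K, adapted br K p.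
Proof.
move=> lie aa cc; have [b [A [fr frA]]] := abelian_frame_exists p lie aa.
have [x frx] := coclosed_symplectic fr frA cc.
by exists (normA x), b, x; split.
Qed.

End AdaptedFrame.

(** * Gluing the local solutions *)

Section Gluing.
Variables (R : realType) (g : vectType R) (br : g -> g -> g).
Implicit Types (P : R -> g2_structure g) (a b : \bar R) (t s : R).

Lemma near_between a b t : (a < t%:E)%E -> (t%:E < b)%E ->
  \forall s \near t, (a < s%:E)%E /\ (s%:E < b)%E.
Proof.
move=> ta tb; have Ha : \forall s \near t, (a < s%:E)%E.
  case: a ta => [r| |] //; rewrite ?lte_fin => rt; first exact: lt_nbhsr.
  by near=> s; exact: ltNyr.
have Hb : \forall s \near t, (s%:E < b)%E.
  case: b tb => [r| |] //; rewrite ?lte_fin => rt; first exact: lt_nbhsl.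
  by near=> s; exact: ltry.
by near=> s; split; near: s.
Unshelve. all: by end_near.
Qed.

Lemma between_0 a b t u : (a < 0%:E)%E -> (0%:E < b)%E -> (a < t%:E)%E -> (t%:E < b)%E ->
  Num.min 0 t <= u <= Num.max 0 t -> (a < u%:E)%E /\ (u%:E < b)%E.
Proof.
move=> a0 b0 ta tb /andP[u1 u2]; split.
- apply: (@lt_le_trans _ _ (Num.min 0 t)%:E); last by rewrite lee_fin.
  by case/orP: (le_total 0 t) => h; [rewrite min_l|rewrite min_r].
- apply: (@le_lt_trans _ _ (Num.max 0 t)%:E); first by rewrite lee_fin.
  by case/orP: (le_total 0 t) => h; [rewrite max_r|rewrite max_l].
Qed.

Lemma flow_at_congr P P' t : (\forall s \near t, g2_form (P s) =1 g2_form (P' s)) ->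
  flow_at br P t -> flow_at br P' t.
Proof.
move=> PP' [cP dP]; have Pt := nbhs_singleton PP'.
split=> v.
  have E : g2_form (P' t) v = g2_form (P t) v by rewrite Pt.
  rewrite /prop_for /continuous_at /= E; apply: cvg_trans (cP v).
  apply: near_eq_cvg; near=> s; have -> // : g2_form (P' s) v = g2_form (P s) v.
  by have H : g2_form (P s) =1 g2_form (P' s) by near: s.
have [mE vE] := g2_form_inj Pt; have sE := psi_inj Pt.
have -> : hodge_laplacian4 br (P' t) (psi (P' t)) v = hodge_laplacian4 br (P t) (psi (P t)) v.
  by rewrite /hodge_laplacian4 /codiff4 /codiff5 mE vE sE.
apply: near_eq_is_derive (dP v).
near=> s; have H : g2_form (P s) =1 g2_form (P' s) by near: s.
by rewrite (psi_inj H).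
Unshelve. all: by end_near.
Qed.

Lemma flow_at_shift P c t : flow_at br P (t - c) -> flow_at br (fun s => P (s - c)) t.
Proof.
have dsub : is_derive t (1 : R) (fun s => s - c) 1.
  rewrite -[X in is_derive _ _ _ X]subr0; apply: is_deriveB; exact: is_derive_cst.
move=> [cP dP]; split=> v.
  exact: (continuous_comp (is_derive_continuous dsub) (cP v)).
have := @is_derive1_comp R (fun s => psi (P s) v) (fun s => s - c) t _ _ (dP v) dsub.
by rewrite mulr1.
Qed.

(** The bound on the bracket is preserved, so that the local solution can be
    continued by the same amount of time again and again. *)
Lemma long_flow K p : lie_bracket br -> adapted br K p ->
  exists2 T : R, 0 < T & forall n : nat, exists P, g2_form (P 0) =1 g2_form p /\
    forall t, - T < t < T + n%:R * (T / 2) -> flow_at br P t /\ (0 <= t -> adapted br K (P t)).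
Proof.
move=> [lr ll l0 _] ap.
have [T T0 HT] := local_flow (And3 lr ll l0) K; exists T => //; elim=> [|n [P [P0 HP]]].
  have [P [P0 HP]] := HT p ap; exists P; split=> // t.
  by rewrite mul0r addr0 -ltr_norml; exact: HP.
have T20 : 0 < T / 2 by rewrite divr_gt0.
have TE : T = T / 2 + T / 2 by rewrite -splitr.
set h := T / 2 in T20 TE HP *.
have nh : 0 <= n%:R * h by rewrite mulr_ge0 ?ler0n // ltW.
(* Restarting half a step before the end leaves an interval on which both
   solutions are defined. *)
pose s := n%:R * h + h.
have s0 : 0 <= s by rewrite addr_ge0 // ltW.
have [_ as_] : flow_at br P s /\ (0 <= s -> adapted br K (P s)).
  by apply: HP; rewrite /s; apply/andP; split; lra.
have [P' [P'0 HP']] := HT (P s) (as_ s0).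
have PP' t : `|t - s| < h -> g2_form (P t) =1 g2_form (P' (t - s)).
  move=> ts; apply: (@flow_unique R g br P (fun u => P' (u - s)) s t) => [u Ju|]; last first.
    by move=> v; rewrite subrr P'0.
  have us : `|u - s| < h.
    move: ts Ju; rewrite !ltr_norml ge_min le_max => /andP[t1 t2] /andP[/orP u1 /orP u2].
    by apply/andP; split; case: u1; case: u2; lra.
  split.
    have [] // := HP u; move: us; rewrite ltr_norml /s => /andP[u1 u2].
    by apply/andP; split; lra.
  apply: flow_at_shift; have [] // := HP' (u - s).
  by apply: lt_trans us _; rewrite TE ltrDl.
exists (fun t => if t < s + h then P t else P' (t - s)); split.
  by rewrite ifT //; rewrite ltr_wpDl.
rewrite -natr1 mulrDl mul1r => t /andP[Tt tT].
have [tsh|sht] := ltP t (s + h).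
  have [|ft at_] := HP t; first by apply/andP; split=> //; move: tsh; rewrite /s; lra.
  split=> //; apply: flow_at_congr ft.
  have near_t : \forall u \near t, u < s + h by apply: lt_nbhsl.
  by near=> u; rewrite ifT //; near: u.
have ts : `|t - s| < T by rewrite ger0_norm; [move: tT; rewrite /s; lra|lra].
have [ft at_] := HP' (t - s) ts; split.
  apply: flow_at_congr (flow_at_shift ft).
  have near_t : \forall u \near t, s < u by apply: lt_nbhsr; lra.
  near=> u; have su : s < u by near: u.
  case: ltP => // ush v; rewrite PP' // ger0_norm; lra.
by move=> _; apply: at_; lra.
Unshelve. all: by end_near.
Qed.

Section Maximal.
Variable p : g2_structure g.

Definition covers t P := exists a b,
  [/\ coflow_solution br p a b P, (a < t%:E)%E & (t%:E < b)%E].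

Lemma covers_unique t P P' : covers t P -> covers t P' -> g2_form (P t) =1 g2_form (P' t).
Proof.
move=> [a [b [[a0 b0 P0 fP] ta tb]]] [a' [b' [[a'0 b'0 P'0 fP'] ta' tb']]].
apply: (@flow_unique R g br P P' 0 t) => [u Ju|v]; last by rewrite P0 P'0.
have [u1 u2] := between_0 a0 b0 ta tb Ju.
have [u3 u4] := between_0 a'0 b'0 ta' tb' Ju.
by split; [exact: fP|exact: fP'].
Qed.

(** By uniqueness all solutions are restrictions of their union, whose interval starts
    at the infimum of the intervals of the solutions. *)
Lemma maximal_solution : (forall b : R, 0 < b -> exists (a : R) P, a < 0 /\
    coflow_solution br p a%:E b%:E P) ->
  exists eps1 : \bar R, (eps1 < 0%:E)%E /\
    exists Phi : R -> g2_structure g, maximal_coflow_solution br p eps1 (+oo)%E Phi.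
Proof.
move=> H; pose E : set \bar R := fun a => exists b P, coflow_solution br p a b P.
pose eps1 := ereal_inf E; exists eps1.
have lb a : E a -> (eps1 <= a)%E by exact: ereal_inf_lbound.
have e0 : (eps1 < 0%:E)%E.
  have [a [P [a0 sol]]] := H 1 ltr01; apply: (@le_lt_trans _ _ a%:E); last by rewrite lte_fin.
  by apply: lb; exists 1%:E, P.
split=> //.
have cov t : (eps1 < t%:E)%E -> exists P, covers t P.
  move=> et; have [t0|t0] := leP 0 t.
    have [a [P [a0 sol]]] := H (t + 1) (ltr_wpDl t0 ltr01); exists P, a%:E, (t + 1)%:E; split=> //.
      by rewrite lte_fin; exact: lt_le_trans t0.
    by rewrite lte_fin ltrDl.
  have [a [b [P sol]] at_] := ereal_inf_lt et.
  exists P, a, b; split=> //; case: sol => _ b0 _ _.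
  by apply: lt_trans b0; rewrite lte_fin.
have /choice[Q HQ] : forall t, exists P, (eps1 < t%:E)%E -> covers t P.
  move=> t; have [/cov[P cP]|ne] := pselect (eps1 < t%:E)%E; first by exists P.
  by exists (fun=> p) => /ne.
pose Phi t := Q t t; exists Phi.
have PhiE t P : covers t P -> g2_form (P t) =1 g2_form (Phi t).
  move=> cP; have [a [b [sol ta tb]]] := cP.
  apply: covers_unique cP (HQ t _).
  by apply: le_lt_trans ta; apply: lb; exists b, P.
split; last first.
  move=> a b P sol; split; first by apply: lb; exists b, P.
    exact: leey.
  by move=> t ta tb; apply: PhiE; exists a, b.
split=> [| | |t et _].
- exact: e0.
- exact: ltry.
- have [P [a [b [sol ta tb]]]] := cov 0 e0.
  have [_ _ P0 _] := sol; move=> v; rewrite -P0; apply/esym/PhiE.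
  by exists a, b.
have [P [a [b [sol ta tb]]]] := cov t et; have [_ _ _ fP] := sol.
apply: (@flow_at_congr P Phi t) (fP t ta tb).
have nt := near_between ta tb.
near=> s; have [sa sb] : (a < s%:E)%E /\ (s%:E < b)%E by near: s.
by apply: PhiE; exists a, b.
Unshelve. all: by end_near.
Qed.

End Maximal.
End Gluing.

Theorem theorem1p1 (R : realType) (g : vectType R) (br : g -> g -> g)
    (dim_g : \dim {:g} = 7%N)
    (br_lie : lie_bracket br)
    (br_aa : almost_abelian br)
    (phi : g2_structure g)
    (phi_coclosed : coclosed br phi)
    (phi_not_flat : ~ flat br (g2_metric phi)) :
  exists eps1 : \bar R, (eps1 < 0%:E)%E /\
    exists Phi : R -> g2_structure g,
      maximal_coflow_solution br phi eps1 (+oo)%E Phi.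
Proof.
have [K aK] := adapted_exists br_lie br_aa phi_coclosed.
have [T T0 HT] := long_flow br_lie aK.
apply: maximal_solution => b b0.
have T2 : 0 < T / 2 by rewrite divr_gt0.
have [n bn] : exists n : nat, b < T + n%:R * (T / 2).
  exists (Num.truncn (b / (T / 2))).+1.
  have := truncnS_gt (b / (T / 2)); rewrite ltr_pdivrMr // => h.
  by apply: lt_trans h _; rewrite ltrDr.
have [P [P0 HP]] := HT n; exists (- T), P; rewrite oppr_lt0; split; first exact: T0.
split=> [| | |t]; rewrite ?lte_fin ?oppr_lt0; [exact: T0|exact: b0|exact: P0|] => Tt tb.
have inT : - T < t < T + n%:R * (T / 2) by rewrite Tt (lt_trans tb bn).
exact: (HP t inT).1.
Qed.
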